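(* In the setting described in the context (with $E_{\theta^*}u(\theta,x)=-\nabla D(\theta)$), assume that: (d1) $D$ has an isolated stationary point at $\theta=\theta^*$, and Lipschitz gradient in a neighborhood of this point; (d2) $D$ is twice differentiable at $\theta=\theta^*$, with positive definite Hessian at this point; (u1) in a neighborhood of $\theta^*$, the function $V(\theta)=E_{\theta^*}\Vert u(\theta,x)\Vert^2$ is uniformly bounded. Assume moreover that the recursive estimates $\theta_n$ are stable (all the $\theta_n$ lie in $\Theta^*$, almost surely), and that $\gamma_n=\frac{a}{n}$ where $2\lambda a>1$, with $\lambda>0$ the smallest eigenvalue of the Hessian matrix $H$ of $D$ at $\theta^*$ in normal coordinates. Then $$\mathbb{E}\,d^2(\theta_n,\theta^* )=O\left(n^{-1}\right).$$
   Context: Setting. $\Theta$ is a $C^r$ Riemannian manifold ($r>3$) of dimension $d$, with metric $\langle\cdot,\cdot\rangle$, norm $\Vert\cdot\Vert$, Riemannian distance $d(\cdot,\cdot)$, Riemannian exponential map $\mathrm{Exp}$, and Riemannian gradient $\nabla$. $X$ is a measurable space, and $\{P_\theta;\theta\in\Theta\}$ is a family of probability distributions on $X$. On a complete probability space $(\Omega,\mathcal F,\mathbb P)$, $(x_n;n=1,2,\ldots)$ are i.i.d. random variables with values in $X$ and distribution $P_{\theta^*}$ for some $\theta^*\in\Theta$ (the true parameter). $\mathbb{E}$ is expectation under $\mathbb{P}$, and $E_{\theta^*}$ is expectation with respect to $x\sim P_{\theta^*}$. $D(\theta)=D(P_{\theta^*},P_\theta)$ is a divergence function: $D\geq 0$,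 equal to zero if and only if $P_\theta=P_{\theta^*}$, with positive definite Hessian at $\theta=\theta^*$. For each $x\in X$, $u(\theta,x)$ is a continuous vector field on $\Theta$, and $E_{\theta^*}u(\theta,x)=-\nabla D(\theta)$. Algorithm: starting from an initial guess $\theta_0\in\Theta$, $\theta_{n+1}=\mathrm{Exp}_{\theta_n}(\gamma_{n+1}u(\theta_n,x_{n+1}))$ for $n=0,1,\ldots$, where the step sizes $\gamma_n$ are strictly positive and decreasing, with $\sum\gamma_n=\infty$ and $\sum\gamma_n^2<\infty$. The $\theta_n$ are called recursive estimates. $\Theta^*$ is a fixed compact and convex neighborhood of $\theta^*$ on which the assumed local conditions hold: $\theta^*$ is the only stationary point of $D$ in $\Theta^*$, $\nabla D$ is Lipschitz on $\Theta^*$, and $V$ is bounded on $\Theta^*$. Convex means that any two points of $\Theta^*$ are joined by a unique minimizing geodesic, which lies in $\Theta^*$. $\Theta^*$ admits normal coordinates $(\theta^\alpha;\alpha=1,\ldots,d)$ with origin at $\theta^*$ (components of $\mathrm{Exp}_{\theta^*}^{-1}(\theta)$ in an orthonormal basis of $T_{\theta^*}\Theta$). The Hessian matrix is $H=(H_{\alpha\beta})$, $H_{\alpha\beta}=\frac{\partial^2D}{\partial\theta^\alpha\partial\theta^\beta}\big|_{\theta^\alpha=0}$. A vector field $Y$ is Lipschitz with constant $L$ on a convex set if $\Vert \Pi Y(\theta)-Y(\tau)\Vert\leq L\,d(\theta,\tau)$ for all $\theta,\tau$ in the set, $\Pi$ being parallel transport along the minimizing geodesic from $\theta$ to $\tau$.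 *)

(* Defs.v *)
From HB Require Import structures.
From mathcomp Require Import all_boot all_order all_algebra.
From mathcomp Require Import all_classical all_reals all_analysis.

Set Implicit Arguments.
Unset Strict Implicit.
Unset Printing Implicit Defensive.

Import Order.TTheory GRing.Theory Num.Theory.
Import numFieldNormedType.Exports.
Local Open Scope classical_set_scope.
Local Open Scope ring_scope.

Section Calculus.
Context {R : realType}.

Definition basis_vec {n} (i : 'I_n) : 'rV[R]_n := delta_mx 0 i.

(* Intended for open U. *)
Fixpoint Ck {n} (k : nat) (U : set 'rV[R]_n) (f : 'rV[R]_n -> R) : Prop :=
  (forall x, U x -> {for x, continuous f}) /\
  match k with
  | 0%N => True
  | k'.+1 => forall i : 'I_n,
      (forall x, U x -> derivable f x (basis_vec i)) /\
      Ck k' U (fun x => 'D_(basis_vec i) f x)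
  end.

Definition Ck_map {n m} (k : nat) (U : set 'rV[R]_n)
    (f : 'rV[R]_n -> 'rV[R]_m) : Prop :=
  forall j : 'I_m, Ck k U (fun x => f x 0 j).

Definition twice_differentiable {n} (f : 'rV[R]_n -> R) (x : 'rV[R]_n) : Prop :=
  (\forall y \near x, differentiable f y) /\
  (forall i : 'I_n, differentiable (fun y => 'D_(basis_vec i) f y) x).

Definition hessian {n} (f : 'rV[R]_n -> R) (x : 'rV[R]_n) : 'M[R]_n :=
  \matrix_(i, j) 'D_(basis_vec i) (fun y => 'D_(basis_vec j) f y) x.

Definition positive_definite {n} (A : 'M[R]_n) : Prop :=
  A^T = A /\ forall v : 'rV[R]_n, v != 0 -> 0 < (v *m A *m v^T) 0 0.

Definition smallest_eigenvalue {n} (A : 'M[R]_n) (lam : R) : Prop :=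
  eigenvalue A lam /\ forall mu : R, eigenvalue A mu -> lam <= mu.

End Calculus.

(* The C^r structure is generated by an atlas with one selected chart around
   each point (several points may share the same chart).  [metric p x] is the
   Gram matrix of the metric in the chart selected at [p], at the point with
   coordinates [x]; coordinate vectors are rows, so a vector v becomes
   v *m jacobian f x under f.  Only a C^(r-1) metric makes sense in a C^r
   structure.  [chart p] and [param p] are irrelevant off [dom p] and off its
   image. *)
Record riemannian_manifold (R : realType) (r d : nat) := RiemannianManifold {
  carrier :> topologicalType ;
  _ : hausdorff_space carrier ;
  _ : @second_countable carrier ;
  dom : carrier -> set carrier ;
  chart : carrier -> carrier -> 'rV[R]_d ;
  param : carrier -> 'rV[R]_d -> carrier ;
  _ : forall p, open (dom p) /\ dom p p ;
  _ : forall p, open (chart p @` dom p) ;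
  _ : forall p q, dom p q ->
        [/\ param p (chart p q) = q,
            {for q, continuous (chart p)}
          & {for chart p q, continuous (param p)}] ;
  _ : forall p q, Ck_map r (chart p @` (dom p `&` dom q)) (chart q \o param p) ;
  metric : carrier -> 'rV[R]_d -> 'M[R]_d ;
  _ : forall p i j, Ck r.-1 (chart p @` dom p) (fun x => metric p x i j) ;
  _ : forall p q, dom p q -> positive_definite (metric p (chart p q)) ;
  _ : forall p q o, dom p o -> dom q o ->
        let J := jacobian (chart q \o param p) (chart p o) in
        metric p (chart p o) = J *m metric q (chart q o) *m J^T
}.

Section Geometry.
Context {R : realType} {r d : nat} {M : riemannian_manifold R r d}.
Implicit Types (p q : M) (v w : 'rV[R]_d) (c : R -> M) (A : set M)
  (J : set R) (Y : M -> 'rV[R]_d) (f : M -> R).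

(* The tangent space at p is 'rV_d, read in the chart selected at p.  Hence a
   vector field is a function Y : M -> 'rV_d, Y p being a vector at p. *)

(* components in the chart selected at p of the tangent vector v at q *)
Definition components p q v : 'rV[R]_d :=
  v *m jacobian (chart p \o param q) (chart q q).

Definition inner p v w : R := (v *m metric p (chart p p) *m w^T) 0 0.
Definition tnorm p v : R := Num.sqrt (inner p v v).

Definition continuous_field Y : Prop :=
  forall p q, dom p q -> {for q, continuous (fun o => components p o (Y o))}.

Definition differentiable_at f p : Prop :=
  differentiable (f \o param p) (chart p p).

Definition grad f p : 'rV[R]_d :=
  (\row_i 'D_(basis_vec i) (f \o param p) (chart p p))
    *m invmx (metric p (chart p p)).

Definition christoffel p (x : 'rV[R]_d) (k i j : 'I_d) : R :=
  let dg l a b := 'D_(basis_vec l) (fun y => metric p y a b) x in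
  2^-1 * \sum_l invmx (metric p x) k l * (dg i j l + dg j i l - dg l i j).

Definition velocity c (t : R) : 'rV[R]_d := derive1 (chart (c t) \o c) t.

Definition C1_curve J c : Prop :=
  forall t, J t -> {for t, continuous c} /\
    forall p, dom p (c t) ->
      derivable (chart p \o c) t 1 /\ {for t, continuous (derive1 (chart p \o c))}.

Definition C1_segment (a b : R) c : Prop :=
  exists J, [/\ open J, `[a, b] `<=` J & C1_curve J c].

Definition curve_length (a b : R) c : R :=
  \int[lebesgue_measure]_(t in `[a, b]) tnorm (c t) (velocity c t).

(* piecewise C^1 paths from p to q, with their length l *)
Inductive path_length : M -> M -> R -> Prop :=
| path_nil p : path_length p p 0
| path_cons c (a b : R) q l : a <= b -> C1_segment a b c ->
    path_length (c b) q l -> path_length (c a) q (curve_length a b c + l).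

(* +oo when p and q lie in different components *)
Definition dist p q : \bar R :=
  ereal_inf [set l%:E | l in [set l | path_length p q l]].

(* W t is a tangent vector at c t, and nabla_(c') W = 0 on J. *)
Definition parallel J c (W : R -> 'rV[R]_d) : Prop :=
  forall p t, J t -> dom p (c t) -> forall k : 'I_d,
    let Wp s := components p (c s) (W s) in
    is_derive t 1 (fun s => Wp s 0 k)
      (- \sum_i \sum_j christoffel p (chart p (c t)) k i j
           * components p (c t) (velocity c t) 0 i * Wp t 0 j).

Definition geodesic J c : Prop := C1_curve J c /\ parallel J c (velocity c).

Definition geodesic_segment c : Prop :=
  exists J, [/\ open J, `[0, 1] `<=` J & geodesic J c].

(* Exp_p v = q *)
Definition is_Exp p v q : Prop :=
  exists c, [/\ geodesic_segment c, c 0 = p, velocity c 0 = v & c 1 = q].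

Definition minimizing_geodesic p q c : Prop :=
  [/\ geodesic_segment c, c 0 = p, c 1 = q
    & (curve_length 0 1 c)%:E = dist p q].

Definition geodesically_convex A : Prop :=
  forall p q, A p -> A q -> exists c,
    [/\ minimizing_geodesic p q c,
        forall t, 0 <= t <= 1 -> A (c t)
      & forall c', minimizing_geodesic p q c' ->
          forall t, 0 <= t <= 1 -> c' t = c t].

(* w at c 1 is the parallel transport of v at c 0 along c *)
Definition is_transport c v w : Prop :=
  exists J W, [/\ open J, `[0, 1] `<=` J, parallel J c W, W 0 = v & W 1 = w].

Definition lipschitz_field A Y : Prop :=
  exists L : R, forall p q c, A p -> A q -> minimizing_geodesic p q c ->
    exists w, is_transport c (Y p) w /\
      ((tnorm q (w - Y q))%:E <= L%:E * dist p q)%E.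

(* The rows of e form an orthonormal basis of the tangent space at o;
   nu y = Exp_o (\sum_a y_a e_a) is a diffeomorphism from a star-shaped open
   set U onto a neighbourhood of A (the exponential map of a C^(r-1) metric is
   C^(r-2)), kappa is its inverse, and on A the components kappa are those of
   Exp_o^-1, the initial velocity of the minimizing geodesic from o. *)
Definition normal_coordinates A (o : M) (e : 'M[R]_d)
    (kappa : M -> 'rV[R]_d) (nu : 'rV[R]_d -> M) : Prop :=
  [/\ e *m metric o (chart o o) *m e^T = 1%:M,
      exists U : set 'rV[R]_d,
        [/\ [/\ open U, U 0 &
                forall y (t : R), U y -> 0 <= t <= 1 -> U (t *: y)],
            forall y, U y -> is_Exp o (y *m e) (nu y) /\ kappa (nu y) = y,
            open (nu @` U) /\ A `<=` nu @` U,
            forall y, U y -> {for y, continuous nu}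
          & forall p,
              Ck_map r.-2 (U `&` nu @^-1` dom p) (chart p \o nu) /\
              Ck_map r.-2 (chart p @` (dom p `&` nu @` U)) (kappa \o param p)]
    & forall p, A p -> exists c,
        minimizing_geodesic o p c /\ velocity c 0 = kappa p *m e].

End Geometry.

Section Probability.
Context {R : realType}.

Definition independent_family {dO dX} {Omega : measurableType dO}
    {X : measurableType dX} (Pr : probability Omega R)
    (x : nat -> Omega -> X) : Prop :=
  forall (J : seq nat) (B : nat -> set X), uniq J ->
    (forall i, measurable (B i)) ->
    fine (Pr (\bigcap_(i in [set` J]) (x i @^-1` B i))) =
      \prod_(i <- J) fine (Pr (x i @^-1` B i)).

Definition iid {dO dX} {Omega : measurableType dO} {X : measurableType dX}
    (Pr : probability Omega R) (Q : probability X R)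
    (x : nat -> Omega -> X) : Prop :=
  [/\ forall n, measurable_fun setT (x n),
      forall n B, measurable B -> Pr (x n @^-1` B) = Q B
    & independent_family Pr x].

(* T is a statistic of x_1, ..., x_n: it is measurable, for the Borel sets of
   M, with respect to the sigma-algebra generated by x_1, ..., x_n. *)
Definition statistic {dX} {Omega : Type} {X : measurableType dX}
    {M : topologicalType} (x : nat -> Omega -> X) (n : nat)
    (T : Omega -> M) : Prop :=
  forall O : set M, open O ->
    <<s \bigcup_(k in [set k | (0 < k <= n)%N])
          [set x k @^-1` B | B in measurable] >> (T @^-1` O).

(* E_Q Y(x) = y, the expectation being taken componentwise *)
Definition has_mean {dX} {X : measurableType dX} {d : nat}
    (Q : probability X R) (Y : X -> 'rV[R]_d) (y : 'rV[R]_d) : Prop :=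
  forall i : 'I_d, Q.-integrable setT (fun x => (Y x 0 i)%:E) /\
    \int[Q]_x (Y x 0 i) = y 0 i.

Definition step_sizes (gamma : nat -> R) : Prop :=
  [/\ forall n, (0 < n)%N -> 0 < gamma n,
      forall m n, (0 < m <= n)%N -> gamma n <= gamma m,
      (fun n => \sum_(1 <= k < n) gamma k) @ \oo --> +oo
    & cvg ((fun n => \sum_(1 <= k < n) gamma k ^+ 2) @ \oo)].

End Probability.

(* Main.v *)
(* The rate is read off the Lyapunov function W = D exp(K D).  In normal
   coordinates at theta^*, |grad D|^2 >= beta D near theta^* for every
   beta < 2 lambda; away from theta^*, compactness and stationarity bound
   |grad D| below.  For K large this gives W'(D) |grad D|^2 >= beta W on the whole
   of Theta^*.  Since grad D is Lipschitz along geodesics, one step of the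
   algorithm increases W by at most gamma W'(D) <grad D, u> + C gamma^2 |u|^2.
   The observation x_{n+1} is independent of theta_n, so taking expectations
   E W_{n+1} <= (1 - beta gamma_{n+1}) E W_n + C' gamma_{n+1}^2.  With
   gamma_n = a / n and beta a > 1 this recursion forces E W_n = O(1/n), and
   d^2(theta, theta^* ) is bounded by a multiple of D <= W on Theta^*.

   As u(theta, x) is only continuous in theta and measurable in x, the expectation
   given theta_n is computed by approximating theta_n by statistics with finitely
   many values and passing to the limit with Fatou's lemma. *)
Require Import Defs.
From HB Require Import structures.
From mathcomp Require Import all_boot all_order all_algebra.
From mathcomp Require Import all_classical all_reals all_analysis.
From mathcomp Require Import measurable_realfun simple_functions measurable_fun_approximation.
From mathcomp Require Import ring lra.

Set Implicit Arguments.
Unset Strict Implicit.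
Unset Printing Implicit Defensive.

Import Order.TTheory GRing.Theory Num.Theory.
Import numFieldNormedType.Exports.
Local Open Scope classical_set_scope.
Local Open Scope ring_scope.

(** The delicate step is the increment of D. The Lipschitz condition speaks only of minimizing
    geodesics between points of Theta^* , whereas the curve of an Exp step need neither minimize nor
    stay in Theta^* . The two curves have the same endpoints, and in a chart each displacement is
    its initial velocity up to a quadratic error; so the initial velocities agree to that order and
    D can be expanded along the minimizing geodesic. This covers short steps. For long ones a bound
    C |v|^2 is free, since D is bounded on Theta^* . In W'(D) = (1 + K D) exp(K D) the exponential
    cancels against that of W, and what remains to prove is beta D <= (1 + K D) |grad D|^2. Wherever
    K |grad D|^2 >= beta, the term with K suffices, which is how K compensates for a poor rate of D
    itself. Neither integrability of the increment nor measurability of the distance is at hand: the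
    first is avoided by completing a square, the second by passing to measurable majorants. *)

Section Analysis.
Context {R : realType}.

(** * Matrix norms, mean value inequalities, differentiability *)

Lemma mxE_le_norm m n (A : 'M[R]_(m, n)) i j : `|A i j| <= `|A|.
Proof.
rewrite [leRHS]/Num.Def.normr/= mx_normrE.
exact: (le_bigmax _ (fun ij : 'I_m * 'I_n => `|A ij.1 ij.2|) (i, j)).
Qed.

Lemma norm_mx_le m n (A : 'M[R]_(m, n)) (b : R) : 0 <= b ->
  (forall i j, `|A i j| <= b) -> `|A| <= b.
Proof.
move=> b0 Ab; rewrite [leLHS]/Num.Def.normr/= mx_normrE.
by apply: bigmax_le => // -[i j] _; exact: Ab.
Qed.

Lemma cvg_mx T (F : set_system T) (FF : Filter F) m n (f : T -> 'M[R]_(m, n))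
    (l : 'M[R]_(m, n)) :
  (forall i j, f x i j @[x --> F] --> l i j) -> f @ F --> l.
Proof.
move=> fl; apply/cvgrPdist_le => e e0.
have H : \forall x \near F, forall ij : 'I_m * 'I_n,
    `|l ij.1 ij.2 - f x ij.1 ij.2| <= e.
  apply: filter_forall => -[i j] /=.
  by move/cvgrPdist_le : (fl i j) => /(_ _ e0).
apply: filterS H => x H; apply: norm_mx_le => [|i j]; first exact: ltW.
by rewrite !mxE; exact: (H (i, j)).
Qed.

Lemma continuous_mx (T : topologicalType) m n (f : T -> 'M[R]_(m, n)) (x : T) :
  (forall i j, {for x, continuous (fun y => f y i j)}) -> {for x, continuous f}.
Proof. by move=> H; apply: (@cvg_mx _ (nbhs x)) => i j; exact: H. Qed.

Lemma cvg_coord T (F : set_system T) (FF : Filter F) m n (f : T -> 'M[R]_(m, n))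
    (l : 'M[R]_(m, n)) i j :
  f @ F --> l -> f x i j @[x --> F] --> l i j.
Proof.
move=> fl; have := @coord_continuous R m n i j l.
exact: cvg_comp fl.
Qed.

Lemma near0_norm_lt (V : normedModType R) (r : R) : 0 < r ->
  \forall h \near (0 : V), `|h| < r.
Proof.
move=> r0; apply/nbhs_ballP; exists r => // h.
by rewrite -ball_normE /= sub0r normrN.
Qed.

Lemma near_norm_le (V : normedModType R) (x : V) (r : R) : 0 < r ->
  \forall y \near x, `|x - y| <= r.
Proof.
move=> r0; apply/nbhs_ballP; exists r => // y.
by rewrite -ball_normE /= => /ltW.
Qed.

Lemma near_cont_norm (T : topologicalType) (V : normedModType R) (f : T -> V) x
    (e : R) : {for x, continuous f} -> 0 < e -> \forall y \near x, `|f x - f y| <= e.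
Proof. by move=> fc e0; have /cvgrPdist_le /(_ _ e0) := fc. Qed.

Lemma near_comp (T U : topologicalType) (f : T -> U) (x : T) (l : U) (P : set U) :
  f @ x --> l -> (\forall y \near l, P y) -> \forall z \near x, P (f z).
Proof. by move=> fl Pl; exact: fl. Qed.

Lemma cvg_sumr T (F : set_system T) (FF : Filter F) (V : normedModType R) I
    (s : seq I) (P : pred I) (f : I -> T -> V) (l : I -> V) :
  (forall i, P i -> f i x @[x --> F] --> l i) ->
  \sum_(i <- s | P i) f i x @[x --> F] --> \sum_(i <- s | P i) l i.
Proof.
move=> H; elim: s => [|i s IH].
  rewrite big_nil; under eq_fun do rewrite big_nil; exact: cvg_cst.
rewrite big_cons; under eq_fun do rewrite big_cons.
by case: ifPn => // /H Hi; exact: cvgD.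
Qed.

Lemma is_derive_line (V W : normedModType R) (f : V -> W) (x v : V) (s : R) l :
  is_derive (x + s *: v) v f l -> is_derive s 1 (fun t => f (x + t *: v)) l.
Proof.
have E : (fun h : R => h^-1 *: (f (x + (h *: (1 : R) + s) *: v) - f (x + s *: v)))
       = (fun h : R => h^-1 *: (f (h *: v + (x + s *: v)) - f (x + s *: v))).
  by apply/funext => h; rewrite [h *: 1]mulr1 scalerDl addrCA.
by case=> df dl; split; rewrite /derivable /derive /= E.
Qed.

Lemma is_derive_scalel (V : normedModType R) (v : V) (s : R) :
  is_derive s 1 (fun u : R => u *: v) v.
Proof.
have H := is_derive_line (is_derive_id (0 + s *: v) v).
by move: H; congr is_derive; apply/funext => u; rewrite /= add0r.
Qed.

Lemma within_cont (a b : R) (f df : R -> R) :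
  (forall s, a <= s <= b -> is_derive s 1 f (df s)) ->
  {within `[a, b], continuous f}.
Proof.
move=> H; apply: derivable_within_continuous => s.
by rewrite in_itv /= => sab; have [] := H s sab.
Qed.

Lemma mean_value (a b : R) (f df : R -> R) : a <= b ->
  (forall s, a <= s <= b -> is_derive s 1 f (df s)) ->
  exists2 s, a <= s <= b & f b - f a = df s * (b - a).
Proof.
move=> ab H; have [|s] := @MVT_segment R f df a b ab _ (within_cont H).
  by move=> s /[!in_itv]/= /andP[? ?]; apply: H; rewrite !ltW.
by rewrite in_itv /= => ? ?; exists s.
Qed.

Lemma mean_value_abs (h : R) (f df : R -> R) :
  (forall s : R, `|s| <= `|h| -> is_derive s 1 f (df s)) ->
  exists2 s : R, `|s| <= `|h| & f h - f 0 = df s * h.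
Proof.
move=> H; have [h0|h0] := leP 0 h.
  have [|s /andP[s0 sh] ->] := @mean_value 0 h f df h0.
    by move=> s /andP[s0 sh]; apply: H; rewrite !ger0_norm.
  by exists s; rewrite ?subr0 // !ger0_norm.
have [|s /andP[hs s0]] := @mean_value h 0 f df (ltW h0).
  by move=> s /andP[hs s0]; apply: H; rewrite (ler0_norm s0) (ler0_norm (ltW h0)) lerN2.
move=> E; exists s; first by rewrite (ler0_norm s0) (ler0_norm (ltW h0)) lerN2.
by rewrite -opprB E sub0r mulrN opprK.
Qed.

(** The intermediate point depends on the entry, which is harmless because the norm is the maximum
    of the entries. *)
Lemma mean_value_mx m n (a b B : R) (f df : R -> 'M[R]_(m, n)) : a <= b -> 0 <= B ->
  (forall s, a <= s <= b -> forall i j,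
    is_derive s 1 (fun t => f t i j) (df s i j)) ->
  (forall s, a <= s <= b -> `|df s| <= B) ->
  `|f b - f a| <= B * (b - a).
Proof.
move=> ab B0 Hd HB; apply: norm_mx_le => [|i j].
  by rewrite mulr_ge0 // subr_ge0.
have [s sab] := mean_value ab (fun s sab => Hd s sab i j).
rewrite !mxE => ->; rewrite normrM [X in _ * X]ger0_norm ?subr_ge0//.
by rewrite ler_wpM2r ?subr_ge0// (le_trans (mxE_le_norm _ _ _))// HB.
Qed.

Let trunc n (k : nat) (h : 'rV[R]_n) : 'rV[R]_n := \row_i (h 0 i *+ (i < k)%N).

Let truncS n (k : 'I_n) (h : 'rV[R]_n) :
  trunc k.+1 h = trunc k h + h 0 k *: delta_mx 0 k.
Proof.
apply/rowP => i; rewrite !mxE eqxx /= ltnS leq_eqVlt.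
have [->|ik] := eqVneq i k; first by rewrite eqxx ltnn mulr0n add0r mulr1.
by rewrite (inj_eq val_inj) (negbTE ik) mulr0 addr0.
Qed.

Let norm_trunc n (k : 'I_n) (h : 'rV[R]_n) (s : R) : `|s| <= `|h 0 k| ->
  `|trunc k h + s *: delta_mx 0 k| <= `|h|.
Proof.
move=> sh; apply: norm_mx_le => // i j; rewrite ord1 !mxE eqxx /=.
have [->|jk] := eqVneq j k.
  by rewrite ltnn mulr0n add0r mulr1 (le_trans sh) // mxE_le_norm.
rewrite mulr0 addr0; case: ltnP => _; last by rewrite mulr0n normr0.
by rewrite mulr1n mxE_le_norm.
Qed.

(* Telescoping along the coordinate axes; on each edge use the mean value
   theorem. *)
Lemma continuous_partials_expansion n (f : 'rV[R]_n -> R) (x : 'rV[R]_n) :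
  (\forall y \near x, forall i, derivable f y (basis_vec i)) ->
  (forall i, {for x, continuous (fun y => 'D_(basis_vec i) f y)}) ->
  forall e : R, 0 < e -> \forall h \near (0 : 'rV[R]_n),
    `|f (h + x) - f x - \sum_i h 0 i * 'D_(basis_vec i) f x| <= e * `|h|.
Proof.
move=> fd fc e e0.
(* There are [n] edges; [n.+1] keeps the denominator nonzero in dimension 0. *)
pose e' := e / n.+1%:R.
have e'0 : 0 < e' by rewrite divr_gt0.
have fc' : \forall y \near x, forall i,
    `|'D_(basis_vec i) f x - 'D_(basis_vec i) f y| <= e'.
  have H i : \forall y \near x,
      `|'D_(basis_vec i) f x - 'D_(basis_vec i) f y| <= e'.
    by have /cvgrPdist_le /(_ _ e'0) := fc i.
  exact: filter_forall H.
have [r /= r0 Hr] := (@nbhs_ballP _ _ _ _).1 (filterI fd fc').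
apply: filterS (@near0_norm_lt 'rV[R]_n r r0) => h hr.
have edge (k : 'I_n) s : `|s| <= `|h 0 k| ->
    ball x r (x + trunc k h + s *: basis_vec k).
  move=> sh; rewrite -ball_normE /= -addrA opprD addNKr normrN.
  exact: le_lt_trans (norm_trunc sh) hr.
have E (k : 'I_n) : exists2 s, `|s| <= `|h 0 k| &
    f (x + trunc k.+1 h) - f (x + trunc k h) =
      'D_(basis_vec k) f (x + trunc k h + s *: basis_vec k) * h 0 k.
  have [s|s sh Es] := @mean_value_abs (h 0 k)
      (fun t => f (x + trunc k h + t *: basis_vec k))
      (fun s => 'D_(basis_vec k) f (x + trunc k h + s *: basis_vec k)).
    move=> /edge/Hr [Hd _]; apply: is_derive_line; exact/derivableP.
  by exists s => //; rewrite -Es scale0r addr0 truncS addrA.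
have -> : f (h + x) - f x = \sum_(k < n) (f (x + trunc k.+1 h) - f (x + trunc k h)).
  rewrite -(big_mkord xpredT (fun k => f (x + trunc k.+1 h) - f (x + trunc k h))).
  have tn : trunc n h = h by apply/rowP => i; rewrite !mxE ltn_ord.
  have t0 : trunc 0 h = 0 by apply/rowP => i; rewrite !mxE.
  rewrite (@telescope_sumr _ 0 n (fun k => f (x + trunc k h))) //.
  by rewrite t0 tn addr0 [h + x]addrC.
rewrite -sumrB; apply: (le_trans (ler_norm_sum _ _ _)).
apply: (@le_trans _ _ (\sum_(k < n) e' * `|h|)).
  apply: ler_sum => k _; have [s sh ->] := E k.
  rewrite mulrC -mulrBr normrM mulrC ler_pM ?mxE_le_norm//.
  by rewrite distrC; apply: (Hr _ (edge _ _ sh)).2.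
rewrite sumr_const card_ord -mulr_natl mulrA ler_wpM2r // /e'.
by rewrite mulrCA ger_pMr // ler_pdivrMr // mul1r ler_nat.
Qed.

(** [Ck] speaks of partial derivatives only; the chain rule needs the full differential. *)
Lemma continuous_partials_differentiable n (f : 'rV[R]_n -> R) (x : 'rV[R]_n) :
  (\forall y \near x, forall i, derivable f y (basis_vec i)) ->
  (forall i, {for x, continuous (fun y => 'D_(basis_vec i) f y)}) ->
  differentiable f x.
Proof.
move=> fd fc.
pose df (h : 'rV[R]_n) : R := (h *m \col_i 'D_(basis_vec i) f x) 0 0.
have dfE h : df h = \sum_i h 0 i * 'D_(basis_vec i) f x.
  by rewrite /df mxE; apply: eq_bigr => i _; rewrite mxE.
have dfl : linear df.
  by move=> a u v; rewrite /df mulmxDl -scalemxAl mxE mxE.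
pose L : {linear 'rV[R]_n -> R} :=
  HB.pack df (GRing.isLinear.Build R _ R _ df dfl).
have Lc : continuous L.
  move=> y; rewrite /continuous_at /=.
  rewrite (_ : df = fun h => \sum_i h 0 i * 'D_(basis_vec i) f x); last first.
    by apply/funext => h; rewrite dfE.
  apply: (@cvg_sumr _ (nbhs y)) => i _; apply: cvgMr_tmp; exact: coord_continuous.
have LE : f \o shift x = cst (f x) + L +o_ (0 : 'rV[R]_n) id.
  apply/eqaddoP => e e0.
  apply: filterS (continuous_partials_expansion fd fc e0) => h.
  by rewrite !fctE /= dfE opprD addrA.
have dE := diff_unique Lc LE.
by apply/diff_locallyP; rewrite dE.
Qed.

Lemma row_basis n (v : 'rV[R]_n) : v = \sum_i v 0 i *: basis_vec i.
Proof. by rewrite [LHS]row_sum_delta. Qed.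

Lemma derive_partials n (W : normedModType R) (f : 'rV[R]_n -> W) x v :
  differentiable f x -> 'D_v f x = \sum_i v 0 i *: 'D_(basis_vec i) f x.
Proof.
move=> df; rewrite deriveE // [in LHS](row_basis v) linear_sum.
by apply: eq_bigr => i _; rewrite linearZ deriveE.
Qed.

Lemma is_derive_comp_curve (V W : normedModType R) (f : V -> W)
    (X : R -> V) (t : R) v :
  differentiable f (X t) -> is_derive t 1 X v ->
  is_derive t 1 (f \o X) ('D_v f (X t)).
Proof.
move=> df [/derivable1_diffP dX <-].
have dc : differentiable (f \o X) t by exact: differentiable_comp.
split; first exact: diff_derivable.
by rewrite !deriveE // diff_comp //= deriveE.
Qed.

Lemma is_derive_reverse (W : normedModType R) (f : R -> W) (s : R) l :
  is_derive (1 - s) 1 f l -> is_derive s 1 (fun u => f (1 - u)) (- l).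
Proof.
move=> [/derivable1_diffP df <-].
have dg : is_derive s 1 (fun u : R => 1 - u) (-1).
  rewrite -(sub0r (1 : R)).
  exact: (@is_deriveB _ _ _ (cst (1 : R)) (@id R) s 1).
have H := is_derive_comp_curve (X := fun u : R => 1 - u) df dg.
by apply: (is_derive_eq H); rewrite !deriveE // linearN.
Qed.

Lemma is_derive_mxP m n (f : R -> 'M[R]_(m, n)) (t : R) l :
  is_derive t 1 f l <-> forall i j, is_derive t 1 (fun s => f s i j) (l i j).
Proof.
split=> [[df <-] i j|H].
  split; first exact: (derivable_mxP f t 1).1.
  by rewrite derive_mx // mxE.
have df : derivable f t 1 by apply/derivable_mxP => i j; have [] := H i j.
split=> //; rewrite derive_mx //; apply/matrixP => i j; rewrite mxE.
by have [] := H i j.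
Qed.

Lemma differentiable_row n m (f : 'rV[R]_n -> 'rV[R]_m) x :
  (forall j, differentiable (fun y => f y 0 j) x) -> differentiable f x.
Proof.
move=> H; rewrite (_ : f = \sum_j (fun y => f y 0 j *: basis_vec j)).
  by apply: differentiable_sum => j; apply: differentiableZl.
by apply/funext => y; rewrite fct_sumE -row_basis.
Qed.

Lemma jacobianE n m (f : 'rV[R]_n -> 'rV[R]_m) x i j :
  differentiable f x ->
  jacobian f x i j = 'D_(basis_vec i) (fun y => f y 0 j) x.
Proof.
move=> df; have dd := @diff_derivable _ _ _ _ _ (basis_vec i) df.
have := @deriveEjacobian _ _ _ _ _ (basis_vec i) df.
by rewrite /basis_vec -rowE derive_mx// => /rowP/(_ j); rewrite !mxE.
Qed.

Lemma Ck_cont n k (U : set 'rV[R]_n) f x : Ck k U f -> U x ->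
  {for x, continuous f}.
Proof. by case: k => [|k] /= [fc _]; exact: fc. Qed.

Lemma Ck_diff n k (U : set 'rV[R]_n) f x : (0 < k)%N -> open U -> Ck k U f ->
  U x -> differentiable f x.
Proof.
case: k => // k _ Uo /= [_ H] Ux; apply: continuous_partials_differentiable.
  by apply: filterS (open_nbhs_nbhs (conj Uo Ux)) => y Uy i; apply: (H i).1.
by move=> i; apply: Ck_cont (H i).2 Ux.
Qed.

Lemma Ck_partial_cont n k (U : set 'rV[R]_n) f x i : (0 < k)%N -> Ck k U f ->
  U x -> {for x, continuous (fun y => 'D_(basis_vec i) f y)}.
Proof. by case: k => // k _ /= [_ H] Ux; apply: Ck_cont (H i).2 Ux. Qed.

(** * Quadratic forms and Rayleigh quotients *)

Definition qf n (A : 'M[R]_n) (u v : 'rV[R]_n) : R := (u *m A *m v^T) 0 0.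

Lemma qfE n (A : 'M[R]_n) u v : qf A u v = \sum_i \sum_j u 0 i * A i j * v 0 j.
Proof.
rewrite /qf mxE exchange_big /=; apply: eq_bigr => j _.
by rewrite !mxE big_distrl.
Qed.

Lemma norm_qf n (A : 'M[R]_n) u v :
  `|qf A u v| <= (n * n)%:R * `|A| * `|u| * `|v|.
Proof.
rewrite qfE; apply: (le_trans (ler_norm_sum _ _ _)).
apply: (@le_trans _ _ (\sum_(i < n) \sum_(j < n) `|A| * `|u| * `|v|)).
  apply: ler_sum => i _; apply: (le_trans (ler_norm_sum _ _ _)).
  apply: ler_sum => j _; rewrite !normrM.
  by rewrite ler_pM ?mxE_le_norm // mulrC ler_pM ?mxE_le_norm.
by rewrite !sumr_const !card_ord -mulrnA -[leLHS]mulr_natl !mulrA.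
Qed.

Lemma qfDl n (A : 'M[R]_n) u v w : qf A (u + v) w = qf A u w + qf A v w.
Proof. by rewrite /qf !mulmxDl mxE. Qed.
Lemma qfDr n (A : 'M[R]_n) u v w : qf A w (u + v) = qf A w u + qf A w v.
Proof. by rewrite /qf linearD mulmxDr mxE. Qed.
Lemma qfZl n (A : 'M[R]_n) a u w : qf A (a *: u) w = a * qf A u w.
Proof. by rewrite /qf -!scalemxAl mxE. Qed.
Lemma qfZr n (A : 'M[R]_n) a u w : qf A w (a *: u) = a * qf A w u.
Proof. by rewrite /qf linearZ -scalemxAr mxE. Qed.
Lemma qfNl n (A : 'M[R]_n) u w : qf A (- u) w = - qf A u w.
Proof. by rewrite -scaleN1r qfZl mulN1r. Qed.
Lemma qfNr n (A : 'M[R]_n) u w : qf A w (- u) = - qf A w u.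
Proof. by rewrite -scaleN1r qfZr mulN1r. Qed.
Lemma qfBl n (A : 'M[R]_n) u v w : qf A (u - v) w = qf A u w - qf A v w.
Proof. by rewrite qfDl qfNl. Qed.
Lemma qfBr n (A : 'M[R]_n) u v w : qf A w (u - v) = qf A w u - qf A w v.
Proof. by rewrite qfDr qfNr. Qed.
Lemma qf_subm n (A B : 'M[R]_n) u v : qf (A - B) u v = qf A u v - qf B u v.
Proof. by rewrite /qf mulmxBr mulmxBl !mxE. Qed.
Lemma subrBB (V : zmodType) (x y z : V) : (x - z) - (x - y) = y - z.
Proof. by rewrite opprB addrC addrA subrK. Qed.

(** One argument changes at a time: left vector, matrix, then the right vector in two stages. Used
    to compare the derivative of D along a geodesic with its value at the starting point. *)
Lemma qf_telescope n (A B : 'M[R]_n) u v x y z :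
  qf A u x - qf B v z =
  qf A (u - v) x + qf (A - B) v x + qf B v (x - y) + qf B v (y - z).
Proof. by rewrite qfBl !qfBr qf_subm; ring. Qed.
Lemma qf0l n (A : 'M[R]_n) w : qf A 0 w = 0.
Proof. by rewrite /qf !mul0mx mxE. Qed.
Lemma qf_sym n (A : 'M[R]_n) u v : A^T = A -> qf A u v = qf A v u.
Proof.
move=> sA; rewrite /qf -[in LHS](trmxK (u *m A *m v^T)) mxE.
by rewrite !trmx_mul trmxK sA mulmxA.
Qed.
Lemma qf_mul n m (A : 'M[R]_m) (J : 'M[R]_(n, m)) u v :
  qf (J *m A *m J^T) u v = qf A (u *m J) (v *m J).
Proof. by rewrite /qf trmx_mul !mulmxA. Qed.

Lemma cvg_qf T (F : set_system T) (FF : Filter F) n (A : T -> 'M[R]_n) B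
    (f g : T -> 'rV[R]_n) u v :
  A @ F --> B -> f @ F --> u -> g @ F --> v ->
  qf (A x) (f x) (g x) @[x --> F] --> qf B u v.
Proof.
move=> AB fu gv; rewrite qfE; under eq_fun do rewrite qfE.
apply: cvg_sumr => i _; apply: cvg_sumr => j _.
by apply: cvgM; [apply: cvgM|]; apply: cvg_coord.
Qed.

Lemma qf_continuous n (A : 'M[R]_n) : continuous (fun v => qf A v v).
Proof.
move=> v.
exact: (@cvg_qf _ (nbhs v) _ n (cst A) A id id v v (cvg_cst _) cvg_id cvg_id).
Qed.

Lemma cvg_mulmx T (F : set_system T) (FF : Filter F) m n p
    (A : T -> 'M[R]_(m, n)) (B : T -> 'M[R]_(n, p)) (a : 'M[R]_(m, n))
    (b : 'M[R]_(n, p)) :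
  A @ F --> a -> B @ F --> b -> A x *m B x @[x --> F] --> a *m b.
Proof.
move=> Aa Bb; apply: cvg_mx => i j; rewrite mxE; under eq_fun do rewrite mxE.
by apply: cvg_sumr => k _; apply: cvgM; exact: cvg_coord.
Qed.

Lemma cvg_trmx T (F : set_system T) (FF : Filter F) m n (A : T -> 'M[R]_(m, n))
    (a : 'M[R]_(m, n)) :
  A @ F --> a -> (A x)^T @[x --> F] --> a^T.
Proof.
move=> Aa; apply: cvg_mx => i j; rewrite mxE; under eq_fun do rewrite mxE.
exact: cvg_coord.
Qed.

Lemma norm_mulmx n m (v : 'rV[R]_n) (A : 'M[R]_(n, m)) :
  `|v *m A| <= n%:R * `|A| * `|v|.
Proof.
apply: norm_mx_le => [|i j]; first by rewrite !mulr_ge0.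
rewrite mxE (le_trans (ler_norm_sum _ _ _)) //.
apply: (@le_trans _ _ (\sum_(k < n) `|A| * `|v|)).
  by apply: ler_sum => k _; rewrite normrM mulrC ler_pM ?mxE_le_norm.
by rewrite sumr_const card_ord -[leLHS]mulr_natl mulrA.
Qed.

Lemma qf_pd_ge0 n (A : 'M[R]_n) v : positive_definite A -> 0 <= qf A v v.
Proof.
case=> _ H; have [->|/H/ltW//] := eqVneq v 0; by rewrite qf0l.
Qed.

Lemma qf_amgm n (A : 'M[R]_n) u v s : positive_definite A ->
  - (2 * s * qf A u v) <= qf A u u + s ^+ 2 * qf A v v.
Proof.
move=> pA; have := qf_pd_ge0 (u + s *: v) pA.
rewrite qfDl !qfDr !qfZl !qfZr (qf_sym v u pA.1) => H.
by rewrite -subr_ge0; apply: le_trans H _; rewrite le_eqVlt; apply/orP; left; apply/eqP; ring.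
Qed.

(** The unit sphere of the sup norm is compact; the dimension is positive because in dimension 0 the
    sphere is empty. *)
Lemma qf_min n (A : 'M[R]_n.+1) : exists2 v : 'rV[R]_n.+1, `|v| = 1 &
  forall u, `|u| = 1 -> qf A v v <= qf A u u.
Proof.
pose S := [set v : 'rV[R]_n.+1 | `|v| = 1].
have S0 : S !=set0.
  exists (const_mx 1); apply/eqP; rewrite eq_le; apply/andP; split.
    by apply: norm_mx_le => // i j; rewrite mxE normr1.
  by have := mxE_le_norm (const_mx 1 : 'rV[R]_n.+1) 0 0; rewrite mxE normr1.
have Sc : compact S.
  apply: bounded_closed_compact.
    by exists 1; split=> // M M1 v /= ->; exact: ltW.
  rewrite (_ : S = (@Num.norm _ 'rV[R]_n.+1) @^-1` [set 1]) //.
  apply: preimage_closed; last exact: closed_eq.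
  by move=> v _; exact: norm_continuous.
have [|v /[!inE] Sv H] := @EVT_min_rV R n.+1 (fun v => qf A v v) S S0 Sc.
  exact/continuous_subspaceT/qf_continuous.
by exists v => // u Su; apply: H; rewrite inE.
Qed.

Lemma qf_pd_lower n (A : 'M[R]_n) : positive_definite A ->
  exists2 c, 0 < c & forall v, c * `|v| ^+ 2 <= qf A v v.
Proof.
case: n A => [|n] A pA.
  exists 1 => // v; rewrite (thinmx0 v) normr0 expr0n mulr0.
  exact: qf_pd_ge0.
have [v v1 vmin] := qf_min A.
exists (qf A v v).
  by apply: pA.2; rewrite -normr_gt0 v1.
move=> u; have [->|u0] := eqVneq u 0.
  by rewrite normr0 expr0n mulr0 qf0l.
have nu : 0 < `|u| by rewrite normr_gt0.
have := vmin (`|u|^-1 *: u); rewrite normrZ normfV normr_id mulVf ?gt_eqF//.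
move=> /(_ erefl); rewrite qfZl qfZr mulrA -expr2 exprVn mulrC.
by rewrite ler_pdivlMr // exprn_gt0.
Qed.

Lemma qf_pd_near n (A : 'M[R]_n) : positive_definite A ->
  exists2 c, 0 < c & \forall B \near A, forall v, c * `|v| ^+ 2 <= qf B v v.
Proof.
move=> /qf_pd_lower[c c0 H]; exists (c / 2); first by rewrite divr_gt0.
pose N : R := (n * n)%:R + 1.
have N0 : 0 < N by rewrite ltr_wpDl.
have cN : 0 < c / 2 / N by rewrite !divr_gt0.
apply: filterS (near_norm_le A cN) => B AB v.
have := norm_qf (A - B) v v; rewrite qf_subm => K.
have K2 : (n * n)%:R * `|A - B| * `|v| * `|v| <= c / 2 * `|v| ^+ 2.
  rewrite -[leLHS]mulrA -expr2 ler_wpM2r ?exprn_ge0 //.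
  move: AB; rewrite ler_pdivlMr // => AB; rewrite mulrC (le_trans _ AB) //.
  by rewrite ler_wpM2l // /N lerDl.
have := H v; move: (le_trans (ler_norm _) (le_trans K K2)).
lra.
Qed.

Lemma pd_unit n (A : 'M[R]_n) : positive_definite A -> A \in unitmx.
Proof.
move=> pA; rewrite unitmxE unitfE; apply/negP => /det0P[v v0 vA].
by have := pA.2 v v0; rewrite vA mul0mx mxE ltxx.
Qed.

Lemma qf1E n (v : 'rV[R]_n) : qf 1%:M v v = \sum_i v 0 i ^+ 2.
Proof.
rewrite /qf mulmx1 mxE; apply: eq_bigr => i _; by rewrite mxE expr2.
Qed.

Lemma pd1 n : positive_definite (1%:M : 'M[R]_n).
Proof.
split; first exact: trmx1.
move=> v v0; rewrite -/(qf 1%:M v v) qf1E lt_neqAle.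
rewrite sumr_ge0 ?andbT; last by move=> i _; exact: sqr_ge0.
apply: contra v0; rewrite eq_sym psumr_eq0; last by move=> i _; exact: sqr_ge0.
move=> /allP H; apply/eqP/rowP => i; rewrite mxE; apply/eqP.
by have := H i (mem_index_enum i); rewrite sqrf_eq0.
Qed.

Lemma qf1_ge n (v : 'rV[R]_n) : `|v| ^+ 2 <= qf 1%:M v v.
Proof.
have H0 := qf_pd_ge0 v (pd1 n).
rewrite -(sqr_sqrtr H0) lerXn2r ?nnegrE ?sqrtr_ge0 //.
apply: norm_mx_le => [|i j]; first exact: sqrtr_ge0.
rewrite -[leLHS]ger0_norm // -sqrtr_sqr ler_wsqrtr // ord1 real_normK ?num_real //.
by rewrite qf1E (bigD1 j) //= lerDl sumr_ge0 // => k _; exact: sqr_ge0.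
Qed.

Lemma mulmx_delta_col n (v : 'rV[R]_n) i :
  (v *m (delta_mx i 0 : 'cV[R]_n)) 0 0 = v 0 i.
Proof.
rewrite mxE (bigD1 i) //= big1 ?addr0 => [|k ki].
  by rewrite mxE !eqxx mulr1.
by rewrite mxE (negbTE ki) mulr0.
Qed.

Lemma qf_sqrD n (A : 'M[R]_n) u v : A^T = A ->
  qf A (u + v) (u + v) = qf A u u + 2 * qf A u v + qf A v v.
Proof. by move=> sA; rewrite qfDl !qfDr (qf_sym v u sA); ring. Qed.

(** The form attains a minimum [m] on the Euclidean unit sphere, at some [w]. Optimality makes [w]
    an eigenvector for [m], so [lam <= m]. *)
Lemma rayleigh n (A : 'M[R]_n) lam v : A^T = A -> smallest_eigenvalue A lam ->
  lam * qf 1%:M v v <= qf A v v.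
Proof.
move=> sA [_ lmin]; case: n A v sA lmin => [|n] A v sA lmin.
  by rewrite (thinmx0 v) !qf0l mulr0.
pose E (w : 'rV[R]_n.+1) := qf 1%:M w w.
have Ec : continuous E.
  exact: qf_continuous.
have E0 w : w != 0 -> 0 < E w by move=> ?; apply: (pd1 _).2.
pose S := [set w | E w = 1].
have normS w : w != 0 -> S ((Num.sqrt (E w))^-1 *: w).
  move=> /E0 w0; rewrite /S /= /E qfZl qfZr mulrA -expr2 exprVn.
  by rewrite sqr_sqrtr ?(ltW w0) // mulVf ?gt_eqF.
have Sc : compact S.
  apply: bounded_closed_compact; last first.
    apply: (@preimage_closed _ _ E [set y | y = 1]); last exact: closed_eq.
    by move=> w _; exact: Ec.
  exists 1; split=> // M M1 w /= Sw.
  have := qf1_ge w; rewrite -/(E w) Sw => H.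
  by rewrite (le_trans _ (ltW M1)) // -(@ler_sqr _ `|w|) ?nnegrE // expr1n.
have S0 : S !=set0.
  exists ((Num.sqrt (E (const_mx 1)))^-1 *: const_mx 1); apply: normS.
  by apply/eqP => /rowP/(_ 0); rewrite !mxE; apply/eqP; rewrite oner_eq0.
have [|w /[!inE] Sw wmin] := @EVT_min_rV R n.+1 (fun v => qf A v v) S S0 Sc.
  exact/continuous_subspaceT/qf_continuous.
pose m := qf A w w.
have mle u : m * E u <= qf A u u.
  have [->|u0] := eqVneq u 0; first by rewrite /E !qf0l mulr0.
  have := wmin ((Num.sqrt (E u))^-1 *: u); rewrite inE => /(_ (normS _ u0)).
  rewrite qfZl qfZr mulrA -expr2 exprVn sqr_sqrtr ?(ltW (E0 _ u0)) //.
  by rewrite mulrC ler_pdivlMr ?E0.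
pose B := A - m%:M.
have BE u z : qf B u z = qf A u z - m * qf 1%:M u z.
  rewrite /B qf_subm; congr (_ - _).
    by rewrite /qf mulmx1 mul_mx_scalar -scalemxAl mxE.
have sB : B^T = B by rewrite /B linearB /= sA tr_scalar_mx.
(* [B] is nonnegative and vanishes on [w], so along the line [z + t *: w] it is affine in [t]; a
   nonzero slope would make it negative. *)
have B0 z : qf B w z = 0.
  apply/eqP/negPn/negP => c0.
  have P t : 0 <= qf B z z + 2 * t * qf B w z.
    have : 0 <= qf B (z + t *: w) (z + t *: w) by rewrite BE subr_ge0 mle.
    have ww : qf B w w = 0 by rewrite BE /m -/(E w) Sw mulr1 subrr.
    rewrite qfDl !qfDr !qfZl !qfZr ww (qf_sym z w sB) !mulr0 addr0.
    by move=> H; apply: le_trans H _; rewrite le_eqVlt; apply/orP; left; apply/eqP; ring.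
  have := P (- (qf B z z + 1) / (2 * qf B w z)).
  rewrite (_ : qf B z z + _ = -1); last by field.
  by rewrite lerNr oppr0 ler10.
have wB : w *m B = 0.
  apply/rowP => i; rewrite [RHS]mxE -(B0 (delta_mx 0 i)) /qf trmx_delta.
  by rewrite mulmx_delta_col.
have me : eigenvalue A m.
  apply/eigenvalueP; exists w; last first.
    by apply/eqP => w0; move: Sw; rewrite /S /= /E w0 qf0l => /esym/eqP; rewrite oner_eq0.
  by apply/eqP; rewrite -subr_eq0 -mul_mx_scalar -mulmxBr; apply/eqP.
apply: le_trans (mle v); rewrite ler_wpM2r ?lmin //.
exact: qf_pd_ge0 (pd1 _).
Qed.

(** Expand |v A - lam v|^2 >= 0 and use [rayleigh]; no diagonalization is involved. With A the
    Hessian, |v A|^2 is the leading part of |grad D|^2 and half of the form that of D, whence the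
    rate 2 lambda. *)
Lemma rayleigh_sq n (A : 'M[R]_n) lam v : A^T = A -> 0 <= lam ->
  smallest_eigenvalue A lam ->
  lam * qf A v v <= qf 1%:M (v *m A) (v *m A).
Proof.
move=> sA l0 lmin; have H1 := rayleigh v sA lmin.
have H2 := qf_pd_ge0 (v *m A - lam *: v) (pd1 n).
have E : qf 1%:M (v *m A) v = qf A v v by rewrite /qf mulmx1.
have H3 : lam * (lam * qf 1%:M v v) <= lam * qf A v v.
  exact: ler_wpM2l.
move: H2; rewrite qfBl !qfBr !qfZl !qfZr.
rewrite (qf_sym v (v *m A) (trmx1 _ _)) E.
lra.
Qed.

Lemma qf_cs n (A : 'M[R]_n) u v : positive_definite A ->
  qf A u v ^+ 2 <= qf A u u * qf A v v.
Proof.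
move=> pA; have [->|v0] := eqVneq v 0.
  by rewrite -(scale0r (0 : 'rV[R]_n)) !qfZr !mul0r !mulr0 expr0n.
have vv : 0 < qf A v v by exact: pA.2.
have := qf_amgm u v (- (qf A u v / qf A v v)) pA.
have -> : - (2 * - (qf A u v / qf A v v) * qf A u v) =
  2 * (qf A u v ^+ 2 / qf A v v) by ring.
have -> : (- (qf A u v / qf A v v)) ^+ 2 * qf A v v =
  qf A u v ^+ 2 / qf A v v by field; rewrite gt_eqF.
rewrite -ler_pdivrMr //; lra.
Qed.

Lemma is_derive_sumr (V W : normedModType R) I (s : seq I) (f : I -> V -> W) x v
    (l : I -> W) : (forall i, is_derive x v (f i) (l i)) ->
  is_derive x v (fun y => \sum_(i <- s) f i y) (\sum_(i <- s) l i).
Proof.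
move=> H; elim: s => [|i s IH].
  under eq_fun do rewrite big_nil; rewrite big_nil; exact: is_derive_cst.
under eq_fun do rewrite big_cons; rewrite big_cons.
exact: is_deriveD.
Qed.

Lemma is_derive_qf n (A : R -> 'M[R]_n) (f g : R -> 'rV[R]_n) (t : R) A' f' g' :
  is_derive t 1 A A' -> is_derive t 1 f f' -> is_derive t 1 g g' ->
  is_derive t 1 (fun s => qf (A s) (f s) (g s))
    (qf A' (f t) (g t) + qf (A t) f' (g t) + qf (A t) (f t) g').
Proof.
move=> /is_derive_mxP dA /is_derive_mxP df /is_derive_mxP dg.
under eq_fun do rewrite qfE.
rewrite !qfE -!big_split /=; apply: is_derive_sumr => i.
rewrite -!big_split /=; apply: is_derive_sumr => j.
have H := is_deriveM (is_deriveM (df 0 i) (dA i j)) (dg 0 j).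
have E (a b c a' b' c' : R) : a * b * c' + c * (a * b' + b * a') =
  a * b' * c + a' * b * c + a * b * c' by ring.
by apply: (is_derive_eq H); exact: E.
Qed.

Lemma mulmx_jacobian n m (f : 'rV[R]_n -> 'rV[R]_m) x v : differentiable f x ->
  v *m jacobian f x = 'D_v f x.
Proof. by move=> df; rewrite deriveEjacobian. Qed.

Lemma eq_mulmx_row n m (A B : 'M[R]_(n, m)) :
  (forall v : 'rV_n, v *m A = v *m B) -> A = B.
Proof. by move=> H; apply/row_matrixP => i; rewrite !rowE. Qed.

Lemma jacobian_comp n m l (f : 'rV[R]_n -> 'rV[R]_m) (g : 'rV[R]_m -> 'rV[R]_l) x :
  differentiable f x -> differentiable g (f x) ->
  jacobian (g \o f) x = jacobian f x *m jacobian g (f x).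
Proof.
move=> df dg; have dgf : differentiable (g \o f) x by exact: differentiable_comp.
apply: eq_mulmx_row => v; rewrite mulmxA (mulmx_jacobian _ dgf).
rewrite (mulmx_jacobian _ df) (mulmx_jacobian _ dg) [LHS]deriveE //.
by rewrite diff_comp //= [RHS]deriveE // [in RHS]deriveE.
Qed.

Lemma near_jacobian n m (f g : 'rV[R]_n -> 'rV[R]_m) x :
  (\forall y \near x, f y = g y) -> differentiable f x -> differentiable g x ->
  jacobian f x = jacobian g x.
Proof.
move=> fg df dg; apply: eq_mulmx_row => v.
transitivity ('D_v f x); first exact: mulmx_jacobian.
by rewrite (near_eq_derive _ fg); exact/esym/mulmx_jacobian.
Qed.

Lemma jacobian_id n (x : 'rV[R]_n) : jacobian id x = 1%:M.
Proof.
apply: eq_mulmx_row => v; rewrite mulmx1 mulmx_jacobian //.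
exact: derive_id.
Qed.

End Analysis.

(** * Axioms of a Riemannian manifold *)

Section ManifoldAxioms.
Context {R : realType} {r d : nat} {M : riemannian_manifold R r d}.
Implicit Types p q o : M.

Lemma man_hausdorff : hausdorff_space M. Proof. by case: M. Qed.
Lemma man_second_countable : @second_countable M. Proof. by case: M. Qed.
Lemma dom_open p : open (dom p).
Proof. by move: p; case: M => ? ? ? ? ? ? H ? ? ? ? ? ? ? p; have [] := H p. Qed.
Lemma dom_self p : dom p p.
Proof. by move: p; case: M => ? ? ? ? ? ? H ? ? ? ? ? ? ? p; have [] := H p. Qed.
Lemma image_open p : open (chart p @` dom p).
Proof. by move: p; case: M. Qed.
Lemma chartK p q : dom p q -> param p (chart p q) = q.
Proof. by move: p q; case: M => ? ? ? ? ? ? ? ? H ? ? ? ? ? p q /H[]. Qed.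
Lemma chart_cont p q : dom p q -> {for q, continuous (chart p)}.
Proof. by move: p q; case: M => ? ? ? ? ? ? ? ? H ? ? ? ? ? p q /H[]. Qed.
Lemma param_cont p q : dom p q -> {for chart p q, continuous (param p)}.
Proof. by move: p q; case: M => ? ? ? ? ? ? ? ? H ? ? ? ? ? p q /H[]. Qed.
Lemma transition_Ck p q :
  Ck_map r (chart p @` (dom p `&` dom q)) (chart q \o param p).
Proof. by move: p q; case: M. Qed.
Lemma metric_Ck p i j : Ck r.-1 (chart p @` dom p) (fun x => metric p x i j).
Proof. by move: p; case: M. Qed.
Lemma metric_pd p q : dom p q -> positive_definite (metric p (chart p q)).
Proof. by move: p q; case: M. Qed.
Lemma metric_change p q o : dom p o -> dom q o ->
  metric p (chart p o) =
    jacobian (chart q \o param p) (chart p o) *m metric q (chart q o)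
    *m (jacobian (chart q \o param p) (chart p o))^T.
Proof. by move: p q o; case: M => ? ? ? ? ? ? ? ? ? ? ? ? ? H; exact: H. Qed.

End ManifoldAxioms.

(** * Charts, velocities and parallel fields *)

Section Charts.
Context {R : realType} {r d : nat} {M : riemannian_manifold R r d}.
Context (r3 : (3 < r)%N).
Implicit Types (p q o : M) (v w : 'rV[R]_d) (c : R -> M) (J : set R).

Lemma near_dom p q : dom p q -> \forall o \near q, dom p o.
Proof. by move=> pq; apply: open_nbhs_nbhs; split=> //; exact: dom_open. Qed.

Lemma near_chart_dom p q : dom p q -> \forall x \near chart p q,
  dom p (param p x) /\ chart p (param p x) = x.
Proof.
move=> pq; have : open_nbhs (chart p q) (chart p @` dom p).
  by split; [exact: image_open|exists q].
move=> /open_nbhs_nbhs; apply: filterS => x [y py xE].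
by rewrite -xE chartK.
Qed.

Lemma near_param p q (O : set M) : dom p q -> nbhs q O ->
  \forall x \near chart p q, O (param p x).
Proof.
move=> pq qO.
have C : param p @ chart p q --> q by rewrite -[X in _ --> X](chartK pq); exact: param_cont.
exact: C qO.
Qed.

Lemma overlap_open p (O : set M) : open O -> open (chart p @` (dom p `&` O)).
Proof.
move=> oO; rewrite openE => _ [q [pq Oq] <-]; rewrite /interior.
apply: filterS (filterI (near_chart_dom pq) (near_param pq (open_nbhs_nbhs (conj oO Oq)))).
by move=> x [[px xE] Ox]; exists (param p x).
Qed.

Lemma transition_diff p q o : dom p o -> dom q o ->
  differentiable (chart q \o param p) (chart p o).
Proof.
move=> po qo; apply: differentiable_row => j.
apply: (Ck_diff _ _ (transition_Ck p q j)); first by case: (r) r3.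
  exact/overlap_open/dom_open.
by exists o.
Qed.

Lemma jacobian_self p o : dom p o ->
  jacobian (chart p \o param p) (chart p o) = 1%:M.
Proof.
move=> po; rewrite -(jacobian_id (chart p o)); apply: near_jacobian.
- by apply: filterS (near_chart_dom po) => x [].
- exact: transition_diff.
- by [].
Qed.

Lemma components_self p v : components p p v = v.
Proof. by rewrite /components jacobian_self ?mulmx1 //; exact: dom_self. Qed.

Lemma innerE p q v w : dom p q ->
  inner q v w = qf (metric p (chart p q)) (components p q v) (components p q w).
Proof.
move=> pq; rewrite /inner -/(qf _ v w) (metric_change (dom_self q) pq).
by rewrite qf_mul.
Qed.

Lemma componentsB p q v w : components p q (v - w) = components p q v - components p q w.
Proof. by rewrite /components mulmxBl. Qed.

Lemma inner_ge0 p v : 0 <= inner p v v.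
Proof. exact/qf_pd_ge0/metric_pd/dom_self. Qed.

Lemma tnorm_sqr p v : tnorm p v ^+ 2 = inner p v v.
Proof. by rewrite sqr_sqrtr // inner_ge0. Qed.

Lemma tnorm_ge0 p v : 0 <= tnorm p v. Proof. exact: sqrtr_ge0. Qed.

Lemma curve_near J c t (O : set M) : C1_curve J c -> J t -> nbhs (c t) O ->
  \forall s \near t, O (c s).
Proof. by move=> C Jt cO; have [cc _] := C _ Jt; exact: cc. Qed.

Lemma curve_is_derive J c t p : C1_curve J c -> J t -> dom p (c t) ->
  is_derive t 1 (chart p \o c) (components p (c t) (velocity c t)).
Proof.
move=> C Jt pt; have [cc /(_ _ (dom_self (c t)))[dq _]] := C _ Jt.
set q := c t in dq *.
have dX : is_derive t 1 (chart q \o c) (velocity c t).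
  by rewrite /velocity derive1E; exact/derivableP.
have dd : differentiable (chart p \o param q) (chart q q).
  exact: (transition_diff (dom_self q) pt).
have H : is_derive t 1 ((chart p \o param q) \o (chart q \o c))
    (components p q (velocity c t)).
  by rewrite /components (mulmx_jacobian _ dd); exact: is_derive_comp_curve.
apply: near_eq_is_derive H.
apply: filterS (curve_near C Jt (near_dom (dom_self (c t)))) => s qs /=.
by rewrite chartK.
Qed.

Lemma curve_velocity J c t p : C1_curve J c -> J t -> dom p (c t) ->
  derive1 (chart p \o c) t = components p (c t) (velocity c t).
Proof. by move=> C Jt pt; rewrite derive1E; have [] := curve_is_derive C Jt pt. Qed.

Lemma metric_diff p q i j : dom p q ->
  differentiable (fun x => metric p x i j) (chart p q).
Proof.
move=> pq; apply: (Ck_diff _ (@image_open _ _ _ M p) (metric_Ck p i j)).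
  by case: (r) r3 => [|[]].
by exists q.
Qed.

Lemma metric_cont p q : dom p q -> {for chart p q, continuous (metric p)}.
Proof.
move=> pq; apply: continuous_mx => i j; apply: (Ck_cont (metric_Ck p i j)).
by exists q.
Qed.

(** Compatibility of the Levi-Civita connection with the metric: [g l a b] stands for the derivative
    of [A a b] in direction [l], [V] for the velocity and [W'] for the derivative of the parallel
    field [W]. *)
Let compatibility (A : 'M[R]_d) (g : 'I_d -> 'I_d -> 'I_d -> R) (V W W' : 'rV[R]_d) :
  positive_definite A ->
  (forall k, W' 0 k = - \sum_i \sum_j (2^-1 * \sum_l invmx A k l *
     (g i j l + g j i l - g l i j)) * V 0 i * W 0 j) ->
  qf (\matrix_(a, b) \sum_l V 0 l * g l a b) W W + qf A W' W + qf A W W' = 0.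
Proof.
move=> pA HW.
pose B : 'rV[R]_d := \row_l \sum_i \sum_j (g i j l + g j i l - g l i j) * V 0 i * W 0 j.
have EW : W' = - (2^-1 *: (B *m invmx A)).
  apply/rowP => k; rewrite HW !mxE; congr (- _); rewrite mulr_sumr.
  under eq_bigr do under eq_bigr do rewrite -mulrA -mulrA mulr_suml mulr_sumr.
  under eq_bigr do rewrite exchange_big /=.
  rewrite exchange_big /=; apply: eq_bigr => l _; rewrite mxE mulr_suml mulr_sumr.
  apply: eq_bigr => i _; rewrite mulr_suml mulr_sumr; apply: eq_bigr => j _.
  have -> : invmx A l k = invmx A k l.
    by rewrite -[in LHS]pA.1 -trmx_inv mxE.
  by ring.
rewrite (qf_sym W W' pA.1) -addrA.
have -> : qf A W' W = - (2^-1 * \sum_l B 0 l * W 0 l).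
  rewrite EW qfNl qfZl /qf mulmxKV ?pd_unit // mxE.
  by under eq_bigr do rewrite [W^T _ _]mxE.
set S := \sum_l _; rewrite (_ : - (2^-1 * S) - _ = - S); last by field.
rewrite {}/S.
apply/eqP; rewrite subr_eq0; apply/eqP; rewrite qfE.
have -> : \sum_l B 0 l * W 0 l =
    \sum_l \sum_i \sum_j g i j l * V 0 i * W 0 j * W 0 l +
    (\sum_l \sum_i \sum_j g j i l * V 0 i * W 0 j * W 0 l -
     \sum_l \sum_i \sum_j g l i j * V 0 i * W 0 j * W 0 l).
  rewrite -sumrB -big_split /=; apply: eq_bigr => l _.
  rewrite mxE mulr_suml -sumrB -big_split /=; apply: eq_bigr => i _.
  rewrite mulr_suml -sumrB -big_split /=; apply: eq_bigr => j _; ring.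
(* Exchanging the two indices carried by [W] cancels two of the three Christoffel terms; the third
   is the derivative of the metric. *)
have -> : \sum_l \sum_i \sum_j g j i l * V 0 i * W 0 j * W 0 l =
     \sum_l \sum_i \sum_j g l i j * V 0 i * W 0 j * W 0 l.
  under eq_bigr do rewrite exchange_big /=.
  rewrite exchange_big /=; apply: eq_bigr => l _.
  rewrite exchange_big /=; apply: eq_bigr => i _.
  by apply: eq_bigr => j _; ring.
rewrite subrr addr0 exchange_big /=; apply: eq_bigr => l _.
rewrite exchange_big /=; apply: eq_bigr => i _.
rewrite mxE mulr_sumr mulr_suml; apply: eq_bigr => j _; ring.
Qed.

Lemma parallel_inner_derive J c W t : open J -> C1_curve J c -> parallel J c W ->
  J t -> is_derive t 1 (fun s => inner (c s) (W s) (W s)) 0.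
Proof.
move=> Jo C P Jt; set p := c t; have pt : dom p (c t) := dom_self p.
have dX := curve_is_derive C Jt pt.
have dW : is_derive t 1 (fun s => components p (c s) (W s))
   (\row_k (- \sum_i \sum_j christoffel p (chart p (c t)) k i j
           * components p (c t) (velocity c t) 0 i * components p (c t) (W t) 0 j)).
  by apply/is_derive_mxP => i k; rewrite ord1 mxE; exact: P.
have dg : is_derive t 1 (fun s => metric p (chart p (c s)))
    (\matrix_(a, b) \sum_l components p (c t) (velocity c t) 0 l *
       'D_(basis_vec l) (fun y => metric p y a b) (chart p (c t))).
  apply/is_derive_mxP => a b; rewrite mxE.
  have df := metric_diff a b pt.
  have := is_derive_comp_curve (X := chart p \o c) df dX.
  by rewrite derive_partials.
have := is_derive_qf dg dW dW.
rewrite compatibility; last 2 first.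
- exact: metric_pd.
- by move=> k; rewrite mxE.
apply: near_eq_is_derive.
apply: filterS (curve_near C Jt (near_dom pt)) => s ps /=.
by rewrite -innerE.
Qed.

Lemma derive0_const (a b : R) (f : R -> R) : a <= b ->
  (forall s : R, a <= s <= b -> is_derive s 1 f 0) -> f b = f a.
Proof.
move=> ab H; have [s _] := mean_value ab H.
by rewrite mul0r => /eqP; rewrite subr_eq0 => /eqP.
Qed.

(** Applied to the velocity of a geodesic, this is its constant speed. *)
Lemma parallel_tnorm J c W t : open J -> `[0, 1] `<=` J -> C1_curve J c ->
  parallel J c W -> 0 <= t <= 1 -> tnorm (c t) (W t) = tnorm (c 0) (W 0).
Proof.
move=> Jo J01 C P /andP[t0 t1]; rewrite /tnorm; congr Num.sqrt.
apply: (@derive0_const 0 t (fun s => inner (c s) (W s) (W s))) => // s /andP[s0 st].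
apply: parallel_inner_derive Jo C P _; apply: J01.
by rewrite /= in_itv /= s0 (le_trans st).
Qed.

End Charts.

(** * Length of curves and distance *)

Section CurveLength.
Context {R : realType} {r d : nat} {M : riemannian_manifold R r d}.
Context (r3 : (3 < r)%N).
Implicit Types (p q o : M) (v w : 'rV[R]_d) (c : R -> M) (J : set R).

Lemma curve_length_cst (a b s : R) c : a <= b ->
  (forall t, a <= t <= b -> tnorm (c t) (velocity c t) = s) ->
  curve_length a b c = s * (b - a).
Proof.
move=> ab H; rewrite /curve_length.
under eq_Rintegral => t do [rewrite inE /= in_itv /= => tab; rewrite (H _ tab)].
rewrite Rintegral_cst //= lebesgue_measure_itv /= lte_fin.
by case: ltgtP ab => // -> _; rewrite subrr.
Qed.

Lemma path_length_ge0 p q l : path_length p q l -> 0 <= l.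
Proof.
elim=> // c a b q' l' ab _ _ l0; rewrite addr_ge0 // Rintegral_ge0 // => t _.
exact: sqrtr_ge0.
Qed.

Lemma dist_ge0 p q : (0%:E <= dist p q)%E.
Proof.
apply: le_ereal_inf_tmp => _ [l /= /path_length_ge0 l0 <-].
by rewrite lee_fin.
Qed.

Lemma dist_le_length (a b : R) c : a <= b -> C1_segment a b c ->
  (dist (c a) (c b) <= (curve_length a b c)%:E)%E.
Proof.
move=> ab C; apply: ereal_inf_lbound; exists (curve_length a b c) => //=.
by rewrite -[curve_length a b c]addr0; apply: path_cons => //; exact: path_nil.
Qed.

Lemma tnormN p v : tnorm p (- v) = tnorm p v.
Proof.
by rewrite /tnorm /inner -/(qf _ _ _) qfNl qfNr opprK.
Qed.

Lemma dist_refl p : dist p p = 0%E.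
Proof.
apply/eqP; rewrite eq_le dist_ge0 andbT; apply: ereal_inf_lbound.
by exists 0 => //; exact: path_nil.
Qed.

Definition geodesic_on J c := [/\ open J, `[0, 1] `<=` J & geodesic J c].

Lemma geodesic_in J c (t : R) : geodesic_on J c -> 0 <= t <= 1 -> J t.
Proof. by move=> [_ JJ _] H; apply: JJ; rewrite /= in_itv. Qed.

Lemma geodesic_speed J c (t : R) : geodesic_on J c -> 0 <= t <= 1 ->
  tnorm (c t) (velocity c t) = tnorm (c 0) (velocity c 0).
Proof. by move=> [Jo J01 [C P]]; exact: (parallel_tnorm r3 Jo J01 C P). Qed.

Lemma geodesic_length J c (t : R) : geodesic_on J c -> 0 <= t <= 1 ->
  curve_length 0 t c = tnorm (c 0) (velocity c 0) * t.
Proof.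
move=> G /andP[t0 t1].
have H s : 0 <= s <= t -> tnorm (c s) (velocity c s) = tnorm (c 0) (velocity c 0).
  move=> /andP[s0 st].
  by apply: geodesic_speed G _; rewrite s0 (le_trans st).
by rewrite (curve_length_cst t0 H) subr0.
Qed.

Lemma geodesic_dist J c (t : R) : geodesic_on J c -> 0 <= t <= 1 ->
  (dist (c 0%R) (c t) <= (tnorm (c 0%R) (velocity c 0%R) * t)%R%:E)%E.
Proof.
move=> G /[dup] t01 /andP[t0 t1]; rewrite -(geodesic_length G) //.
apply: dist_le_length => //; exists J; case: G => Jo J01 [C _]; split=> //.
move=> s; rewrite /= in_itv /= => /andP[s0 st]; apply: J01.
by rewrite /= in_itv /= s0 (le_trans st).
Qed.

Lemma minimizing_speed p q c : minimizing_geodesic p q c ->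
  dist p q = (tnorm p (velocity c 0))%:E.
Proof.
case=> -[J G] <- <- <-.
by rewrite (geodesic_length G (t := 1)) ?mulr1 // ler01 lexx.
Qed.

(* A path traversed backwards has the same length; only the constant speed of
   geodesics is needed. *)
Lemma minimizing_reverse p q c : minimizing_geodesic p q c ->
  (dist q p <= (tnorm p (velocity c 0%R))%:E)%E.
Proof.
case=> -[J [Jo J01 [C P]]] c0 c1 _.
pose c' (t : R) := c (1 - t).
have C' : C1_curve [set t | J (1 - t)] c'.
  move=> t /= Jt; have [cc H] := C _ Jt; split.
    apply: (@continuous_comp _ _ _ (fun t : R => 1 - t) c); last exact: cc.
    by apply: continuousB; [exact: cst_continuous|exact: cvg_id].
  move=> o ot; have [dH cH] := H o ot.
  have dc (s : R) : J (1 - s) -> dom o (c (1 - s)) ->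
      is_derive s 1 (chart o \o c') (- derive1 (chart o \o c) (1 - s)).
    move=> Js os; have [_ /(_ _ os)[ds _]] := C _ Js.
    have dX : is_derive (1 - s) 1 (chart o \o c) (derive1 (chart o \o c) (1 - s)).
      by rewrite derive1E; exact/derivableP.
    exact: is_derive_reverse.
  split; first by have [] := dc t Jt ot.
  have ev : \forall s \near t, derive1 (chart o \o c') s = - derive1 (chart o \o c) (1 - s).
    have nt : \forall s \near (1 - t), J s /\ dom o (c s).
      apply: filterI; first exact: open_nbhs_nbhs.
      exact: (cc _ (near_dom ot)).
    have cv : (fun s : R => 1 - s) @ t --> 1 - t.
      by apply: cvgB; [exact: cvg_cst|exact: cvg_id].
    have nt' : \forall s \near t, J (1 - s) /\ dom o (c (1 - s)) by exact: cv _ nt.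
    apply: filterS nt' => s [Js os].
    by rewrite derive1E; have [] := dc s Js os.
  have K : - derive1 (chart o \o c) (1 - s) @[s --> t] --> - derive1 (chart o \o c) (1 - t).
    apply: (@cvgN _ _ _ (nbhs t)).
    apply: (@continuous_comp _ _ _ (fun t : R => 1 - t) (derive1 (chart o \o c))).
      by apply: continuousB; [exact: cst_continuous|exact: cvg_id].
    exact: cH.
  have ev0 := nbhs_singleton ev.
  rewrite /prop_for /continuous_at ev0; apply: cvg_trans K.
  by apply: near_eq_cvg; move: ev; apply: filterS => s /esym.
have J'o : open [set t | J (1 - t)].
  apply: (@open_comp _ _ (fun t : R => 1 - t) J) => // t _.
  by apply: continuousB; [exact: cst_continuous|exact: cvg_id].
have J'01 : `[0, 1] `<=` [set t | J (1 - t)].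
  move=> t; rewrite /= in_itv /= => /andP[t0 t1]; apply: J01.
  by rewrite /= in_itv /= subr_ge0 t1 lerBlDl lerDr.
have vel (t : R) : 0 <= t <= 1 -> velocity c' t = - velocity c (1 - t).
  move=> t01; have Jt : J (1 - t) by apply: J'01; rewrite /= in_itv.
  have [_ /(_ _ (dom_self (c (1 - t))))[ds _]] := C _ Jt.
  have dX : is_derive (1 - t) 1 (chart (c (1 - t)) \o c) (velocity c (1 - t)).
    by rewrite /velocity derive1E; exact/derivableP.
  rewrite /velocity [LHS]derive1E.
  by have [_ <-] := is_derive_reverse dX.
have G : geodesic_on J c by [].
have L : curve_length 0 1 c' = tnorm p (velocity c 0).
  have H (t : R) : 0 <= t <= 1 -> tnorm (c' t) (velocity c' t) = tnorm p (velocity c 0).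
    move=> /[dup] t01 /andP[t0 t1]; rewrite vel // tnormN /c'.
    by rewrite (geodesic_speed G) ?c0 // subr_ge0 t1 lerBlDl lerDr.
  by rewrite (curve_length_cst ler01 H) subr0 mulr1.
rewrite -L; have := @dist_le_length 0 1 c' ler01; rewrite /c' subr0 subrr c0 c1.
by apply; exists [set t | J (1 - t)].
Qed.

End CurveLength.

(** * A continuity argument along curves *)

Section Confinement.
Context {R : realType} {T : topologicalType}.

(** Let [t0] be the supremum of the times up to which [c] stays in [K]. Closedness of [K] includes
    [t0], the last hypothesis then puts [c t0] in [O], and openness of [O] carries the curve beyond
    [t0] unless [t0 = 1]. *)
Lemma confinement (c : R -> T) (O K : set T) :
  (forall t : R, 0 <= t <= 1 -> {for t, continuous c}) ->
  open O -> closed K -> O `<=` K -> K (c 0) ->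
  (forall t : R, 0 <= t <= 1 -> (forall s : R, 0 <= s <= t -> K (c s)) -> O (c t)) ->
  forall t : R, 0 <= t <= 1 -> K (c t).
Proof.
move=> cc Oo Kc OK K0 H.
pose E := [set t : R | 0 <= t <= 1 /\ forall s : R, 0 <= s <= t -> K (c s)].
have E0 : E 0.
  by split=> [|s]; [rewrite lexx ler01|rewrite -eq_le => /eqP <-].
have Eub : ubound E 1 by move=> t [/andP[_ ?] _].
have Es : has_sup E by split; [exists 0|exists 1].
pose t0 := sup E.
have t00 : 0 <= t0 by apply: ub_le_sup => //; exists 1.
have t01 : t0 <= 1 by apply: ge_sup => //; exists 0.
have t0i : 0 <= t0 <= 1 by rewrite t00.
have below s : 0 <= s -> s < t0 -> K (c s).
  move=> s0 st; have st' : 0 < t0 - s by rewrite subr_gt0.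
  have [u [_ Hu] su] := sup_adherent st' Es.
  by apply: Hu; rewrite s0 /=; move: su; rewrite opprB addrC subrK => /ltW.
have at0 : K (c t0).
  have [t0E|t0N] := eqVneq t0 0; first by rewrite t0E.
  have t0p : 0 < t0 by rewrite lt_neqAle eq_sym t0N.
  apply: contrapT => nK.
  have nb : nbhs t0 (c @^-1` (~` K)).
    by apply: (cc _ t0i); apply: open_nbhs_nbhs; split=> //; exact: closed_openC.
  have [e /= e0 He] := (@nbhs_ballP _ _ _ _).1 nb.
  pose s := Num.max 0 (t0 - e / 2).
  have s0 : 0 <= s by rewrite /s le_max lexx.
  have st : s < t0 by rewrite /s gt_max t0p ltrBlDr ltrDl divr_gt0.
  apply: (He s _ (below s s0 st)); rewrite /ball /= ger0_norm ?subr_ge0 ?ltW //.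
  have : t0 - e / 2 <= s by rewrite /s le_max lexx orbT.
  lra.
have Et0 : E t0.
  split=> // s /andP[s0]; rewrite le_eqVlt => /orP[/eqP -> //|]; exact: below.
have [t0E|t0N] := eqVneq t0 1.
  by move=> t t1; apply: Et0.2; rewrite t0E.
have t0l : t0 < 1 by rewrite lt_neqAle t0N.
have nb : nbhs t0 (c @^-1` O).
  apply: (cc _ t0i); apply: open_nbhs_nbhs; split=> //.
  exact: H Et0.2.
have [e /= e0 He] := (@nbhs_ballP _ _ _ _).1 nb.
pose t := Num.min 1 (t0 + e / 2).
have tt0 : t0 < t by rewrite /t lt_min t0l ltrDl divr_gt0.
have te : t <= t0 + e / 2 by rewrite /t ge_min lexx orbT.
have t1 : t <= 1 by rewrite /t ge_min lexx.
suff Et : E t by move: (ub_le_sup Es.2 Et); rewrite leNgt tt0.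
split=> [|s /andP[s0 st]]; first by rewrite t1 (le_trans t00 (ltW tt0)).
have [st0|st0] := leP s t0; first by apply: Et0.2; rewrite s0.
apply: OK; apply: He; rewrite /ball /= distrC ger0_norm ?subr_ge0 ?ltW //.
lra.
Qed.

End Confinement.

(** * Uniform bounds in a chart ball *)

Section LocalGeometry.
Context {R : realType} {r d : nat} {M : riemannian_manifold R r d}.
Context (r3 : (3 < r)%N).
Implicit Types (p q o : M) (v w : 'rV[R]_d) (c : R -> M) (J : set R).

Definition chart_ball o (rho : R) : set M :=
  [set q | dom o q /\ `|chart o q - chart o o| <= rho].

(** A single constant serves all the bounds, and [1 <= m] allows [m] to be replaced by its powers.
    Vectors are measured by the sup norm of their coordinates. *)
Record bounded_chart o (rho m : R) := BoundedChart {
  bc_rho : 0 < rho ;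
  bc_m : 1 <= m ;
  bc_image x : `|x - chart o o| <= rho -> (chart o @` dom o) x ;
  bc_lower x v : `|x - chart o o| <= rho -> `|v| ^+ 2 <= m * qf (metric o x) v v ;
  bc_upper x v w : `|x - chart o o| <= rho ->
    `|qf (metric o x) v w| <= m * `|v| * `|w| ;
  bc_christoffel x v w k : `|x - chart o o| <= rho ->
    `|\sum_i \sum_j christoffel o x k i j * v 0 i * w 0 j| <= m * `|v| * `|w| ;
  bc_derive x v i j : `|x - chart o o| <= rho ->
    `|'D_v (fun y => metric o y i j) x| <= m * `|v| }.

(** Row [i] of the inverse solves v A = e_i, hence c |v|^2 <= v_i. *)
Lemma invmx_bound n (A : 'M[R]_n) (c : R) : 0 < c ->
  (forall v : 'rV[R]_n, c * `|v| ^+ 2 <= qf A v v) -> forall i j, `|invmx A i j| <= n%:R / c.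
Proof.
move=> c0 H i j.
have uA : A \in unitmx.
  rewrite unitmxE unitfE; apply/negP => /det0P[v v0 vA].
  have := H v; rewrite /qf vA mul0mx mxE => K.
  have : 0 < c * `|v| ^+ 2 by rewrite mulr_gt0 // exprn_gt0 // normr_gt0.
  by rewrite ltNge K.
pose v : 'rV[R]_n := row i (invmx A).
have vE : invmx A i j = v 0 j by rewrite mxE.
have vA : v *m A = delta_mx 0 i.
  by rewrite /v -row_mul mulVmx // row1.
have : c * `|v| ^+ 2 <= n%:R * `|v|.
  apply: (le_trans (H v)); rewrite /qf vA -rowE mxE mxE.
  apply: (@le_trans _ _ `|v|); first by rewrite (le_trans (ler_norm _)) ?mxE_le_norm.
  by rewrite ler_peMl // ler1n (leq_ltn_trans (leq0n i)).
have [v0 _|v0] := eqVneq v 0.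
  have := mxE_le_norm v 0 j; rewrite -vE v0 normr0 => K.
  by rewrite (le_trans K) // divr_ge0 // ltW.
have nv : 0 < `|v| by rewrite normr_gt0.
rewrite expr2 mulrA ler_pM2r // => K.
by rewrite vE ler_pdivlMr // mulrC (le_trans _ K) // ler_wpM2l ?mxE_le_norm // ltW.
Qed.

Lemma bounded_chart_exists o : exists rho m, bounded_chart o rho m.
Proof.
have oo := dom_self o.
have gc := metric_cont oo.
have [c c0 Hc] := qf_pd_near (metric_pd oo).
have H1 : \forall x \near chart o o, forall v, c * `|v| ^+ 2 <= qf (metric o x) v v.
  exact: gc Hc.
have H2 : \forall x \near chart o o, `|metric o x| <= `|metric o (chart o o)| + 1.
  apply: filterS (near_cont_norm gc ltr01) => x Hx.
  rewrite -[X in `|X|](subKr (metric o (chart o o))) (le_trans (ler_normB _ _)) //.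
  by rewrite lerD2l.
(* The 1 leaves room for continuity: near the centre each derivative exceeds its value there by at
   most 1. *)
pose G0 := 1 + \sum_l \sum_i \sum_j
  `|'D_(basis_vec l) (fun y => metric o y i j) (chart o o)|.
have G00 : 0 <= G0 by rewrite addr_ge0 // !sumr_ge0 // => *; rewrite !sumr_ge0 // => *; rewrite sumr_ge0.
have H3 : \forall x \near chart o o, forall lij : 'I_d * 'I_d * 'I_d,
   `|'D_(basis_vec lij.1.1) (fun y => metric o y lij.1.2 lij.2) x| <= G0.
  suff H (lij : 'I_d * 'I_d * 'I_d) : \forall x \near chart o o,
      `|'D_(basis_vec lij.1.1) (fun y => metric o y lij.1.2 lij.2) x| <= G0.
    exact: filter_forall H.
  case: lij => -[l i] j /=.
  have r1 : (0 < r.-1)%N by case: (r) r3 => [|[]].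
  have ox : (chart o @` dom o) (chart o o) by exists o.
  have pc := Ck_partial_cont (i := l) r1 (metric_Ck o i j) ox.
  apply: filterS (near_cont_norm pc ltr01) => x Hx.
  rewrite -[X in `|X|](subKr ('D_(basis_vec l) (fun y => metric o y i j) (chart o o))).
  rewrite (le_trans (ler_normB _ _)) // addrC lerD //.
  rewrite (bigD1 l) //= (bigD1 i) //= (bigD1 j) //= -!addrA lerDl.
  rewrite !addr_ge0 // !sumr_ge0 // => *; rewrite !sumr_ge0 // => *.
  by rewrite sumr_ge0.
have H4 : \forall x \near chart o o, (chart o @` dom o) x.
  by apply: open_nbhs_nbhs; split; [exact: image_open|exists o].
have [rho /= rho0 Hr] := (@nbhs_ballP _ _ _ _).1 (filterI (filterI H1 H2) (filterI H3 H4)).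
(* One constant per clause: ellipticity, upper bound, Christoffel sum ([d * d] pairs, each half a
   sum of [d] products of an inverse metric entry with three derivatives), directional
   derivative. *)
pose m1 := c^-1.
pose m2 := (d * d)%:R * (`|metric o (chart o o)| + 1).
pose m3 := (d * d)%:R * (2^-1 * (d%:R * (d%:R / c * (3 * G0)))).
pose m4 := d%:R * G0.
have m10 : 0 <= m1 by rewrite invr_ge0 ltW.
have m20 : 0 <= m2 by rewrite mulr_ge0 // addr_ge0.
have m30 : 0 <= m3 by rewrite /m3 !mulr_ge0 ?invr_ge0 // ltW.
have m40 : 0 <= m4 by rewrite mulr_ge0.
exists (rho / 2), (1 + m1 + m2 + m3 + m4).
have Hb x : `|x - chart o o| <= rho / 2 -> ball (chart o o) rho x.
  move=> xr; rewrite -ball_normE /= distrC (le_lt_trans xr) //.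
  by rewrite ltr_pdivrMr // ltr_pMr // ltr1n.
have D3 x : `|x - chart o o| <= rho / 2 -> forall l i j,
   `|'D_(basis_vec l) (fun y => metric o y i j) x| <= G0.
  by move=> /Hb/Hr[_ [K _]] l i j; exact: (K (l, i, j)).
split.
- by rewrite divr_gt0.
- lra.
- by move=> x /Hb/Hr[_ []].
- move=> x v /Hb/Hr[[K _] _].
  have q0 : 0 <= qf (metric o x) v v.
    by apply: le_trans (K v); rewrite mulr_ge0 ?exprn_ge0 // ltW.
  apply: (@le_trans _ _ (m1 * qf (metric o x) v v)).
    by rewrite /m1 mulrC ler_pdivlMr // mulrC.
  by rewrite ler_wpM2r //; lra.
- move=> x v w /Hb/Hr[[_ K] _].
  apply: (le_trans (norm_qf _ _ _)).
  rewrite !ler_wpM2r // (@le_trans _ _ m2) //; last lra.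
  by rewrite ler_wpM2l.
- move=> x v w k xr; have [[K _] _] := Hr _ (Hb _ xr).
  apply: (@le_trans _ _ (m3 * `|v| * `|w|)); last first.
    by rewrite !ler_wpM2r //; lra.
  apply: (le_trans (ler_norm_sum _ _ _)).
  apply: (@le_trans _ _ (\sum_(i < d) \sum_(j < d)
     (2^-1 * (d%:R * (d%:R / c * (3 * G0)))) * `|v| * `|w|)); last first.
    rewrite !sumr_const !card_ord -mulrnA -[leLHS]mulr_natl /m3.
    by rewrite !mulrA.
  apply: ler_sum => i _; apply: (le_trans (ler_norm_sum _ _ _)).
  apply: ler_sum => j _; rewrite !normrM.
  apply: ler_pM; rewrite ?mulr_ge0 ?mxE_le_norm //.
  apply: ler_pM; rewrite ?mulr_ge0 ?mxE_le_norm //.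
  rewrite ger0_norm ?invr_ge0 // ler_wpM2l ?invr_ge0 //.
  apply: (le_trans (ler_norm_sum _ _ _)).
  apply: (@le_trans _ _ (\sum_(l < d) d%:R / c * (3 * G0))); last first.
    by rewrite sumr_const card_ord -[leLHS]mulr_natl.
  apply: ler_sum => l _; rewrite normrM ler_pM //.
    exact: invmx_bound.
  apply: (le_trans (ler_normB _ _)).
  have := ler_normD ('D_(basis_vec i) (fun y => metric o y j l) x)
    ('D_(basis_vec j) (fun y => metric o y i l) x).
  have := D3 x xr i j l; have := D3 x xr j i l; have := D3 x xr l i j; lra.
- move=> x v i j xr.
  have [_ [_ [q oq qx]]] := Hr _ (Hb _ xr).
  have df : differentiable (fun y => metric o y i j) x.
    by rewrite -qx; exact: metric_diff.
  apply: (@le_trans _ _ (m4 * `|v|)); last by rewrite ler_wpM2r //; lra.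
  rewrite derive_partials //; apply: (le_trans (ler_norm_sum _ _ _)).
  apply: (@le_trans _ _ (\sum_(l < d) G0 * `|v|)); last first.
    by rewrite sumr_const card_ord -[leLHS]mulr_natl mulrA.
  apply: ler_sum => l _; rewrite normrM mulrC ler_pM ?mxE_le_norm //.
  exact: D3.
Qed.

(** Closed in the whole manifold, not only in the chart domain: it is the image of a compact
    coordinate ball in a Hausdorff space. *)
Lemma chart_ball_closed o rho m : bounded_chart o rho m -> closed (chart_ball o rho).
Proof.
move=> B; apply: (compact_closed man_hausdorff).
pose A := [set x : 'rV[R]_d | `|x - chart o o| <= rho].
have -> : chart_ball o rho = param o @` A.
  apply/seteqP; split=> [q [oq qr]|q [x xA <-]].
    by exists (chart o q); rewrite ?chartK.
  have [y oy yx] := bc_image B xA.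
  by rewrite -yx chartK //; split; rewrite // yx.
apply: continuous_compact.
  apply: continuous_in_subspaceT => x; rewrite inE => /(bc_image B)[q oq <-].
  exact: param_cont.
apply: bounded_closed_compact.
  exists (`|chart o o| + rho); split; first by rewrite num_real.
  move=> N MN x /= xr; apply: le_trans (ltW MN).
  by rewrite -[x](subrK (chart o o)) addrC (le_trans (ler_normD _ _)) // lerD2l.
rewrite (_ : A = closed_ball (chart o o) rho); first exact: closed_ball_closed.
rewrite closed_ballE ?(bc_rho B) //.
by apply/seteqP; split=> x; rewrite /A /closed_ball_ /= distrC.
Qed.

Lemma chart_ball_near o (rho : R) : 0 < rho -> \forall q \near o, chart_ball o rho q.
Proof.
move=> rho0; apply: filterI; first exact/near_dom/dom_self.
by apply: filterS (near_cont_norm (chart_cont (dom_self o)) rho0) => q; rewrite distrC.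
Qed.

Definition chart_open_ball o (rho : R) : set M :=
  dom o `&` [set q | `|chart o q - chart o o| < rho].

Lemma chart_open_ball_open o rho : open (chart_open_ball o rho).
Proof.
rewrite openE => q [oq qr]; apply: filterI; first exact: near_dom.
have e0 : 0 < (rho - `|chart o q - chart o o|) / 2 by rewrite divr_gt0 // subr_gt0.
apply: filterS (near_cont_norm (chart_cont oq) e0) => q' /= Hq.
have := ler_distD (chart o q) (chart o q') (chart o o).
by rewrite (distrC (chart o q') (chart o q)); move: e0 Hq; lra.
Qed.

Lemma bc_components o rho m q v : bounded_chart o rho m -> chart_ball o rho q ->
  `|components o q v| <= m * tnorm q v.
Proof.
move=> B [oq qr]; have m1 := bc_m B; have m0 : 0 <= m by lra.
rewrite -(@ler_sqr _ `|_|) ?nnegrE ?mulr_ge0 ?tnorm_ge0 // exprMn tnorm_sqr //.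
rewrite (innerE v v oq); apply: (le_trans (bc_lower B _ qr)).
by rewrite ler_wpM2r ?ler_eXnr // qf_pd_ge0 //; exact: metric_pd.
Qed.

Lemma bc_tnorm o rho m q v : bounded_chart o rho m -> chart_ball o rho q ->
  tnorm q v <= m * `|components o q v|.
Proof.
move=> B [oq qr]; have m1 := bc_m B; have m0 : 0 <= m by lra.
rewrite -(@ler_sqr _ (tnorm q v)) ?nnegrE ?mulr_ge0 ?tnorm_ge0 // tnorm_sqr //.
rewrite (innerE v v oq); apply: (le_trans (ler_norm _)).
apply: (le_trans (bc_upper B _ _ qr)); rewrite exprMn -mulrA -expr2.
by rewrite ler_wpM2r ?exprn_ge0 // ler_eXnr.
Qed.

(** * Short geodesics stay in a chart ball *)

Section ConfinedGeodesic.
Variables (o : M) (rho m : R).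
Hypothesis B : bounded_chart o rho m.

Let m1 : 1 <= m. Proof. exact: bc_m B. Qed.
Let m0 : 0 <= m. Proof. exact: le_trans m1. Qed.

Let V c (t : R) := components o (c t) (velocity c t).

Section Curve.
Variables (J : set R) (c : R -> M) (eta : R).
Hypothesis G : geodesic_on J c.
Hypothesis c0 : chart_ball o (rho / 2) (c 0).
Hypothesis speed : tnorm (c 0) (velocity c 0) <= eta.
Hypothesis small : m * eta < rho / 2.

Let C : C1_curve J c. Proof. by case: G => _ _ []. Qed.

Let eta0 : 0 <= eta. Proof. exact: le_trans (tnorm_ge0 _ _) speed. Qed.

Lemma ball_velocity (t : R) : 0 <= t <= 1 -> chart_ball o rho (c t) ->
  `|V c t| <= m * eta.
Proof.
move=> t01 /(bc_components (velocity c t) B) H; apply: (le_trans H).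
by rewrite (geodesic_speed r3 G) // ler_wpM2l.
Qed.

Let position_bound (t : R) : 0 <= t <= 1 ->
  (forall s, 0 <= s <= t -> chart_ball o rho (c s)) ->
  `|chart o (c t) - chart o (c 0)| <= m * eta.
Proof.
move=> /andP[t0 t1] H.
have st (s : R) : 0 <= s <= t -> 0 <= s <= 1.
  by move=> /andP[-> /le_trans]; exact.
apply: (@le_trans _ _ (m * eta * (t - 0))).
  apply: (@mean_value_mx _ _ _ 0 t (m * eta) (fun s => chart o (c s)) (V c)) => //.
  - by rewrite mulr_ge0.
  - move=> s s0t; apply/is_derive_mxP.
    exact: (curve_is_derive r3 C (geodesic_in G (st _ s0t)) (H _ s0t).1).
  - by move=> s s0t; exact: ball_velocity (st _ s0t) (H _ s0t).
by rewrite subr0 ler_piMr // mulr_ge0.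
Qed.

(** While the curve is in the ball its coordinate speed is at most [m * eta], so it moves by less
    than [rho / 2] from a point of the half ball and lies in the open ball: the improvement that
    [confinement] asks for. *)
Lemma geodesic_confined (t : R) : 0 <= t <= 1 -> chart_ball o rho (c t).
Proof.
have rho0 := bc_rho B.
apply: (confinement (O := chart_open_ball o rho)).
- by move=> s s01; have [] := C (geodesic_in G s01).
- exact: chart_open_ball_open.
- exact: chart_ball_closed B.
- by move=> q [oq /ltW].
- case: c0 => o0 H; split=> //; apply: (le_trans H); lra.
move=> s s01 H; split; first by apply: (H s _).1; rewrite lexx andbT; case/andP: s01.
have K := position_bound s01 H; case: c0 => _ H0.
have := ler_distD (chart o (c 0)) (chart o (c s)) (chart o o).
move=> H1; apply: (le_lt_trans H1); rewrite (splitr rho).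
exact: ltr_leD (le_lt_trans K small) H0.
Qed.

(** In coordinates the derivative of [W] is a Christoffel sum, at most [m] times the coordinate
    norms of velocity and field; these are at most [m * eta] and [m] times the constant norm of [W].
    Hence the cube. *)
Lemma confined_transport J' W : open J' -> `[0, 1] `<=` J' -> parallel J' c W ->
  forall t : R, 0 <= t <= 1 ->
  `|components o (c t) (W t) - components o (c 0) (W 0)| <=
    m ^+ 3 * eta * tnorm (c 0) (W 0).
Proof.
move=> J'o J'01 P t /andP[t0 t1].
have [Jo J01 [_ _]] := G.
have st (s : R) : 0 <= s <= t -> 0 <= s <= 1.
  by move=> /andP[-> /le_trans]; exact.
have T (s : R) : 0 <= s <= 1 -> tnorm (c s) (W s) = tnorm (c 0) (W 0).
  apply: (parallel_tnorm r3 (J := J `&` J')).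
  - exact: openI.
  - by move=> u u01; split; [exact: J01|exact: J'01].
  - by move=> u [Ju _]; exact: C.
  - by move=> p u [_ J'u] pu; exact: P.
apply: (@le_trans _ _ (m ^+ 3 * eta * tnorm (c 0) (W 0) * (t - 0))).
  pose dW s := \row_k (- \sum_i \sum_j christoffel o (chart o (c s)) k i j
           * components o (c s) (velocity c s) 0 i * components o (c s) (W s) 0 j).
  apply: (@mean_value_mx _ _ _ 0 t _ (fun s => components o (c s) (W s)) dW) => //.
  - by rewrite !mulr_ge0 // ?exprn_ge0 // tnorm_ge0.
  - move=> s s0t i k; rewrite ord1 mxE; apply: P.
      by apply: J'01; rewrite /= in_itv /= st.
    by have [] := geodesic_confined (st _ s0t).
  - move=> s s0t; apply: norm_mx_le => [|i k].
      by rewrite !mulr_ge0 // ?exprn_ge0 // tnorm_ge0.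
    have cs := geodesic_confined (st _ s0t).
    rewrite mxE normrN; apply: (le_trans (bc_christoffel B _ _ _ cs.2)).
    apply: (@le_trans _ _ (m * (m * eta) * (m * tnorm (c 0) (W 0)))).
      rewrite ler_pM ?mulr_ge0 //.
        by rewrite ler_wpM2l // ball_velocity // st.
      by rewrite -(T s (st _ s0t)); exact: bc_components B cs.
    by rewrite le_eqVlt; apply/orP; left; apply/eqP; ring.
by rewrite subr0 ler_piMr // !mulr_ge0 // ?exprn_ge0 // tnorm_ge0.
Qed.

Lemma confined_acceleration (t : R) : 0 <= t <= 1 ->
  `|V c t - V c 0| <= m ^+ 3 * eta ^+ 2.
Proof.
move=> t01; have [Jo J01 [_ P]] := G.
apply: (le_trans (confined_transport Jo J01 P t01)).
by rewrite expr2 mulrA ler_wpM2l // mulr_ge0 // exprn_ge0.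
Qed.

(** The derivative of the curve minus its tangent line is the change of velocity, already of second
    order. The bound holds for every short geodesic, minimizing or not, so that two of them with
    common endpoints can be compared. *)
Lemma confined_expansion :
  `|chart o (c 1) - chart o (c 0) - V c 0| <= m ^+ 3 * eta ^+ 2.
Proof.
have H := @mean_value_mx R 1 d 0 1 (m ^+ 3 * eta ^+ 2)
  (fun s => chart o (c s) - s *: V c 0) (fun s => V c s - V c 0) ler01.
have := H; rewrite scale0r scale1r !subr0 mulr1.
rewrite (addrAC _ (- V c 0)); apply.
- by rewrite mulr_ge0 // exprn_ge0.
- move=> s s01; apply/is_derive_mxP.
  have cs := geodesic_confined s01.
  have dX := curve_is_derive r3 C (geodesic_in G s01) cs.1.
  have dL := is_derive_scalel (V c 0) s.
  exact: is_deriveB dX dL.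
- by move=> s s01; exact: confined_acceleration.
Qed.

Lemma confined_metric (t : R) : 0 <= t <= 1 ->
  `|metric o (chart o (c t)) - metric o (chart o (c 0))| <= m ^+ 2 * eta.
Proof.
move=> /andP[t0 t1].
have st (s : R) : 0 <= s <= t -> 0 <= s <= 1.
  by move=> /andP[-> /le_trans]; exact.
apply: (@le_trans _ _ (m ^+ 2 * eta * (t - 0))).
  pose dg s := \matrix_(i, j) 'D_(V c s) (fun y => metric o y i j) (chart o (c s)).
  apply: (@mean_value_mx _ _ _ 0 t _ (fun s => metric o (chart o (c s))) dg) => //.
  - by rewrite mulr_ge0 // exprn_ge0.
  - move=> s s0t i j; rewrite mxE.
    have cs := geodesic_confined (st _ s0t).
    have dX := curve_is_derive r3 C (geodesic_in G (st _ s0t)) cs.1.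
    exact: (is_derive_comp_curve (X := chart o \o c) (metric_diff r3 i j cs.1) dX).
  - move=> s s0t; apply: norm_mx_le => [|i j].
      by rewrite mulr_ge0 // exprn_ge0.
    have cs := geodesic_confined (st _ s0t).
    rewrite mxE (le_trans (bc_derive B _ _ _ cs.2)) // expr2 -mulrA ler_wpM2l //.
    by rewrite ball_velocity // st.
by rewrite subr0 ler_piMr // mulr_ge0 // exprn_ge0.
Qed.

End Curve.
End ConfinedGeodesic.

End LocalGeometry.

(** * Expansion of D along one exponential step *)

Section Gradient.
Context {R : realType} {r d : nat} {M : riemannian_manifold R r d}.
Context (r3 : (3 < r)%N).
Variables (D : M -> R) (S : set M).
Hypothesis Dd : forall p, differentiable_at D p.
Hypothesis Sc : geodesically_convex S.

Lemma inner_grad p v : inner p (grad D p) v = 'D_v (D \o param p) (chart p p).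
Proof.
rewrite /inner /grad mulmxKV ?pd_unit //; last exact/metric_pd/dom_self.
rewrite derive_partials; last exact: Dd.
by rewrite mxE; apply: eq_bigr => i _; rewrite !mxE mulrC.
Qed.

Lemma D_continuous : continuous D.
Proof.
move=> p; have H : {for p, continuous ((D \o param p) \o chart p)}.
  apply: continuous_comp; first exact/chart_cont/dom_self.
  exact/differentiable_continuous/Dd.
have {}H : (D \o param p) \o chart p @ p --> D p.
  by move: H; rewrite /prop_for /continuous_at /= chartK //; exact: dom_self.
apply: cvg_trans H; apply: near_eq_cvg.
by apply: filterS (near_dom (dom_self p)) => q pq /=; rewrite chartK.
Qed.

Lemma curve_D_derive J c t : C1_curve J c -> J t ->
  is_derive t 1 (D \o c) (inner (c t) (grad D (c t)) (velocity c t)).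
Proof.
move=> C Jt; set q := c t.
have dX := curve_is_derive r3 C Jt (dom_self q).
rewrite components_self // -/q in dX.
have H := is_derive_comp_curve (X := chart q \o c) (Dd q) dX.
rewrite inner_grad; apply: near_eq_is_derive H.
apply: filterS (curve_near C Jt (near_dom (dom_self q))) => s qs /=.
by rewrite chartK.
Qed.

Variables L b : R.
Hypothesis L0 : 0 <= L.
Hypothesis DL : forall p q c, S p -> S q -> minimizing_geodesic p q c ->
  exists w, is_transport c (grad D p) w /\
    ((tnorm q (w - grad D q))%:E <= L%:E * dist p q)%E.
Hypothesis Db : forall p, S p -> tnorm p (grad D p) <= b.

Section Local.
Variables (o : M) (rho m : R).
Hypothesis B : bounded_chart o rho m.

Let m1 : 1 <= m. Proof. exact: bc_m B. Qed.
Let m0 : 0 <= m. Proof. exact: le_trans m1. Qed.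

(** The Lipschitz condition compares gradients after parallel transport, which gives [m * L]; the
    transport itself moves the coordinates of the bounded gradient, which gives [m ^+ 3 * b]. *)
Lemma grad_chart_lipschitz p q l : S p -> S q -> chart_ball o (rho / 2) p ->
  (dist p q <= l%:E)%E -> m * l < rho / 2 ->
  chart_ball o rho q /\
  `|components o q (grad D q) - components o p (grad D p)| <= (m ^+ 3 * b + m * L) * l.
Proof.
move=> Sp Sq op pql ml.
have [c [mc _ _]] := Sc Sp Sq.
have l'l : tnorm p (velocity c 0) <= l.
  by rewrite -lee_fin -(minimizing_speed r3 mc).
have [[J G] c0 c1 _] := mc.
rewrite -c0 in op l'l.
have q_ball : chart_ball o rho q.
  by rewrite -c1; apply: (geodesic_confined r3 B G op l'l ml); rewrite ler01 lexx.
split=> //; have [w [[J' [W [J'o J'01 P W0 W1]]] wq]] := DL Sp Sq mc.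
have l0 : 0 <= l by rewrite (le_trans (tnorm_ge0 _ _) l'l).
have := confined_transport r3 B G op l'l ml J'o J'01 P (t := 1).
rewrite ler01 lexx => /(_ isT); rewrite W0 W1 c0 c1 => H1.
have H2 : `|components o q (w - grad D q)| <= m * (L * l).
  apply: (le_trans (bc_components _ B q_ball)); rewrite ler_wpM2l //.
  rewrite -lee_fin; apply: (le_trans wq); rewrite EFinM.
  by apply: lee_wpmul2l; rewrite ?lee_fin.
rewrite componentsB in H2.
have H3 : m ^+ 3 * l * tnorm p (grad D p) <= m ^+ 3 * b * l.
  by rewrite mulrAC ler_wpM2r // ler_wpM2l ?exprn_ge0 // Db.
rewrite mulrDl -[m * L * l]mulrA.
rewrite (_ : components o q (grad D q) - components o p (grad D p) =
  (components o q w - components o p (grad D p)) -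
  (components o q w - components o q (grad D q))).
  by rewrite (le_trans (ler_normB _ _)) // lerD // (le_trans H1).
by rewrite subrBB.
Qed.

(** The four summands bound, in order, the four terms of [qf_telescope]. *)
Definition expansion_cst := (m ^+ 3 * b + m * L) * m * m +
  (d * d)%:R * m ^+ 2 * (m * b) * m + m * (m * b) * m ^+ 3 + m * (m * b) * (2 * m ^+ 3).

Lemma gradient_expansion p q v : S p -> S q -> chart_ball o (rho / 2) p ->
  is_Exp p v q -> m * tnorm p v < rho / 2 ->
  `|D q - D p - inner p (grad D p) v| <= expansion_cst * tnorm p v ^+ 2.
Proof.
move=> Sp Sq op [c1 [[J1 G1] c10 v1 c11]] ml.
set l := tnorm p v in ml *.
have b0 : 0 <= b := le_trans (tnorm_ge0 _ _) (Db Sp).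
have s1 : tnorm (c1 0) (velocity c1 0) <= l by rewrite c10 v1.
have dpq : (dist p q <= l%:E)%E.
  have := geodesic_dist r3 G1 (t := 1).
  by rewrite ler01 lexx c10 c11 v1 mulr1 => /(_ isT).
have [c [mc cS _]] := Sc Sp Sq.
have [[J G] c0 cq _] := mc.
have s : tnorm (c 0) (velocity c 0) <= l.
  by rewrite c0 -lee_fin -(minimizing_speed r3 mc).
have l0 : 0 <= l := tnorm_ge0 _ _.
have opc : chart_ball o (rho / 2) (c 0) by rewrite c0.
have opc1 : chart_ball o (rho / 2) (c1 0) by rewrite c10.
have C : C1_curve J c by case: G => _ _ [].
(* The mean value theorem is applied along the minimizing [c], whose points lie in [S], where the
   gradient is controlled; [c1] may leave [S]. *)
have [t t01] : exists2 t, 0 <= t <= 1 &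
    D q - D p = inner (c t) (grad D (c t)) (velocity c t).
  have [t t01] := @mean_value R 0 1 (D \o c) _ ler01
     (fun t t01 => curve_D_derive C (geodesic_in G t01)).
  by rewrite /= c0 cq subr0 mulr1 => E; exists t.
move=> ->; have ct := geodesic_confined r3 B G opc s ml t01.
have oc0 := geodesic_confined r3 B G opc s ml (t := 0).
rewrite lexx ler01 in oc0; have {}oc0 := oc0 isT.
rewrite c0 in oc0.
pose at_ := components o (c t) (grad D (c t)).
pose a0 := components o p (grad D p).
pose Vt := components o (c t) (velocity c t).
pose V0 := components o p (velocity c 0).
pose v0 := components o p v.
rewrite (innerE _ _ ct.1) (innerE _ _ oc0.1) -/at_ -/a0 -/Vt -/v0.
pose gt := metric o (chart o (c t)); pose g0 := metric o (chart o p).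
rewrite -/gt -/g0.
rewrite (qf_telescope _ _ _ _ _ V0).
have na0 : `|a0| <= m * b.
  by rewrite (le_trans (bc_components _ B oc0)) // ler_wpM2l // Db.
have nVt : `|Vt| <= m * l by exact: (ball_velocity r3 B G s t01 ct).
have nat : `|at_ - a0| <= (m ^+ 3 * b + m * L) * l.
  apply: (grad_chart_lipschitz Sp (cS _ t01) op _ ml).2.
  have := geodesic_dist r3 G t01; rewrite c0 => /le_trans; apply.
  rewrite lee_fin -c0 (le_trans _ s) // ler_piMr ?tnorm_ge0 //.
  by case/andP: t01.
have nVV : `|Vt - V0| <= m ^+ 3 * l ^+ 2.
  by have := confined_acceleration r3 B G opc s ml t01; rewrite c0.
(* Both geodesics run from [p] to [q]: subtracting their expansions eliminates the displacement and
   leaves the difference of the initial velocities. *)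
have nvv : `|V0 - v0| <= 2 * m ^+ 3 * l ^+ 2.
  have E1 := confined_expansion r3 B G opc s ml.
  have E2 := confined_expansion r3 B G1 opc1 s1 ml.
  rewrite c0 cq in E1; rewrite c10 c11 v1 in E2.
  rewrite (_ : V0 - v0 = (chart o q - chart o p - v0) - (chart o q - chart o p - V0)).
    by rewrite (le_trans (ler_normB _ _)) // -mulrA mulr_natl mulr2n lerD.
  by rewrite subrBB.
have ng : `|gt - g0| <= m ^+ 2 * l.
  by have := confined_metric r3 B G opc s ml t01; rewrite c0.
have m20 : 0 <= m ^+ 2 by rewrite exprn_ge0.
have m30 : 0 <= m ^+ 3 by rewrite exprn_ge0.
have T1 : `|qf gt (at_ - a0) Vt| <= (m ^+ 3 * b + m * L) * m * m * l ^+ 2.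
  apply: (le_trans (bc_upper B _ _ ct.2)).
  apply: (@le_trans _ _ (m * ((m ^+ 3 * b + m * L) * l) * (m * l))).
    by rewrite ler_pM ?mulr_ge0 // ler_wpM2l.
  by rewrite le_eqVlt; apply/orP; left; apply/eqP; ring.
have T2 : `|qf (gt - g0) a0 Vt| <= (d * d)%:R * m ^+ 2 * (m * b) * m * l ^+ 2.
  apply: (le_trans (norm_qf _ _ _)).
  apply: (@le_trans _ _ ((d * d)%:R * (m ^+ 2 * l) * (m * b) * (m * l))).
    by rewrite ler_pM ?mulr_ge0 // ler_pM ?mulr_ge0 // ler_wpM2l.
  by rewrite le_eqVlt; apply/orP; left; apply/eqP; ring.
have T3 : `|qf g0 a0 (Vt - V0)| <= m * (m * b) * m ^+ 3 * l ^+ 2.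
  apply: (le_trans (bc_upper B _ _ oc0.2)).
  by rewrite -[leRHS]mulrA ler_pM ?mulr_ge0 // ler_wpM2l.
have T4 : `|qf g0 a0 (V0 - v0)| <= m * (m * b) * (2 * m ^+ 3) * l ^+ 2.
  apply: (le_trans (bc_upper B _ _ oc0.2)).
  by rewrite -[leRHS]mulrA ler_pM ?mulr_ge0 // ler_wpM2l.
apply: (le_trans (ler_normD _ _)); rewrite /expansion_cst mulrDl lerD //.
apply: (le_trans (ler_normD _ _)); rewrite mulrDl lerD //.
by apply: (le_trans (ler_normD _ _)); rewrite mulrDl lerD.
Qed.

End Local.

End Gradient.

(** * Integrals of nonmeasurable functions *)

Section NonmeasurableIntegral.
Context {dT} {T : measurableType dT} {R : realType} (mu : {measure set T -> \bar R}).
Local Open Scope ereal_scope.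

(* The integral of a nonnegative function is a supremum over simple functions
   below it, so monotonicity needs no measurability. *)
Lemma ge0_le_integral_nomeas (D : set T) (f g : T -> \bar R) :
  (forall x, D x -> 0 <= f x) -> (forall x, D x -> f x <= g x) ->
  \int[mu]_(x in D) f x <= \int[mu]_(x in D) g x.
Proof.
move=> f0 fg; rewrite !ge0_integralE //; last first.
  by move=> x Dx; apply: le_trans (fg _ Dx); exact: f0.
apply: ereal_sup_le => _ [h /= hf <-].
exists h => // x; apply: (le_trans (hf x)); rewrite /patch; case: ifPn => // /[!inE].
exact: fg.
Qed.

End NonmeasurableIntegral.

(** * Distance bounded by coordinate segments *)

Section StraightLine.
Context {R : realType} {r d : nat} {M : riemannian_manifold R r d}.
Context (r3 : (3 < r)%N).
Implicit Types (p q o : M) (v w : 'rV[R]_d) (c : R -> M) (J : set R).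

Lemma curve_length_le (a b s : R) c : a <= b ->
  (forall t, a <= t <= b -> tnorm (c t) (velocity c t) <= s) ->
  curve_length a b c <= s * (b - a).
Proof.
move=> ab H.
have s0 : 0 <= s by rewrite (le_trans (tnorm_ge0 _ _) (H a _)) // lexx ab.
rewrite /curve_length /Rintegral.
have E : (\int[lebesgue_measure]_(t in `[a, b]) s%:E = (s * (b - a))%:E)%E.
  rewrite integral_cst //= lebesgue_measure_itv /= lte_fin.
  by case: ltgtP ab => // -> _; rewrite subrr mulr0 mule0.
have LE : (\int[lebesgue_measure]_(t in `[a, b]) (tnorm (c t) (velocity c t))%:E
    <= (s * (b - a))%:E)%E.
  rewrite -E; apply: ge0_le_integral_nomeas => t; rewrite /= in_itv /= => tab.
    by rewrite lee_fin tnorm_ge0.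
  by rewrite lee_fin H.
(* [fine] sends an infinite value to 0, so it preserves the inequality only once the integral is
   known to be finite. *)
rewrite -[leRHS]/(fine (s * (b - a))%:E) fine_le //.
rewrite ge0_fin_numE; first by rewrite (le_lt_trans LE) // ltry.
by apply: integral_ge0 => t _; rewrite lee_fin tnorm_ge0.
Qed.

Lemma chart_line_C1 o (h : 'rV[R]_d) :
  let x0 := chart o o in
  C1_curve [set t : R | (chart o @` dom o) (x0 + t *: h)]
    (fun t => param o (x0 + t *: h)).
Proof.
move=> x0; set J := [set t | _]; set c := fun t => _.
pose aff (t : R) := x0 + t *: h.
have affc : continuous aff.
  by move=> t; apply: cvgD; [exact: cvg_cst|exact: scalel_continuous].
have Jo : open J.
  apply: (@open_comp _ _ (fun t : R => x0 + t *: h) (chart o @` dom o)).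
    by move=> t _; exact: affc.
  exact: image_open.
move=> t Jt; have [y oy yE] := Jt.
have cy : c t = y by rewrite /c -yE chartK.
have cc : {for t, continuous c}.
  apply: (@continuous_comp _ _ _ aff (param o)); first exact: affc.
  by rewrite /aff -yE; exact: param_cont.
split=> // p; rewrite cy => py.
have near_t : \forall s \near t, J s /\ dom p (c s).
  apply: filterI; first exact: open_nbhs_nbhs.
  by apply: cc; rewrite cy; exact: near_dom.
have dc s : J s -> dom p (c s) ->
    is_derive s 1 (chart p \o c) ('D_h (chart p \o param o) (aff s)).
  move=> [z oz zE] ps; apply: (is_derive_line (f := chart p \o param o)).
  rewrite /aff -zE; apply/derivableP/diff_derivable/transition_diff => //.
  by move: ps; rewrite /c -zE chartK.
have [pt Jt'] : dom p (c t) /\ J t by rewrite cy.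
split; first by have [] := dc t Jt' pt.
(* The derivative is written through the partial derivatives of the transition map, whose continuity
   comes from [transition_Ck]. *)
have ev : \forall s \near t, derive1 (chart p \o c) s =
    \row_j \sum_i h 0 i * 'D_(basis_vec i) (fun x => (chart p \o param o) x 0 j) (aff s).
  apply: filterS near_t => s [Js ps]; rewrite derive1E.
  have [_ ->] := dc s Js ps; have [z oz zE] := Js.
  have df : differentiable (chart p \o param o) (aff s).
    by rewrite /aff -zE; apply: transition_diff => //; move: ps; rewrite /c -zE chartK.
  rewrite -mulmx_jacobian //; apply/rowP => j; rewrite !mxE; apply: eq_bigr => i _.
  by rewrite jacobianE.
have ev0 := nbhs_singleton ev.
pose F i j (s : R) := 'D_(basis_vec i) (fun x => (chart p \o param o) x 0 j) (aff s).
have Fc i j : {for t, continuous (F i j)}.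
  apply: (@continuous_comp _ _ _ aff
    (fun z => 'D_(basis_vec i) (fun x => (chart p \o param o) x 0 j) z) t (affc t)).
  have r1 : (0 < r)%N by case: (r) r3.
  rewrite /aff -yE; apply: (Ck_partial_cont (i := i) r1 (transition_Ck o p j)).
  by exists y.
have K : {for t, continuous (fun s : R => \row_j \sum_i h 0 i * F i j s)}.
  apply: continuous_mx => i0 j.
  have E : (fun s => (\row_j \sum_i h 0 i * F i j s) i0 j) =
      (fun s => \sum_i h 0 i * F i j s) by apply/funext => s; rewrite mxE.
  rewrite E /prop_for /continuous_at.
  apply: (@cvg_sumr R _ (nbhs t) _ R _ _ _ (fun i s => h 0 i * F i j s)) => i _.
  exact: (@cvgM _ _ (nbhs t) _ (fun=> h 0 i) (F i j) _ _ (cvg_cst _) (Fc i j)).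
rewrite /prop_for /continuous_at ev0; apply: cvg_trans K.
by apply: near_eq_cvg; move: ev; apply: filterS => s /esym.
Qed.

(** The coordinate segment has constant coordinate velocity [h], hence length at most m |h|. This
    lets estimates in terms of [dist] yield continuity in the topology of the manifold. *)
Lemma dist_chart_le o rho m q : bounded_chart o rho m -> chart_ball o rho q ->
  (dist o q <= (m * `|chart o q - chart o o|)%:E)%E.
Proof.
move=> B [oq qr]; set x0 := chart o o; set h := chart o q - x0.
have C := @chart_line_C1 o h; rewrite -/x0 /= in C.
set J := [set t | _] in C; set c := fun t => _ in C.
have ball_t (t : R) : 0 <= t <= 1 -> `|x0 + t *: h - x0| <= rho.
  move=> /andP[t0 t1]; rewrite addrC addKr normrZ ger0_norm //.
  by apply: le_trans qr; rewrite ler_piMl.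
have J01 : `[0, 1] `<=` J.
  by move=> t; rewrite /= in_itv /= => t01; exact/(bc_image B)/ball_t.
have affc : continuous (fun t : R => x0 + t *: h).
  by move=> t; apply: cvgD; [exact: cvg_cst|exact: scalel_continuous].
have Jo : open J.
  apply: (@open_comp _ _ (fun t : R => x0 + t *: h) (chart o @` dom o)).
    by move=> t _; exact: affc.
  exact: image_open.
have c0 : c 0 = o by rewrite /c scale0r addr0 chartK //; exact: dom_self.
have c1 : c 1 = q by rewrite /c scale1r addrC subrK chartK.
have L : curve_length 0 1 c <= m * `|h| * (1 - 0).
  apply: curve_length_le => // t t01.
  have Jt : J t by apply: J01; rewrite /= in_itv.
  have [y oy yE] := Jt.
  have cy : c t = y by rewrite /c -yE chartK.
  have oc : dom o (c t) by rewrite cy.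
  have cb : chart_ball o rho (c t) by split; rewrite // cy yE ball_t.
  apply: (le_trans (bc_tnorm _ B cb)); rewrite -(curve_velocity r3 C Jt oc).
  suff -> : derive1 (chart o \o c) t = h by [].
  have dl : is_derive t 1 (fun t : R => x0 + t *: h) h.
    have := is_deriveD (is_derive_cst x0 t 1) (is_derive_scalel h t).
    by rewrite add0r.
  rewrite derive1E; have [] : is_derive t 1 (chart o \o c) h; last by [].
  apply: near_eq_is_derive dl.
  apply: filterS (open_nbhs_nbhs (conj Jo Jt)) => s [z oz zE] /=.
  by rewrite /c -zE chartK.
rewrite subr0 mulr1 in L.
rewrite -{1}c0 -c1; apply: (@le_trans _ _ (curve_length 0 1 c)%:E).
  by apply: dist_le_length => //; exists J.
by rewrite lee_fin.
Qed.

End StraightLine.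

(** * Second-order expansion at a stationary point *)

Section SecondOrder.
Context {R : realType} {d : nat}.

Lemma differentiable_expansion (V W : normedModType R) (f : V -> W) (x : V) :
  differentiable f x -> forall e : R, 0 < e -> \forall h \near (0 : V),
    `|f (h + x) - f x - 'd f x h| <= e * `|h|.
Proof.
move=> /diff_locally/eqaddoP H e e0.
apply: filterS (H _ e0) => h; rewrite !fctE /=; congr (_ <= _); congr (`| _ |).
by rewrite opprD addrA.
Qed.

Variables (f : 'rV[R]_d -> R).
Hypothesis f2 : twice_differentiable f 0.
Hypothesis f0 : f 0 = 0.
Hypothesis df0 : forall i, 'D_(basis_vec i) f 0 = 0.

Let H := hessian f 0.
Let w (y : 'rV[R]_d) : 'rV[R]_d := \row_i 'D_(basis_vec i) f y.

Lemma gradient_first_order (e : R) : 0 < e ->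
  \forall y \near (0 : 'rV[R]_d), `|w y - y *m H| <= e * `|y|.
Proof.
move=> e0.
suff K (j : 'I_d) : \forall y \near (0 : 'rV[R]_d),
    `|'D_(basis_vec j) f y - (y *m H) 0 j| <= e * `|y|.
  have {}K : \forall y \near (0 : 'rV[R]_d), forall j,
    `|'D_(basis_vec j) f y - (y *m H) 0 j| <= e * `|y| := @filter_forall _ _ _ _ (nbhs_filter _) K.
  apply: filterS K => y K.
  apply: norm_mx_le => [|i j]; first by rewrite mulr_ge0 // ltW.
  rewrite ord1; have -> : (w y - y *m H) 0 j = 'D_(basis_vec j) f y - (y *m H) 0 j.
    by rewrite mxE [X in X + _]mxE [X in _ + X]mxE.
  exact: K.
have [_ /(_ j) dj] := f2.
apply: filterS (differentiable_expansion dj e0) => y.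
have -> : (y *m H) 0 j = 'd ('D_(basis_vec j) f) 0 y.
  by rewrite -deriveE // derive_partials // mxE; apply: eq_bigr => i _; rewrite mxE.
by rewrite addr0 df0 subr0.
Qed.

(* Mean value theorem for [t |-> f (t y) - t ^ 2 / 2 y H y^T]. *)
Lemma taylor_second_order (e : R) : 0 < e ->
  \forall y \near (0 : 'rV[R]_d), `|f y - 2^-1 * qf H y y| <= e * `|y| ^+ 2.
Proof.
move=> e0; pose e' := e / d.+1%:R.
have e'0 : 0 < e' by rewrite divr_gt0.
have [r /= r0 Hr] := (@nbhs_ballP _ _ _ _).1
  (filterI f2.1 (gradient_first_order e'0)).
apply: filterS (@near0_norm_lt _ 'rV[R]_d r r0) => y yr.
have yt (t : R) : 0 <= t <= 1 -> ball (0 : 'rV[R]_d) r (t *: y).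
  move=> /andP[t0 t1]; rewrite -ball_normE /= sub0r normrN normrZ ger0_norm //.
  by apply: le_lt_trans yr; rewrite ler_piMl.
pose h (t : R) := f (0 + t *: y) - 2^-1 * (t * t) * qf H y y.
pose dh (t : R) := \sum_i y 0 i * ((w (t *: y)) 0 i - ((t *: y) *m H) 0 i).
have dhE (t : R) : 0 <= t <= 1 -> is_derive t 1 h (dh t).
  move=> t01; have [ft _] := Hr _ (yt t t01).
  have d1 : is_derive t 1 (fun t : R => f (0 + t *: y)) ('D_y f (t *: y)).
    apply: is_derive_line; rewrite add0r; exact/derivableP/diff_derivable.
  have d2 : is_derive t 1 (fun t : R => 2^-1 * (t * t) * qf H y y) (t * qf H y y).
    have K := is_deriveM (is_derive_id t (1 : R)) (is_derive_id t (1 : R)).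
    have K2 := is_deriveM (is_deriveM (is_derive_cst (2^-1 : R) t (1 : R)) K)
      (is_derive_cst (qf H y y) t (1 : R)).
    have E (a b : R) : 2^-1 * (a * a) * 0 + b * (2^-1 * (a * 1 + a * 1) + (a * a) * 0)
       = a * b by field.
    by apply: (is_derive_eq K2); exact: E.
  have dd := is_deriveB d1 d2.
  have E : 'D_y f (t *: y) - t * qf H y y = dh t.
    rewrite derive_partials // /dh; under [RHS]eq_bigr do rewrite mulrBr.
    rewrite sumrB; congr (_ - _).
      by apply: eq_bigr => i _; rewrite mxE.
    rewrite /qf mxE mulr_sumr; apply: eq_bigr => i _.
    have -> : (t *: y *m H) 0 i = t * (y *m H) 0 i by rewrite -scalemxAl mxE.
    rewrite [y^T i 0]mxE; ring.
  by apply: (is_derive_eq dd); exact: E.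
have [s s01] := mean_value (ler01 : (0 : R) <= 1) dhE.
have -> : h 1 - h 0 = f y - 2^-1 * qf H y y.
  by rewrite /h scale1r scale0r !add0r f0; ring.
rewrite subr0 mulr1 => ->.
apply: (le_trans (ler_norm_sum _ _ _)).
apply: (@le_trans _ _ (\sum_(i < d) `|y| * (e' * `|y|))).
  apply: ler_sum => i _; rewrite normrM ler_pM ?mxE_le_norm //.
  have [_ K] := Hr _ (yt s s01).
  have := mxE_le_norm (w (s *: y) - s *: y *m H) 0 i.
  rewrite [X in `|X| <= _]mxE [X in `|_ + X| <= _]mxE => /le_trans; apply.
  apply: (le_trans K); rewrite ler_wpM2l ?(ltW e'0) // normrZ.
  by case/andP: s01 => s0 s1; rewrite ger0_norm // ler_piMl.
rewrite sumr_const card_ord -mulr_natl /e' expr2.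
have -> : d%:R * (`|y| * (e / d.+1%:R * `|y|)) = (d%:R / d.+1%:R) * (e * (`|y| * `|y|)) :> R.
  ring.
rewrite ler_piMl ?mulr_ge0 // ?(ltW e0) //.
by rewrite ler_pdivrMr // mul1r ler_nat.
Qed.

End SecondOrder.

(** * Normal coordinates and the local drift *)

Section NormalCoordinates.
Context {R : realType} {r d : nat} {M : riemannian_manifold R r d}.
Context (r3 : (3 < r)%N).
Variables (D : M -> R) (S : set M) (ths : M).
Hypothesis Dd : forall p, differentiable_at D p.
Variables (e : 'M[R]_d) (kappa : M -> 'rV[R]_d) (nu : 'rV[R]_d -> M).
Hypothesis Hn : normal_coordinates S ths e kappa nu.
Hypothesis Sths : S ths.
Hypothesis D0 : D ths = 0.
Hypothesis gD0 : grad D ths = 0.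

Let e1 : e *m metric ths (chart ths ths) *m e^T = 1%:M.
Proof. by case: Hn. Qed.

Lemma tnorm_frame y : tnorm ths (y *m e) ^+ 2 = qf 1%:M y y.
Proof. by rewrite tnorm_sqr /inner -/(qf _ _ _) -qf_mul e1. Qed.

(** Normal coordinates come with geodesics issued from [ths], while the distance is measured towards
    [ths]; hence the reversal. *)
Lemma dist_normal p : S p -> exists2 s : R, (dist p ths <= s%:E)%E &
  0 <= s /\ s ^+ 2 = qf 1%:M (kappa p) (kappa p).
Proof.
move=> Sp; have [_ _ /(_ p Sp)[c [mc vc]]] := Hn.
exists (tnorm ths (kappa p *m e)); last by rewrite tnorm_frame tnorm_ge0.
by rewrite -vc; exact: minimizing_reverse mc.
Qed.

(** The minimizing geodesic from [ths] to itself has length 0, hence zero initial velocity. *)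
Lemma kappa_ths : kappa ths = 0.
Proof.
have [_ _ /(_ ths Sths)[c [mc vc]]] := Hn.
have := minimizing_speed r3 mc; rewrite dist_refl vc => -[t0].
have := tnorm_frame (kappa ths); rewrite -t0 expr0n /= => q0.
by apply/eqP/negPn/negP => /(pd1 _).2; rewrite -/(qf _ _ _) -q0 ltxx.
Qed.

Definition normal_domain : set M := [set p | nu (kappa p) = p /\
  {for p, continuous kappa} /\ is_Exp ths (kappa p *m e) p].

Lemma S_normal_domain p : S p -> normal_domain p.
Proof.
move=> Sp; have [_ [U [_ KU [Uo SU] _ CU]] _] := Hn.
have [y Uy yp] := SU p Sp; have [E K] := KU y Uy.
have kp : kappa p = y by rewrite -yp.
split; first by rewrite kp.
split; last by rewrite kp -yp.
have pp := dom_self p.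
have c1 : {for chart p p, continuous (kappa \o param p)}.
  apply: continuous_mx => i j; rewrite ord1.
  by apply: (Ck_cont ((CU p).2 j)); exists p => //; split=> //; exists y.
have {}c1 : (kappa \o param p) \o chart p @ p --> kappa p.
  have E1 : ((kappa \o param p) \o chart p) p = kappa p by rewrite /= chartK.
  by rewrite -[X in _ --> X]E1; exact: (continuous_comp (chart_cont pp) c1).
apply: cvg_trans c1; apply: near_eq_cvg.
by apply: filterS (near_dom pp) => q pq /=; rewrite chartK.
Qed.

(** The exponential map at [ths], read in the chart selected there. *)
Let F := chart ths \o nu.

Lemma nu0 : nu 0 = ths.
Proof. by rewrite -kappa_ths; have [] := S_normal_domain Sths. Qed.

Lemma nu_facts : exists U : set 'rV[R]_d, [/\ open U, U 0,
  forall y, U y -> is_Exp ths (y *m e) (nu y),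
  forall y, U y -> {for y, continuous nu} &
  forall p j, Ck r.-2 (U `&` nu @^-1` dom p) (fun y => (chart p \o nu) y 0 j)].
Proof.
have [_ [U [[Uo U0 _] KU _ cU CU]] _] := Hn.
exists U; split=> //; first by move=> y /KU[].
by move=> p; have [] := CU p.
Qed.

Lemma nu_diff : \forall y \near (0 : 'rV[R]_d), forall p, dom p (nu y) ->
  differentiable (chart p \o nu) y.
Proof.
have [U [Uo U0 _ cU CU]] := nu_facts.
apply: filterS (open_nbhs_nbhs (conj Uo U0)) => y Uy p py.
have O : open (U `&` nu @^-1` dom p).
  rewrite openE => z [Uz nz]; apply: filterI; first exact: open_nbhs_nbhs.
  by apply: cU => //; exact: near_dom.
apply: differentiable_row => j; apply: (Ck_diff _ O (CU p j)) => //.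
by case: (r) r3 => [|[|[|]]].
Qed.

Lemma F_regular : \forall y \near (0 : 'rV[R]_d),
  dom ths (nu y) /\ differentiable F y.
Proof.
have [U [Uo U0 _ cU CU]] := nu_facts.
have n0 : nbhs (0 : 'rV[R]_d) (nu @^-1` dom ths).
  by apply: cU => //; rewrite nu0; exact/near_dom/dom_self.
by apply: filterS (filterI n0 nu_diff) => y [ny H]; split=> //; apply: H.
Qed.

Lemma F_partial_cont i j :
  {for (0 : 'rV[R]_d), continuous (fun y => 'D_(basis_vec i) (fun z => F z 0 j) y)}.
Proof.
have [U [Uo U0 _ cU CU]] := nu_facts.
have r2 : (0 < r.-2)%N by case: (r) r3 => [|[|[|]]].
apply: (Ck_partial_cont (i := i) r2 (CU ths j)).
by split=> //=; rewrite nu0; exact: dom_self.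
Qed.

Lemma F_expansion : exists C : R, \forall y \near (0 : 'rV[R]_d),
  `|F y - F 0 - y *m e| <= C * `|y| ^+ 2.
Proof.
have [rho [m B]] := bounded_chart_exists r3 ths.
have rho0 := bc_rho B; have m1 := bc_m B.
have m0 : 0 < m by lra.
have [U [Uo U0 EU _ _]] := nu_facts.
pose N : R := (d * d)%:R * `|1%:M : 'M[R]_d| + 1.
have N0 : 0 < N by rewrite ltr_wpDl // mulr_ge0.
have N1 y : tnorm ths (y *m e) ^+ 2 <= N * `|y| ^+ 2.
  rewrite tnorm_frame (le_trans (ler_norm _)) // (le_trans (norm_qf _ _ _)) //.
  by rewrite -mulrA -expr2 ler_wpM2r ?exprn_ge0 // /N lerDl.
exists (m ^+ 3 * N).
(* For |y| < 1 one has |y|^2 <= |y| < t, so the geodesic with initial velocity [y *m e] is short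
   enough for [confined_expansion]. *)
pose t : R := (rho / 4 / m) ^+ 2 / N.
have t0 : 0 < t by rewrite divr_gt0 // exprn_gt0 // !divr_gt0.
have n1 : \forall y \near (0 : 'rV[R]_d), `|y| < Num.min 1 t.
  by apply: near0_norm_lt; rewrite lt_min ltr01 t0.
apply: filterS (filterI n1 (open_nbhs_nbhs (conj Uo U0))) => y [].
rewrite lt_min => /andP[y1 yt] Uy.
have [c [[J G] c0 v0 c1]] := EU y Uy.
have sm : m * tnorm ths (y *m e) < rho / 2.
  have : tnorm ths (y *m e) <= rho / 4 / m.
    rewrite -(@ler_sqr _ (tnorm _ _)) ?nnegrE ?tnorm_ge0 // ?divr_ge0 ?(ltW m0) //; last first.
      exact: ltW.
    apply: (le_trans (N1 y)); move: yt; rewrite /t ltr_pdivlMr // => yt.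
    rewrite mulrC (le_trans _ (ltW yt)) // ler_wpM2r ?(ltW N0) //.
    by rewrite expr2 ler_piMr // ltW.
  rewrite ler_pdivlMr // mulrC; lra.
have cb : chart_ball ths (rho / 2) (c 0).
  by rewrite c0; split; [exact: dom_self|rewrite subrr normr0 divr_ge0 // ltW].
have sp : tnorm (c 0) (velocity c 0) <= tnorm ths (y *m e) by rewrite c0 v0.
have := confined_expansion r3 B G cb sp sm.
rewrite c0 c1 v0 components_self // /F /= nu0 => H; apply: (le_trans H).
by rewrite -mulrA ler_wpM2l ?exprn_ge0 // ltW.
Qed.

(** [F] has two first-order expansions at 0, with linear parts its differential and [y *m e];
    evaluated at small multiples of [v], they force these to agree. *)
Lemma jacobian_F0 : jacobian F 0 = e.
Proof.
have [C HC] := F_expansion; have dF := (nbhs_singleton F_regular).2.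
apply: eq_mulmx_row => v; rewrite mulmx_jacobian //.
pose C' := `|C| + 1; have C'0 : 0 < C' by rewrite ltr_wpDl.
have C'C y : `|F y - F 0 - y *m e| <= C * `|y| ^+ 2 ->
    `|F y - F 0 - y *m e| <= C' * `|y| ^+ 2.
  move=> /le_trans; apply; rewrite ler_wpM2r ?exprn_ge0 //.
  by rewrite (le_trans (ler_norm C)) // lerDl.
rewrite deriveE //; apply/eqP; rewrite -subr_eq0 -normr_eq0 eq_le normr_ge0 andbT.
apply/ler_addgt0Pr => eps eps0; rewrite add0r.
have [v0|v0] := eqVneq v 0.
  by rewrite v0 linear0 mul0mx subrr normr0 ltW.
have nv : 0 < `|v| by rewrite normr_gt0.
pose e1' := eps / 2 / `|v|; have e10 : 0 < e1' by rewrite !divr_gt0.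
have [rr /= rr0 Hr] := (@nbhs_ballP _ _ _ _).1
  (filterI HC (differentiable_expansion dF e10)).
(* The first bound keeps [s *: v] in the ball of validity; the second makes the quadratic error at
   most s eps / 2. *)
pose s := Num.min (rr / 2 / `|v|) (eps / 2 / C' / `|v| ^+ 2).
have s0 : 0 < s by rewrite lt_min !divr_gt0 // exprn_gt0.
have bs : ball (0 : 'rV[R]_d) rr (s *: v).
  rewrite -ball_normE /= sub0r normrN normrZ gtr0_norm //.
  have : s <= rr / 2 / `|v| by rewrite ge_min lexx.
  rewrite ler_pdivlMr // => K; lra.
have [/C'C K1 K2] := Hr _ bs.
rewrite addr0 in K2.
have K3 : `|s *: ('d F 0 v - v *m e)| <= s * eps.
  rewrite scalerBr -linearZ scalemxAl.
  rewrite (_ : 'd F 0 (s *: v) - (s *: v) *m e =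
     (F (s *: v) - F 0 - (s *: v) *m e) - (F (s *: v) - F 0 - 'd F 0 (s *: v))); last first.
    by rewrite subrBB.
  apply: (le_trans (ler_normB _ _)); rewrite (splitr eps) mulrDr lerD //.
    apply: (le_trans K1); rewrite normrZ gtr0_norm // exprMn expr2 -!mulrA.
    rewrite mulrCA ler_pM2l //.
    have : s <= eps / 2 / C' / `|v| ^+ 2 by rewrite ge_min lexx orbT.
    rewrite ler_pdivlMr ?exprn_gt0 // ler_pdivlMr // => K.
    by rewrite mulrC.
  apply: (le_trans K2); rewrite normrZ gtr0_norm // mulrCA ler_pM2l //.
  by rewrite /e1' divfK // gt_eqF.
by move: K3; rewrite normrZ gtr0_norm // ler_pM2l.
Qed.

Let f := D \o nu.
Let w (y : 'rV[R]_d) : 'rV[R]_d := \row_i 'D_(basis_vec i) f y.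
Let grad_comp y := components ths (nu y) (grad D (nu y)).
Let g y := metric ths (chart ths (nu y)).

(** Chain rule: a partial derivative of D o nu is the inner product of grad D with the image of a
    basis vector under the differential of [nu]. *)
Lemma gradient_pullback : \forall y \near (0 : 'rV[R]_d),
  w y = grad_comp y *m g y *m (jacobian F y)^T.
Proof.
have [U [Uo U0 _ cU _]] := nu_facts.
apply: filterS (filterI (open_nbhs_nbhs (conj Uo U0)) (filterI F_regular nu_diff)).
move=> y [Uy [[dy dF] dnu]].
set p := nu y; have pp := dom_self p; have dp := dnu p pp.
have dDp : differentiable (D \o param p) ((chart p \o nu) y) by exact: Dd.
apply/rowP => i; rewrite mxE.
have E : 'D_(basis_vec i) f y = 'D_(basis_vec i) ((D \o param p) \o (chart p \o nu)) y.
  apply: near_eq_derive; apply: filterS (near_comp (cU y Uy) (near_dom pp)) => z pz /=.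
  by rewrite /f /= chartK.
rewrite E deriveE; last exact: differentiable_comp.
rewrite diff_comp //= -deriveE // -[X in 'D_X _ _]deriveE //.
rewrite -inner_grad // (innerE _ _ dy) -/(g y) -/(grad_comp y).
have -> : components ths p ('D_(basis_vec i) (chart p \o nu) y) =
    basis_vec i *m jacobian F y.
  rewrite -(mulmx_jacobian (basis_vec i) dp) /components -mulmxA; congr (_ *m _).
  have dT : differentiable (chart ths \o param p) ((chart p \o nu) y).
    exact: (transition_diff r3 pp dy).
  transitivity (jacobian ((chart ths \o param p) \o (chart p \o nu)) y).
    exact/esym/(jacobian_comp dp dT).
  apply: near_jacobian => //; last exact: differentiable_comp.
  apply: filterS (near_comp (cU y Uy) (near_dom pp)) => z pz /=.
  by rewrite /F /= chartK.
rewrite /qf trmx_mul mulmxA /basis_vec trmx_delta.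
by rewrite mulmx_delta_col.
Qed.

(** With J the Jacobian of F, [gradient_pullback] gives w = a g J^T, so |w|^2 is the form of (g J^T)
    (g J^T)^T at a, while |grad D|^2 is the form of g at a. At 0 one has J = e, and orthonormality
    of the frame makes both matrices equal. *)
Lemma pullback_metric_cvg :
  (fun y => g y *m (jacobian F y)^T *m 1%:M *m (g y *m (jacobian F y)^T)^T - g y)
    @ (0 : 'rV[R]_d) --> (0 : 'M[R]_d).
Proof.
have dF := nbhs_singleton F_regular.
have gc : g @ (0 : 'rV[R]_d) --> metric ths (chart ths ths).
  have E : metric ths (chart ths ths) = (metric ths \o F) 0 by rewrite /F /= nu0.
  rewrite E; apply: continuous_comp; first exact/differentiable_continuous/dF.2.
  by rewrite /F /= nu0; apply: metric_cont; exact: dom_self.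
have Jc : jacobian F @ (0 : 'rV[R]_d) --> e.
  rewrite -jacobian_F0; apply: (@cvg_mx R _ (nbhs (0 : 'rV[R]_d))) => i j.
  have K := @F_partial_cont i j.
  rewrite /prop_for /continuous_at -(jacobianE i j dF.2) in K.
  apply: cvg_trans K; apply: near_eq_cvg.
  by apply: filterS F_regular => y [_ dy]; rewrite jacobianE.
have Kc : (fun y => g y *m (jacobian F y)^T) @ (0 : 'rV[R]_d) -->
    metric ths (chart ths ths) *m e^T.
  by apply: (@cvg_mulmx R _ (nbhs (0 : 'rV[R]_d))) => //; exact: (@cvg_trmx R _ (nbhs (0 : 'rV[R]_d))).
set g0 := metric ths (chart ths ths) in gc Kc *.
have E : g0 *m e^T *m 1%:M *m (g0 *m e^T)^T - g0 = 0.
  have e2 : e^T *m (e *m g0) = 1%:M by apply: mulmx1C; exact: e1.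
  have sg : g0^T = g0 by exact: (metric_pd (dom_self ths)).1.
  by rewrite mulmx1 trmx_mul trmxK sg -mulmxA [e^T *m _]e2 mulmx1 subrr.
rewrite -E; apply: (@cvgB _ _ _ (nbhs (0 : 'rV[R]_d))) => //.
apply: (@cvg_mulmx R _ (nbhs (0 : 'rV[R]_d))).
  by apply: (@cvg_mulmx R _ (nbhs (0 : 'rV[R]_d))) => //; exact: cvg_cst.
exact: (@cvg_trmx R _ (nbhs (0 : 'rV[R]_d))).
Qed.

Variables (lam b : R).
Hypothesis f2 : twice_differentiable f 0.
Hypothesis Hpd : positive_definite (hessian f 0).
Hypothesis lam0 : 0 < lam.
Hypothesis Hlam : smallest_eigenvalue (hessian f 0) lam.
Hypothesis b0 : 0 < b.
Hypothesis blam : b < 2 * lam.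

Let f0 : f 0 = 0. Proof. by rewrite /f /= nu0. Qed.

Let df0 i : 'D_(basis_vec i) f 0 = 0.
Proof.
have /rowP/(_ i) := nbhs_singleton gradient_pullback.
rewrite mxE => ->; rewrite /grad_comp nu0 gD0 /components !mul0mx mxE.
by [].
Qed.

Let Q y := qf (hessian f 0) y y.

Lemma hessian_lower y : lam * `|y| ^+ 2 <= Q y.
Proof.
apply: le_trans (rayleigh y Hpd.1 Hlam).
by rewrite ler_wpM2l ?(ltW lam0) // qf1_ge.
Qed.

Lemma near_lower : \forall y \near (0 : 'rV[R]_d), lam / 4 * `|y| ^+ 2 <= f y.
Proof.
have e0 : 0 < lam / 4 by rewrite divr_gt0.
apply: filterS (taylor_second_order f2 f0 df0 e0) => y /ler_normlP[H1 _].
have := hessian_lower y; rewrite /Q; move: H1; lra.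
Qed.

(** To leading order |grad D|^2 is |y H|^2 >= lam Q(y) and D is Q(y) / 2; the strict inequality
    between [b] and [2 * lam] absorbs the remainders. *)
Lemma near_drift : \forall y \near (0 : 'rV[R]_d),
  b * f y <= tnorm (nu y) (grad D (nu y)) ^+ 2.
Proof.
have [rho [m B]] := bounded_chart_exists r3 ths.
have rho0 := bc_rho B; have m1 := bc_m B.
have m0 : 0 <= m by lra.
pose N : R := (d * d)%:R.
pose H := hessian f 0.
pose C := 2 * (N * `|1%:M : 'M[R]_d| * (d%:R * `|H|)).
have N0 : 0 <= N by [].
have C0 : 0 <= C by rewrite /C !mulr_ge0.
(* [E] collects the coefficients of [eps] in the final comparison, relative to Q(y); [eps <= 1]
   turns the term in eps^2 into a linear one. *)
pose E := C / lam + b / lam + N * m * b * (2^-1 + 1 / lam).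
have E0 : 0 <= E.
  have il0 : 0 <= lam^-1 by rewrite invr_ge0 ltW.
  have i20 : 0 <= 2^-1 + 1 / lam by rewrite mul1r addr_ge0.
  by rewrite /E !addr_ge0 // !mulr_ge0 // ltW.
pose eps := Num.min 1 ((lam - b / 2) / (E + 1)).
have E1 : 0 < E + 1 by rewrite ltr_wpDl.
have lb : 0 < lam - b / 2 by move: blam; lra.
have eps0 : 0 < eps by rewrite /eps lt_min ltr01 divr_gt0.
have eps1 : eps <= 1 by rewrite /eps ge_min lexx.
have epsE : eps * E <= lam - b / 2.
  have : eps <= (lam - b / 2) / (E + 1) by rewrite /eps ge_min lexx orbT.
  rewrite ler_pdivlMr // mulrDr mulr1 => K; apply: le_trans K.
  by rewrite lerDl ltW.
have nball : \forall y \near (0 : 'rV[R]_d), chart_ball ths rho (nu y).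
  have [U [_ U0 _ cU _]] := nu_facts.
  by apply: cU => //; rewrite nu0; exact: chart_ball_near.
have nA : \forall y \near (0 : 'rV[R]_d),
   `|g y *m (jacobian F y)^T *m 1%:M *m (g y *m (jacobian F y)^T)^T - g y| <= eps.
  move/cvgrPdist_le : pullback_metric_cvg => /(_ _ eps0).
  by apply: filterS => y; rewrite sub0r normrN.
have n1 : \forall y \near (0 : 'rV[R]_d), `|w y - y *m H| <= eps * `|y|.
  exact: gradient_first_order.
have n2 : \forall y \near (0 : 'rV[R]_d), `|f y - 2^-1 * qf H y y| <= eps * `|y| ^+ 2.
  exact: taylor_second_order.
apply: filterS (filterI (filterI gradient_pullback nball)
  (filterI nA (filterI n1 n2))) => y.
move=> [[wE yb] [HA [Hw Hf]]].
rewrite tnorm_sqr (innerE _ _ yb.1) -/(g y) -/(grad_comp y).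
set a := grad_comp y in wE *; set A := _ *m _^T in HA.
set G := qf (g y) a a; set Y := `|y| ^+ 2 in Hf.
have Y0 : 0 <= Y by rewrite exprn_ge0.
have aG : `|a| ^+ 2 <= m * G by exact: (bc_lower B a yb.2).
have up : qf 1%:M (w y) (w y) <= (1 + N * m * eps) * G.
  have -> : qf 1%:M (w y) (w y) = qf A a a by rewrite wE -mulmxA qf_mul.
  have -> : qf A a a = G + qf (A - g y) a a by rewrite qf_subm /G addrC subrK.
  rewrite mulrDl mul1r lerD2l (le_trans (ler_norm _)) // (le_trans (norm_qf _ _ _)) //.
  have K : `|A - g y| * (`|a| * `|a|) <= eps * (m * G).
    by rewrite -expr2 ler_pM // exprn_ge0.
  have -> : N * m * eps * G = N * (eps * (m * G)) by ring.
  by rewrite -!mulrA ler_wpM2l.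
have lo : lam * Q y - C * eps * Y <= qf 1%:M (w y) (w y).
  have -> : w y = y *m H + (w y - y *m H) by rewrite addrC subrK.
  set dl := w y - y *m H in Hw *.
  rewrite (qf_sqrD _ _ (trmx1 _ _)).
  have K1 := rayleigh_sq y Hpd.1 (ltW lam0) Hlam.
  have K2 := qf_pd_ge0 dl (pd1 d).
  have K3 : `|qf 1%:M (y *m H) dl| <= C / 2 * eps * Y.
    apply: (le_trans (norm_qf _ _ _)).
    apply: (@le_trans _ _ (N * `|1%:M : 'M[R]_d| * (d%:R * `|H| * `|y|) * (eps * `|y|))).
      by rewrite ler_pM ?mulr_ge0 // ler_pM ?mulr_ge0 // norm_mulmx.
    by rewrite /C /Y le_eqVlt; apply/orP; left; apply/eqP; field.
  have /ler_normlP[K4 _] := K3.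
  rewrite /Q -/H in K1 *; lra.
have QY := hessian_lower y; rewrite -/Y in QY.
have fle : f y <= 2^-1 * Q y + eps * Y.
  by have /ler_normlP[_] := Hf; rewrite /Q -/H; lra.
have Yle : Y <= Q y / lam by rewrite ler_pdivlMr // mulrC.
have Q0 : 0 <= Q y by apply: le_trans QY; rewrite mulr_ge0 // ltW.
have main : (1 + N * m * eps) * (b * f y) <= (1 + N * m * eps) * G.
  apply: le_trans up; apply: le_trans lo.
  have k0 : 0 <= N * m * eps by rewrite !mulr_ge0 // ltW.
  apply: (@le_trans _ _ ((1 + N * m * eps) * (b * ((2^-1 + eps / lam) * Q y)))).
    rewrite ler_wpM2l ?addr_ge0 // ler_wpM2l ?(ltW b0) //.
    apply: (le_trans fle); rewrite mulrDl lerD2l -mulrA ler_wpM2l ?(ltW eps0) //.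
    by rewrite mulrC.
  apply: (@le_trans _ _ (lam * Q y - C * eps * (Q y / lam))); last first.
    by rewrite lerD2l lerN2 ler_wpM2l // mulr_ge0 // ltW.
  have -> : lam * Q y - C * eps * (Q y / lam) = (lam - C * eps / lam) * Q y by ring.
  rewrite !mulrA ler_wpM2r //.
  have e2 : N * m * eps * b * (eps / lam) <= N * m * eps * b * (1 / lam).
    by rewrite ler_wpM2l ?mulr_ge0 ?(ltW b0) ?(ltW eps0) // ler_wpM2r ?invr_ge0 // ltW.
  move: epsE e2; rewrite /E.
  set il := lam^-1.
  rewrite !mul1r; nra.
by move: main; rewrite ler_pM2l // ltr_wpDr // !mulr_ge0 // ltW.
Qed.

Lemma S_near_lower : \forall p \near ths, S p -> lam / 4 * `|kappa p| ^+ 2 <= D p.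
Proof.
have [_ [kc _]] := S_normal_domain Sths; rewrite /prop_for /continuous_at kappa_ths in kc.
apply: filterS (near_comp kc near_lower) => p H Sp; apply: (le_trans H).
by rewrite /f /= (S_normal_domain Sp).1.
Qed.

Lemma S_near_drift : \forall p \near ths, S p -> b * D p <= tnorm p (grad D p) ^+ 2.
Proof.
have [_ [kc _]] := S_normal_domain Sths; rewrite /prop_for /continuous_at kappa_ths in kc.
apply: filterS (near_comp kc near_drift) => p H Sp; move: H.
by rewrite /= /f /= (S_normal_domain Sp).1.
Qed.

End NormalCoordinates.

(** * Uniform constants on compact sets *)

Section Covering.
Context {R : realType} {T : topologicalType}.

(** Finitely many neighbourhoods cover [S], and by monotonicity the largest local constant serves
    them all. *)
Lemma compact_uniform (S : set T) (P : R -> T -> Prop) : compact S ->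
  (forall K K' y, K <= K' -> P K y -> P K' y) ->
  (forall x, S x -> exists K, \forall y \near x, S y -> P K y) ->
  exists K, forall y, S y -> P K y.
Proof.
move=> /compact_near_coveringP cS mono H.
have := cS R (pinfty_nbhs R) (fun K y => S y -> P K y) _; case.
  move=> x Sx; have [K HK] := H x Sx.
  exists ((fun y => S y -> P K y), [set K' | K <= K']).
    by split=> //=; apply: nbhs_pinfty_ge; exact: num_real.
  by move=> [y K'] [/= Hy KK'] Sy; apply: mono KK' (Hy Sy).
move=> K [_ HK]; exists (K + 1) => y Sy; apply: HK => //.
by rewrite ltrDl.
Qed.

End Covering.

(** * Estimates uniform on the stable set *)

Section Global.
Context {R : realType} {r d : nat} {M : riemannian_manifold R r d}.
Context (r3 : (3 < r)%N).
Variables (D : M -> R) (S : set M) (ths : M).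
Hypothesis Dd : forall p, differentiable_at D p.
Hypothesis D_ge0 : forall p, 0 <= D p.
Hypothesis Sc : geodesically_convex S.
Hypothesis Scomp : compact S.
Hypothesis DL : lipschitz_field S (grad D).
Variable b : R.
Hypothesis Db : forall p, S p -> tnorm p (grad D p) <= b.

(** Moving along [v] by a small multiple of - 'd g x v would lower [g] by more than the remainder
    can restore. *)
Lemma min_diff0 (V : normedModType R) (g : V -> R) (x v : V) :
  differentiable g x -> (forall y, g x <= g y) -> 'd g x v = 0.
Proof.
move=> dg gmin; apply/eqP/negPn/negP => l0; set l := 'd g x v in l0.
have nl : 0 < `|l| by rewrite normr_gt0.
have e0 : 0 < `|l| / (2 * (`|v| + 1)) by rewrite divr_gt0 // mulr_gt0 // ltr_wpDl.
have [rr /= rr0 Hr] := (@nbhs_ballP _ _ _ _).1 (differentiable_expansion dg e0).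
pose c := `|l| * `|v| + 1; have c0 : 0 < c by rewrite ltr_wpDl // mulr_ge0.
pose dl := rr / 2 / c; have dl0 : 0 < dl by rewrite !divr_gt0.
have nh : `|- (dl * l) *: v| = dl * (`|l| * `|v|).
  by rewrite normrZ normrN normrM (gtr0_norm dl0) mulrA.
have hb : ball (0 : V) rr (- (dl * l) *: v).
  rewrite -ball_normE /= sub0r normrN nh.
  apply: (@le_lt_trans _ _ (dl * c)); first by rewrite ler_wpM2l ?(ltW dl0) // lerDl.
  by rewrite divfK ?gt_eqF // ltr_pdivrMr // ltr_pMr // ltr1n.
have E : 'd g x (- (dl * l) *: v) = - (dl * l * l).
  by rewrite linearZ /= /GRing.scale /= mulNr.
have := Hr _ hb; rewrite nh E => H.
have H2 : dl * `|l| ^+ 2 <= `|l| / (2 * (`|v| + 1)) * (dl * (`|l| * `|v|)).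
  apply: le_trans H; apply: le_trans (ler_norm _).
  rewrite opprK real_normK ?num_real // expr2 mulrA lerDr subr_ge0.
  exact: gmin.
have : dl * `|l| ^+ 2 <= dl * `|l| ^+ 2 / 2.
  apply: (le_trans H2).
  have -> : `|l| / (2 * (`|v| + 1)) * (dl * (`|l| * `|v|)) =
     dl * `|l| ^+ 2 / 2 * (`|v| / (`|v| + 1)).
    by field; rewrite gt_eqF // ltr_wpDl.
  rewrite ler_piMr //; first by rewrite !mulr_ge0 ?invr_ge0 ?exprn_ge0 // ltW.
  by rewrite ler_pdivrMr ?ltr_wpDl // mul1r lerDl.
have : 0 < dl * `|l| ^+ 2 by rewrite mulr_gt0 // exprn_gt0.
lra.
Qed.

Lemma inner_cs (p : M) v w : `|inner p v w| <= tnorm p v * tnorm p w.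
Proof.
rewrite -(@ler_sqr _ `|_|) ?nnegrE ?mulr_ge0 ?tnorm_ge0 // exprMn !tnorm_sqr.
rewrite real_normK ?num_real //.
exact/qf_cs/metric_pd/dom_self.
Qed.

Lemma lipschitz_nonneg : exists2 L : R, 0 <= L &
  forall p q c, S p -> S q -> minimizing_geodesic p q c ->
    exists w, is_transport c (grad D p) w /\
      ((tnorm q (w - grad D q))%:E <= L%:E * dist p q)%E.
Proof.
have [L HL] := DL; exists `|L| => // p q c Sp Sq mc.
have [w [tw Hw]] := HL p q c Sp Sq mc; exists w; split=> //.
apply: (le_trans Hw); apply: lee_wpmul2r; first exact: dist_ge0.
by rewrite lee_fin ler_norm.
Qed.

(** Continuity of grad D comes from its Lipschitz property, which is available between points of
    [S]; hence the limit within [S]. *)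
Lemma grad_components_cvg o : S o ->
  components o q (grad D q) @[q --> within S (nbhs o)] --> components o o (grad D o).
Proof.
move=> So; have [L L0 HL] := lipschitz_nonneg.
have [rho [m B]] := bounded_chart_exists r3 o.
have rho0 := bc_rho B; have m1 := bc_m B; have m0 : 0 < m by lra.
have b0 : 0 <= b := le_trans (tnorm_ge0 _ _) (Db So).
pose C := m ^+ 3 * b + m * L.
have C0 : 0 <= C by rewrite addr_ge0 // !mulr_ge0 ?exprn_ge0 // ltW.
apply/cvgrPdist_le => e e0.
(* The first bound makes the geodesic short enough for the chart; the second makes the Lipschitz
   estimate at most [e]. *)
pose s := Num.min (rho / 4 / m / m) (e / (C + 1) / m).
have s0 : 0 < s by rewrite lt_min !divr_gt0 // ltr_wpDl.
rewrite near_withinE.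
apply: filterS (filterI (chart_ball_near o rho0)
  (near_cont_norm (chart_cont (dom_self o)) s0)) => q [qb qs] Sq.
have dq := dist_chart_le r3 B qb; rewrite distrC in qs.
set l := m * `|chart o q - chart o o| in dq.
have l0 : 0 <= l by rewrite mulr_ge0 // ltW.
have ls : l <= m * s by rewrite /l ler_wpM2l // ltW.
have oo : chart_ball o (rho / 2) o.
  by split; [exact: dom_self|rewrite subrr normr0 divr_ge0 // ltW].
have s1 : s <= rho / 4 / m / m by rewrite ge_min lexx.
have s2 : s <= e / (C + 1) / m by rewrite ge_min lexx orbT.
have ml : m * l < rho / 2.
  apply: (@le_lt_trans _ _ (rho / 4)); last by lra.
  rewrite ler_pdivlMr // ler_pdivlMr // in s1.
  by apply: le_trans s1; rewrite mulrC ler_wpM2r ?(ltW m0) // (le_trans ls) // mulrC.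
have [_ H] := grad_chart_lipschitz r3 Sc L0 HL Db B So Sq oo dq ml.
rewrite distrC (le_trans H) // -/C.
have C1 : 0 < C + 1 by rewrite ltr_wpDl.
rewrite ler_pdivlMr // ler_pdivlMr // in s2.
apply: (@le_trans _ _ (C * (m * s))); first by rewrite ler_wpM2l.
have : 0 <= m * s by rewrite mulr_ge0 // ltW.
by move: s2; nra.
Qed.

Lemma inner_cvg o (Y Z : M -> 'rV[R]_d) : S o ->
  components o q (Y q) @[q --> within S (nbhs o)] --> components o o (Y o) ->
  components o q (Z q) @[q --> within S (nbhs o)] --> components o o (Z o) ->
  inner q (Y q) (Z q) @[q --> within S (nbhs o)] --> inner o (Y o) (Z o).
Proof.
move=> So cY cZ; rewrite (innerE _ _ (dom_self o)).
have cg : metric o (chart o q) @[q --> within S (nbhs o)] --> metric o (chart o o).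
  apply: cvg_trans (_ : metric o (chart o q) @[q --> o] --> _).
    by apply: cvg_app; exact: cvg_within.
  exact: continuous_comp (chart_cont (dom_self o)) (metric_cont (dom_self o)).
apply: cvg_trans (cvg_qf _ cg cY cZ); apply: near_eq_cvg.
by apply: cvg_within; apply: filterS (near_dom (dom_self o)) => q oq; rewrite -innerE.
Qed.

Lemma field_components_cvg o (Y : M -> 'rV[R]_d) : continuous_field Y ->
  components o q (Y q) @[q --> within S (nbhs o)] --> components o o (Y o).
Proof.
move=> cY; have K : components o q (Y q) @[q --> o] --> components o o (Y o).
  exact: (cY o o (dom_self o)).
by apply: cvg_trans K; apply: cvg_app; exact: cvg_within.
Qed.

Lemma D_bounded : exists K, forall p, S p -> D p <= K.
Proof.
apply: compact_uniform => // [K K' y KK' H|x Sx]; first exact: le_trans KK'.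
exists (D x + 1); apply: filterS (near_cont_norm (D_continuous Dd (x := x)) ltr01).
by move=> y /ler_normlP[H _] _; move: H; lra.
Qed.

Lemma gradient_expansion_uniform : exists2 C : R, 0 <= C &
  forall p q v, S p -> S q -> is_Exp p v q ->
  `|D q - D p - inner p (grad D p) v| <= C * tnorm p v ^+ 2.
Proof.
have [L L0 HL] := lipschitz_nonneg.
(* [K] serves both as the constant and as the inverse of the admissible step length, so that the
   property is monotone in [K]. *)
pose P (K : R) p := forall q v, S q -> is_Exp p v q -> K * tnorm p v <= 1 ->
  `|D q - D p - inner p (grad D p) v| <= K * tnorm p v ^+ 2.
have [K1 HK1] : exists K, forall p, S p -> P K p.
  apply: compact_uniform => // [K K' p KK' H q v Sq E Kt|o So].
    have t0 := tnorm_ge0 p v.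
    apply: (le_trans (H q v Sq E _)); first exact: le_trans (ler_wpM2r _ KK') Kt.
    by rewrite ler_wpM2r // exprn_ge0.
  have [rho [m B]] := bounded_chart_exists r3 o.
  have rho0 := bc_rho B; have m1 := bc_m B; have m0 : 0 < m by lra.
  have r20 : 0 < rho / 2 by rewrite divr_gt0.
  exists (Num.max (m / (rho / 2) + 1) (expansion_cst (d := d) L b m)).
  set K := Num.max _ _.
  apply: filterS (chart_ball_near o r20) => p pb Sp q v Sq E Kt.
  have t0 := tnorm_ge0 p v.
  have K1 : m / (rho / 2) + 1 <= K by rewrite le_max lexx.
  have K2 : expansion_cst (d := d) L b m <= K by rewrite le_max lexx orbT.
  have mt : m * tnorm p v < rho / 2.
    have K3 : m + rho / 2 <= K * (rho / 2).
      by rewrite -ler_pdivrMr // mulrDl divff ?gt_eqF.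
    have : K * (rho / 2) * tnorm p v <= rho / 2.
      by rewrite mulrAC ler_piMl // ltW.
    have : (m + rho / 2) * tnorm p v <= K * (rho / 2) * tnorm p v.
      by rewrite ler_wpM2r.
    move=> H1 H2; have [t00|tn] := eqVneq (tnorm p v) 0; first by rewrite t00 mulr0.
    have tp : 0 < rho / 2 * tnorm p v by rewrite mulr_gt0 // lt_neqAle eq_sym tn.
    move: tp H1; rewrite mulrDl; lra.
  apply: (le_trans (gradient_expansion r3 Dd Sc L0 HL Db B Sp Sq pb E mt)).
  by rewrite ler_wpM2r // exprn_ge0.
have [Dm HD] := D_bounded.
have [[p0 Sp0]|/set0P/negP/negPn/eqP S0] := pselect (S !=set0); last first.
  by exists 0 => // p q v; rewrite S0.
have b0 : 0 <= b := le_trans (tnorm_ge0 _ _) (Db Sp0).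
have Dm0 : 0 <= Dm := le_trans (D_ge0 p0) (HD _ Sp0).
pose K := Num.max 1 K1.
have K0 : 1 <= K by rewrite le_max lexx.
have K1K : K1 <= K by rewrite le_max lexx orbT.
exists (K + Dm * K ^+ 2 + b * K).
  by rewrite !addr_ge0 ?mulr_ge0 ?exprn_ge0 //; lra.
move=> p q v Sp Sq E; have t0 := tnorm_ge0 p v; set t := tnorm p v in t0 *.
have [Kt|Kt] := leP (K * t) 1.
  apply: (@le_trans _ _ (K1 * t ^+ 2)).
    by apply: HK1 => //; apply: le_trans Kt; rewrite ler_wpM2r.
  rewrite ler_wpM2r ?exprn_ge0 // -addrA (le_trans K1K) // lerDl.
  by rewrite addr_ge0 // mulr_ge0 ?exprn_ge0 //; lra.
have I := inner_cs p (grad D p) v; rewrite -/t in I.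
have I2 : `|inner p (grad D p) v| <= b * t by rewrite (le_trans I) // ler_wpM2r // Db.
have DD : `|D q - D p| <= Dm.
  have := D_ge0 p; have := D_ge0 q; have := HD _ Sp; have := HD _ Sq.
  by move=> *; apply/ler_normlP; split; lra.
apply: (le_trans (ler_normB _ _)); apply: (le_trans (lerD DD I2)).
(* For a long step both the bounded variation of D and the linear term are dominated by t^2. *)
have Kt2 : 1 <= K ^+ 2 * t ^+ 2 by rewrite -exprMn; apply: exprn_ege1; exact: ltW.
have A1 : Dm <= Dm * K ^+ 2 * t ^+ 2 by rewrite -mulrA ler_peMr.
have A2 : b * t <= b * K * t ^+ 2.
  by rewrite -mulrA ler_wpM2l // expr2 mulrA ler_peMl // ltW.
have A3 : 0 <= K * t ^+ 2 by rewrite mulr_ge0 ?exprn_ge0 //; lra.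
by rewrite !mulrDl; lra.
Qed.

Variables (e : 'M[R]_d) (kappa : M -> 'rV[R]_d) (nu : 'rV[R]_d -> M).
Hypothesis Hn : normal_coordinates S ths e kappa nu.
Hypothesis Sths : S ths.
Hypothesis D0 : D ths = 0.
Hypothesis stationary : forall p, S p -> (grad D p = 0 <-> p = ths).
Variables (lam beta : R).
Hypothesis f2 : twice_differentiable (D \o nu) 0.
Hypothesis Hpd : positive_definite (hessian (D \o nu) 0).
Hypothesis lam0 : 0 < lam.
Hypothesis Hlam : smallest_eigenvalue (hessian (D \o nu) 0) lam.
Hypothesis beta0 : 0 < beta.
Hypothesis blam : beta < 2 * lam.

Let gD0 : grad D ths = 0. Proof. exact/stationary. Qed.

(** A zero of D is a minimum, hence a stationary point, hence [ths]. *)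
Lemma D_pos p : S p -> p <> ths -> 0 < D p.
Proof.
move=> Sp pths; rewrite lt_neqAle D_ge0 andbT; apply/eqP => /esym Dp0; apply: pths.
apply/(stationary Sp); rewrite /grad (_ : \row_i _ = 0) ?mul0mx //.
apply/rowP => i; rewrite !mxE deriveE; last exact: Dd.
apply: min_diff0 => [|y]; first exact: Dd.
by rewrite /= chartK ?Dp0 //; exact: dom_self.
Qed.

Lemma dist_sqr_le : exists2 K : R, 0 < K & forall p, S p ->
  (dist p ths ^+ 2 <= (K * D p)%:E)%E.
Proof.
pose N : R := (d * d)%:R * `|1%:M : 'M[R]_d|.
have N0 : 0 <= N by rewrite mulr_ge0.
have qN (y : 'rV[R]_d) : qf 1%:M y y <= N * `|y| ^+ 2.
  by rewrite (le_trans (ler_norm _)) // (le_trans (norm_qf _ _ _)) // -mulrA -expr2.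
have [K HK] : exists K, forall p, S p -> qf 1%:M (kappa p) (kappa p) <= K * D p.
  apply: (compact_uniform (P := fun K p => qf 1%:M (kappa p) (kappa p) <= K * D p)) => //.
    by move=> K K' p KK' /le_trans; apply; rewrite ler_wpM2r.
  move=> x Sx; have [->|/eqP xths] := eqVneq x ths.
    exists (N * (4 / lam)).
    apply: filterS (S_near_lower r3 Dd Hn Sths D0 gD0 f2 Hpd lam0 Hlam) => p H Sp.
    apply: (le_trans (qN _)); rewrite -mulrA ler_wpM2l //.
    by rewrite mulrC -ler_pdivrMr ?divr_gt0 // invf_div mulrC H.
  have Dx := D_pos Sx xths.
  have [_ [kc _]] := S_normal_domain Hn Sx.
  have Dx2 : 0 < D x / 2 by rewrite divr_gt0.
  exists (N * (`|kappa x| + 1) ^+ 2 / (D x / 2)).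
  apply: filterS (filterI (near_cont_norm kc ltr01)
    (near_cont_norm (@D_continuous _ _ _ _ D Dd x) Dx2)) => p [H1 /ler_normlP[_ H2]] Sp.
  apply: (@le_trans _ _ (N * (`|kappa x| + 1) ^+ 2)).
    apply: (le_trans (qN _)); rewrite ler_wpM2l // lerXn2r ?nnegrE ?addr_ge0 //.
    have := ler_normD (kappa x) (kappa p - kappa x); rewrite addrC subrK => /le_trans; apply.
    by rewrite lerD2l distrC.
  rewrite -mulrA ler_peMr ?mulr_ge0 ?exprn_ge0 ?addr_ge0 //.
  by rewrite mulrC ler_pdivlMr // mul1r; lra.
exists (Num.max 1 K); first by rewrite lt_max ltr01.
move=> p Sp; have [s ds [s0 sE]] := dist_normal r3 Hn Sp.
apply: (@le_trans _ _ (s ^+ 2)%:E).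
  by rewrite expe2 expr2 EFinM; apply: lee_pmul => //; exact: dist_ge0.
rewrite lee_fin sE (le_trans (HK p Sp)) // ler_wpM2r //.
by rewrite le_max lexx orbT.
Qed.

Lemma drift : exists2 K : R, 0 < K & forall p, S p ->
  beta * D p <= (1 + K * D p) * tnorm p (grad D p) ^+ 2.
Proof.
have [K HK] : exists K, forall p, S p ->
    beta * D p <= (1 + K * D p) * tnorm p (grad D p) ^+ 2.
  apply: (compact_uniform (P := fun K p =>
    beta * D p <= (1 + K * D p) * tnorm p (grad D p) ^+ 2)) => //.
    move=> K K' p KK' /le_trans; apply; rewrite ler_wpM2r ?exprn_ge0 ?tnorm_ge0 //.
    by rewrite lerD2l ler_wpM2r.
  move=> x Sx; have [->|/eqP xths] := eqVneq x ths.
    exists 0.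
    apply: filterS (S_near_drift r3 Dd Hn Sths D0 gD0 f2 Hpd lam0 Hlam beta0 blam) => p H Sp.
    by rewrite mul0r addr0 mul1r H.
  have Gx : 0 < inner x (grad D x) (grad D x).
    apply: (metric_pd (dom_self x)).2; apply/eqP => /(stationary Sx).
    exact: xths.
  have Gx2 : 0 < inner x (grad D x) (grad D x) / 2 by rewrite divr_gt0.
  have Gc := inner_cvg Sx (grad_components_cvg Sx) (grad_components_cvg Sx).
  move/cvgrPdist_le : Gc => /(_ _ Gx2); rewrite near_withinE => Gc.
  (* Near [x] the squared gradient stays above half its value, so for this [K] the term
     [K * D p * tnorm p (grad D p) ^+ 2] alone reaches [beta * D p]. *)
  exists (beta / (inner x (grad D x) (grad D x) / 2)).
  apply: filterS Gc => p H Sp; have /ler_normlP[_ {}H] := H Sp.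
  rewrite tnorm_sqr mulrDl mul1r.
  apply: ler_wpDl; first exact: inner_ge0.
  set g := inner x _ _ in H Gx2 *.
  have -> : beta / (g / 2) * D p * inner p (grad D p) (grad D p) =
    (beta * D p) * (inner p (grad D p) (grad D p) / (g / 2)).
    by rewrite -!mulrA; congr (_ * _); rewrite mulrCA; congr (_ * _); rewrite mulrC.
  rewrite ler_peMr ?mulr_ge0 ?(ltW beta0) //.
  by rewrite ler_pdivlMr // mul1r; lra.
exists (Num.max 1 K); first by rewrite lt_max ltr01.
move=> p Sp; apply: (le_trans (HK p Sp)).
rewrite ler_wpM2r ?exprn_ge0 ?tnorm_ge0 // lerD2l ler_wpM2r //.
by rewrite le_max lexx orbT.
Qed.

End Global.

(** * Integration against a restricted measure *)

Section Restriction.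
Context {R : realType} {dO : measure_display} {Omega : measurableType dO}.
Import HBNNSimple.

Lemma ge0_integral_mrestr (mu : {measure set Omega -> \bar R}) (E : set Omega)
    (mE : measurable E) (f : Omega -> \bar R) :
  measurable_fun [set: _] f -> (forall w, (0 <= f w)%E) ->
  (\int[mrestr mu mE]_w f w = \int[mu]_(w in E) f w)%E.
Proof.
move=> mf f0; pose f_ := nnsfun_approx measurableT mf.
have H (m : {measure set Omega -> \bar R}) (B : set Omega) : measurable B ->
    (\int[m]_(w in B) f w = limn (fun n => \int[m]_(w in B) (f_ n w)%:E))%E.
  move=> mB; rewrite -monotone_convergence//=.
  - apply: eq_integral => x _; apply/esym/cvg_lim => //=.
    exact: (cvg_nnsfun_approx measurableT mf).
  - by move=> n; apply: measurableT_comp => //; exact: measurable_funTS.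
  - by move=> n x _; rewrite lee_fin.
  - by move=> x _ m' n mn; rewrite lee_fin//; exact/lefP/nd_nnsfun_approx.
rewrite !H //; congr (limn _); apply/funext => n.
rewrite !integral_nnsfun // !sintegralET; apply: eq_fsbigr => y _.
(* The value 0 is set apart: cut off to [E], the function also takes it outside [E]. *)
have [->|y0] := eqVneq y 0; first by rewrite !mul0e.
congr (_ * _)%E; rewrite patch_setT /= /mrestr; congr (mu _).
apply/seteqP; split=> w /=.
  by move=> [fy Ew]; rewrite patchE mem_set.
rewrite patchE; case: ifP => [/set_mem Ew -> //|_ /esym /eqP].
by rewrite (negPf y0).
Qed.

End Restriction.

(** * Independence of the past and the next observation *)

Section Independence.
Context {R : realType} {dX dO : measure_display} {X : measurableType dX}
  {Omega : measurableType dO}.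
Variables (Pr : probability Omega R) (Q : probability X R).
Variable x : nat -> Omega -> X.
Hypothesis xiid : iid Pr Q (fun n => x n.+1).

Definition past n : set (set Omega) :=
  <<s \bigcup_(k in [set k | (0 < k <= n)%N]) [set x k @^-1` B | B in measurable] >>.

Lemma measurable_obs n B : (0 < n)%N -> measurable B -> measurable (x n @^-1` B).
Proof.
case: n => // n _ mB; have [mx _ _] := xiid.
by rewrite -[_ @^-1` _]setTI; apply: mx.
Qed.

Lemma past_measurable n A : past n A -> measurable A.
Proof.
apply: smallest_sub; first exact: sigma_algebra_measurable.
move=> _ [k /= /andP[k0 _] [B mB <-]]; exact: measurable_obs.
Qed.

(** A pi-system generating [past n], on which the assumed independence can be used directly. *)
Definition cylinder n : set (set Omega) :=
  [set A | exists2 B : nat -> set X, forall i, measurable (B i) &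
    A = \bigcap_(i in [set` iota 0 n]) (x i.+1 @^-1` B i)].

Lemma cylinder_setI n : setI_closed (cylinder n).
Proof.
move=> _ _ [B mB ->] [C mC ->]; exists (fun i => B i `&` C i).
  by move=> i; exact: measurableI.
by rewrite -bigcapI.
Qed.

Lemma past_cylinder n : past n `<=` <<s cylinder n >>.
Proof.
apply: smallest_sub; first exact: smallest_sigma_algebra.
move=> _ [k /= /andP[k0 kn] [B mB <-]]; apply: sub_gen_smallest.
exists (fun i => if i == k.-1 then B else setT).
  by move=> i; case: ifP.
apply/seteqP; split=> w /=.
  by move=> Bw i _ /=; case: eqP => // ->; rewrite prednK.
move=> /(_ k.-1); rewrite /= mem_iota /= eqxx prednK //; apply.
by rewrite add0n.
Qed.

Lemma cylinder_measurable n A : cylinder n A -> measurable A.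
Proof.
move=> [B mB ->]; apply: fin_bigcap_measurable => // i _.
exact: measurable_obs.
Qed.

Lemma probability_fin (A : set Omega) : measurable A -> Pr A = (fine (Pr A))%:E.
Proof. by move=> mA; rewrite fineK // fin_num_measure. Qed.

(** The events independent of the next observation form a lambda-system, which contains the
    cylinders. *)
Lemma past_independent n A B : past n A -> measurable B ->
  Pr (A `&` x n.+1 @^-1` B) = (Pr A * Q B)%E.
Proof.
move=> nA mB; have [mx xQ xI] := xiid.
have mxB : measurable (x n.+1 @^-1` B) by exact: measurable_obs.
suff H : <<s cylinder n >> `<=`
    [set A | measurable A /\ Pr (A `&` x n.+1 @^-1` B) = (Pr A * Q B)%E].
  by have [] := H A (past_cylinder nA).
apply: lambda_system_subset; [exact: cylinder_setI| | |by []].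
- apply/dynkin_lambda_system; split.
  + by split=> //; rewrite setTI probability_setT mul1e xQ.
  + move=> C [mC HC]; split; first exact: measurableC.
    rewrite setIC -setDE measureD //; last by rewrite ltey_eq fin_num_measure.
    have E : Pr (x n.+1 @^-1` B `&` C) = (Pr C * Q B)%E by rewrite setIC.
    transitivity (Q B - Pr C * Q B)%E; first by congr (_ - _)%E => //; exact: xQ.
    rewrite probability_setC // -(xQ n) //.
    rewrite (probability_fin mxB) (probability_fin mC).
    by rewrite -EFinM -!EFinD -EFinM mulrBl mul1r.
  + move=> F tF HF; split; first by apply: bigcupT_measurable => k; have [] := HF k.
    rewrite setI_bigcupl measure_bigcup //; last 2 first.
      by move=> k _; apply: measurableI => //; have [] := HF k.
      by under eq_fun do rewrite setIC; exact: trivIset_setIl.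
    rewrite measure_bigcup //; last by move=> k _; have [] := HF k.
    rewrite -(xQ n) // (probability_fin mxB) muleC -nneseriesZl //.
    by apply: eq_eseriesr => k _; have [_ Hk] := HF k; apply: (eq_trans Hk); rewrite -(xQ n) // muleC -probability_fin.
- move=> C cC; split; first exact: cylinder_measurable cC.
  have [D mD ->] := cC.
  (* The intersection with the next observation is a cylinder of length [n.+1]; its product formula
     is that of length [n] times one factor. *)
  pose D' i := if i == n then B else D i.
  have mD' i : measurable (D' i) by rewrite /D'; case: ifP.
  have H1 := xI (iota 0 n) D (iota_uniq _ _) mD.
  have := xI (iota 0 n.+1) D' (iota_uniq _ _) mD'.
  have -> : \bigcap_(i in [set` iota 0 n.+1]) (x i.+1 @^-1` D' i) =
     \bigcap_(i in [set` iota 0 n]) (x i.+1 @^-1` D i) `&` x n.+1 @^-1` B.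
    have iotaE m : [set` iota 0 m] = [set i | (i < m)%N].
      by apply/seteqP; split=> i; rewrite /mkset mem_iota add0n.
    rewrite !iotaE; apply/seteqP; split=> w.
      move=> Hw; split; last by have := Hw n (ltnSn n); rewrite /D' eqxx.
      by move=> i /= ii; have := Hw i (ltnW ii); rewrite /D' (ltn_eqF ii).
    move=> [Hw Bw] i /=; rewrite ltnS leq_eqVlt /D'.
    by case: eqP => [-> //|_ /= ii]; exact: Hw.
  rewrite -[n.+1]addn1 iotaD big_cat /= big_seq1 add0n /D' eqxx.
  under eq_big_seq => i.
    rewrite mem_iota /= add0n => ii; rewrite (ltn_eqF ii); over.
  rewrite !addn1 => E; have mC1 : measurable (\bigcap_(i in [set` iota 0 n]) (x i.+1 @^-1` D i) `&` x n.+1 @^-1` B).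
    by apply: measurableI => //; apply: cylinder_measurable; exists D.
  rewrite (probability_fin mC1) E -H1 EFinM -!probability_fin ?xQ //.
  by apply: cylinder_measurable; exists D.
Qed.

(** Under [Pr] restricted to [E], the next observation has law [Pr E] times [Q]. *)
Lemma past_integral n E (f : X -> \bar R) : past n E ->
  measurable_fun [set: _] f -> (forall y, (0 <= f y)%E) ->
  (\int[Pr]_(w in E) f (x n.+1 w) = Pr E * \int[Q]_y f y)%E.
Proof.
move=> nE mf f0; have mE := past_measurable nE; have [mx xQ xI] := xiid.
have k0 : 0 <= fine (Pr E) by exact: fine_ge0.
rewrite -(@ge0_integral_mrestr _ _ _ _ _ mE (f \o x n.+1)) //; last 2 first.
- exact: measurableT_comp.
- by move=> w; exact: f0.
rewrite -(@ge0_integral_pushforward _ _ _ _ _ _ (mx n) _ setT) //.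
rewrite (probability_fin mE) -(@ge0_integral_mscale _ _ R Q setT measurableT (NngNum k0) f) //.
apply: eq_measure_integral => A mA _ /=; rewrite /pushforward /mrestr /mscale /=.
by rewrite setIC past_independent // -probability_fin.
Qed.

End Independence.

(** * A countable base indexed by integers *)

Section CountableBase.
Context {T : topologicalType}.

Lemma second_countable_base : @second_countable T -> exists U : nat -> set T,
  (forall i, open (U i)) /\ forall p (N : set T), nbhs p N -> exists i, U i p /\ U i `<=` N.
Proof.
move=> [B /countable_injP[f finj] [Bo Bb]].
(* An integer that codes no base set yields the empty set, which is open too. *)
exists (fun i => [set p | exists V, [/\ B V, f V = i & V p]]); split.
  move=> i; rewrite (_ : [set _ | _] = \bigcup_(V in [set V | B V /\ f V = i]) V).
    by apply: bigcup_open => V [BV _]; exact: Bo.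
  by apply/seteqP; split=> [p [V [BV fV Vp]]|p [V [BV fV] Vp]]; exists V.
move=> p N pN; have [V [BV Vp] VN] := Bb p N pN.
exists (f V); split; first by exists V.
move=> q [V' [BV' ff V'q]]; apply: VN.
by rewrite -(finj V' V) ?inE.
Qed.

End CountableBase.

(** * Expectation of one step given the past *)

Section ConditionalStep.
Context {R : realType} {dX dO : measure_display} {X : measurableType dX}
  {Omega : measurableType dO} {M : topologicalType}.
Variables (Pr : probability Omega R) (Q : probability X R).
Variable x : nat -> Omega -> X.
Hypothesis xiid : iid Pr Q (fun n => x n.+1).
Variables (n : nat) (T : Omega -> M) (S : set M).
Hypothesis Tn : statistic x n T.
Hypothesis Sc : closed S.

Let past_sigma : sigma_algebra setT (past x n).
Proof. exact: smallest_sigma_algebra. Qed.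

Lemma past_setC A : past x n A -> past x n (~` A).
Proof. by move=> nA; rewrite -setTD; case: past_sigma => _ + _; apply. Qed.

Lemma past_setT : past x n setT.
Proof. by rewrite -setC0; apply: past_setC; case: past_sigma. Qed.

Lemma past_bigcap (A : nat -> set Omega) :
  (forall i, past x n (A i)) -> past x n (\bigcap_i A i).
Proof.
move=> nA; rewrite -[\bigcap_i _]setCK setC_bigcap; apply: past_setC.
by case: past_sigma => _ _; apply => i; exact: past_setC.
Qed.

Lemma past_setI A B : past x n A -> past x n B -> past x n (A `&` B).
Proof.
move=> nA nB; rewrite -bigcap2E; apply: past_bigcap => -[|[|i]] //=.
exact: past_setT.
Qed.

Lemma past_stable : past x n (T @^-1` S).
Proof.
rewrite -[_ @^-1` _]setCK; apply: past_setC; rewrite preimage_setC.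
by apply: Tn; exact: closed_openC.
Qed.

Variable U : nat -> set M.
Hypothesis Uo : forall i, open (U i).
Hypothesis Ub : forall p (N : set M), nbhs p N -> exists i, U i p /\ U i `<=` N.

Definition pattern k (p : M) : {ffun 'I_k -> bool} := [ffun i : 'I_k => `[< U i p >]].

Definition cell k (s : {ffun 'I_k -> bool}) : set Omega :=
  [set w | S (T w) /\ pattern k (T w) = s].

Lemma cell_past k s : past x n (@cell k s).
Proof.
pose B i := if insub i is Some j then
  (if s j then T @^-1` U i else ~` (T @^-1` U i)) else setT.
have -> : cell s = T @^-1` S `&` \bigcap_i B i.
  apply/seteqP; split=> w /= [Sw].
    move=> sw; split=> // i _; rewrite /B; case: insubP => //= j _ <-.
    by rewrite -sw ffunE; case: asboolP.
  move=> Bw; split=> //; apply/ffunP => j; rewrite ffunE.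
  have := Bw j I; rewrite /B; case: insubP => [j' _ /val_inj ->|]; last by rewrite ltn_ord.
  by case: (s j) => /= H; [apply/asboolP|apply/asboolPn].
apply: past_setI; first exact: past_stable.
apply: past_bigcap => i; rewrite /B; case: insubP => [j _ _|_]; last exact: past_setT.
by case: ifP => _; [|apply: past_setC]; exact: Tn.
Qed.

(* The statistic [T] is replaced by one point of [S] for each pattern of
   membership in the first [k] base sets: finitely many values, to which
   independence applies cell by cell, and which converge to [T]. *)
Definition representative k (s : {ffun 'I_k -> bool}) : option M :=
  match pselect (exists t, S t /\ pattern k t = s) with
  | left e => Some (projT1 (cid e)) | right _ => None end.

Lemma representativeP k p : S p ->
  exists2 t, representative (pattern k p) = Some t & S t /\ pattern k t = pattern k p.
Proof.
move=> Sp; rewrite /representative; case: pselect => [e|[]]; last by exists p.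
by exists (projT1 (cid e)) => //; exact: (projT2 (cid e)).
Qed.

Lemma representative_stable k s t : @representative k s = Some t -> S t.
Proof.
by rewrite /representative; case: pselect => // e [<-]; have [] := projT2 (cid e).
Qed.

(** The default 0 concerns patterns realized by no point of [S], whose cells are empty. *)
Definition cell_value (F : M -> X -> R) k s (y : X) : R :=
  if @representative k s is Some t then F t y else 0.

Definition approximation (F : M -> X -> R) k (w : Omega) : \bar R :=
  (\sum_(s : {ffun 'I_k -> bool})
     ((fun w => (cell_value F s (x n.+1 w))%:E) \_ (cell s)) w)%E.

Lemma approximation_stable F k w : S (T w) ->
  approximation F k w = (cell_value F (pattern k (T w)) (x n.+1 w))%:E.
Proof.
move=> Sw; rewrite /approximation (bigD1 (pattern k (T w))) //=.
rewrite big1 ?adde0; first by rewrite patchE mem_set.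
move=> s sw; rewrite patchE memNset // => -[_ ws].
by rewrite ws eqxx in sw.
Qed.

Section Integrand.
Variable F : M -> X -> R.
Hypothesis F0 : forall p y, S p -> 0 <= F p y.
Hypothesis Fm : forall p, S p -> measurable_fun [set: X] (F p).
Hypothesis Fc : forall p y, S p -> F q y @[q --> within S (nbhs p)] --> F p y.

Lemma cell_value_ge0 k s y : 0 <= @cell_value F k s y.
Proof.
rewrite /cell_value; case E: representative => [t|] //.
by apply: F0; exact: representative_stable E.
Qed.

Lemma measurable_cell_value k s : measurable_fun [set: X] (@cell_value F k s).
Proof.
rewrite /cell_value; case E: representative => [t|]; last exact: measurable_cst.
by apply: Fm; exact: representative_stable E.
Qed.

Lemma measurable_approximation k : measurable_fun [set: Omega] (approximation F k).
Proof.
apply: emeasurable_sum => s.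
apply/(measurable_restrictT _ _).1; first exact: (past_measurable xiid (cell_past s)).
apply/measurable_EFinP/measurable_funTS.
have [mx _ _] := xiid.
exact: (measurableT_comp (measurable_cell_value s) (mx n)).
Qed.

Lemma approximation_ge0 k w : (0 <= approximation F k w)%E.
Proof.
apply: sume_ge0 => s _; rewrite patchE; case: ifP => // _.
by rewrite lee_fin cell_value_ge0.
Qed.

Lemma approximation_integral k :
  (\int[Pr]_(w in T @^-1` S) approximation F k w =
   \sum_(s : {ffun 'I_k -> bool}) Pr (cell s) * \int[Q]_y (cell_value F s y)%:E)%E.
Proof.
have mS := past_measurable xiid past_stable.
have mc s := past_measurable xiid (@cell_past k s).
have [mx _ _] := xiid.
rewrite ge0_integral_sum //; last 2 first.
- move=> s; apply: measurable_funTS.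
  apply/(measurable_restrictT _ (mc s)).1.
  apply/measurable_EFinP/measurable_funTS.
  exact: (measurableT_comp (measurable_cell_value s) (mx n)).
- move=> s w _; rewrite patchE; case: ifP => // _.
  by rewrite lee_fin cell_value_ge0.
apply: eq_bigr => s _.
rewrite -integral_mkcondr.
have -> : T @^-1` S `&` cell s = cell s by apply: setIidr => w [].
rewrite (past_integral xiid (cell_past s) (f := EFin \o cell_value F s)) //.
  exact/measurable_EFinP/measurable_cell_value.
by move=> y; rewrite /= lee_fin cell_value_ge0.
Qed.

(** A base set [U i] around [T w] contains the representative as soon as [i < k]; as representatives
    lie in [S], continuity within [S] suffices. *)
Lemma approximation_cvg w : S (T w) ->
  approximation F k w @[k --> \oo] --> (F (T w) (x n.+1 w))%:E.
Proof.
move=> Sw; under eq_fun do rewrite approximation_stable //.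
apply: cvg_EFin; first by near=> k.
move=> N /(@Fc _ (x n.+1 w) Sw); rewrite /nbhs /= /within /= => pN'.
have [i [Ui UN]] := Ub pN'.
near=> k => /=; rewrite /cell_value.
have [t -> [St tp]] := representativeP k Sw.
apply: (UN) => //.
have ik : (i < k)%N by near: k; exact: nbhs_infty_gt.
have /ffunP/(_ (Ordinal ik)) := tp; rewrite !ffunE /= => E.
by apply/asboolP; rewrite E; apply/asboolP.
Unshelve. all: by end_near. Qed.

(** [F] is measurable in the observation and continuous in the point; the composite is measurable as
    a pointwise limit of approximations. *)
Lemma measurable_step : measurable_fun (T @^-1` S) (fun w => F (T w) (x n.+1 w)).
Proof.
apply/measurable_EFinP.
apply: (@emeasurable_fun_cvg _ _ _ _ (fun k => approximation F k)).
  by move=> k; apply: measurable_funTS; exact: measurable_approximation.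
by move=> w Sw; exact: approximation_cvg.
Qed.

End Integrand.

Variables (F : M -> X -> R) (g : M -> R) (K : R).
Hypothesis F0 : forall p y, S p -> 0 <= F p y.
Hypothesis Fm : forall p, S p -> measurable_fun [set: X] (F p).
Hypothesis Fc : forall p y, S p -> F q y @[q --> within S (nbhs p)] --> F p y.
Hypothesis Fg : forall p, S p -> (\int[Q]_y (F p y)%:E <= (g p)%:E)%E.
Hypothesis gc : forall p, S p -> g q @[q --> within S (nbhs p)] --> g p.
Hypothesis gK : forall p, S p -> g p <= K.

(** On each cell the inequality is [Fg] at the representative, by independence. Fatou's lemma
    handles the limit of [F], which has no bound; dominated convergence handles that of [g], which
    lies between 0 and [K]. *)
Lemma step_integral_le :
  (\int[Pr]_(w in T @^-1` S) (F (T w) (x n.+1 w))%:E <=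
   \int[Pr]_(w in T @^-1` S) (g (T w))%:E)%E.
Proof.
have mS := past_measurable xiid past_stable.
(* As an integrand that ignores the observation, [g] falls under the same approximation lemmas. *)
pose G p (y : X) := g p.
have G0 p y : S p -> 0 <= G p y.
  move=> Sp; rewrite -lee_fin; apply: le_trans (Fg Sp).
  by apply: integral_ge0 => z _; rewrite lee_fin F0.
have Gm p : S p -> measurable_fun [set: X] (G p) by move=> _; exact: measurable_cst.
have Gc p y : S p -> G q y @[q --> within S (nbhs p)] --> G p y by move=> Sp; exact: gc.
have mG k : measurable_fun (T @^-1` S) (approximation G k).
  by apply: measurable_funTS; exact: measurable_approximation.
have GK : (\int[Pr]_(w in T @^-1` S) approximation G k w @[k --> \oo] -->
    \int[Pr]_(w in T @^-1` S) (g (T w))%:E)%E.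
  have [] := @dominated_convergence _ _ _ Pr _ mS (fun k => approximation G k)
    (fun w => (g (T w))%:E) (cst K%:E) _ _ _ _ _ => //.
  - by apply/measurable_EFinP; exact: (measurable_step Gm Gc).
  - by apply: aeW => w Sw; exact: (approximation_cvg Gc).
  - exact: finite_measure_integrable_cst.
  - apply: aeW => w k Sw; rewrite gee0_abs ?approximation_ge0 //.
    rewrite approximation_stable // lee_fin /cell_value.
    by have [t -> [St _]] := representativeP k Sw; exact: gK.
have le k : (\int[Pr]_(w in T @^-1` S) approximation F k w <=
    \int[Pr]_(w in T @^-1` S) approximation G k w)%E.
  rewrite !approximation_integral //; apply: lee_sum => s _.
  apply: lee_pmul => //.
    by apply: integral_ge0 => y _; rewrite lee_fin cell_value_ge0.
  rewrite /cell_value; case E: representative => [t|] //.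
  have St := representative_stable E.
  apply: (le_trans (Fg St)); rewrite -[leLHS]mule1 -(@probability_setT _ _ _ Q).
  by rewrite -integral_cst.
have := @fatou _ _ _ Pr _ mS (fun k => approximation F k) _ _.
rewrite (@eq_integral _ _ _ _ _ (fun w => (F (T w) (x n.+1 w))%:E)); last first.
  move=> w /set_mem Sw; have C := approximation_cvg Fc Sw.
  by rewrite is_cvg_limn_einfE; [exact/cvg_lim|apply/cvg_ex; eexists; exact: C].
move=> H; apply: (le_trans (H _ _)).
- by move=> k; apply: measurable_funTS; exact: measurable_approximation.
- by move=> k w _; exact: approximation_ge0.
have <- : limn_einf (fun k => \int[Pr]_(w in T @^-1` S) approximation G k w)%E =
    (\int[Pr]_(w in T @^-1` S) (g (T w))%:E)%E by have [] := cvg_limn_einf_sup GK.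
rewrite !limn_einf_lim; apply: lee_lim.
- exact: is_cvg_einfs.
- exact: is_cvg_einfs.
near=> m; apply: le_ereal_inf_tmp => _ [k mk <-].
apply: le_trans (le k); apply: ereal_inf_lbound; exists k.
Unshelve. all: by end_near. Qed.

End ConditionalStep.

(** * Scalar inequalities and the recursion *)

Section Scalar.
Context {R : realType}.
Implicit Types K m s t q c a : R.

(** From exp(-z) >= 1 - z one gets exp z - 1 - z <= z (exp z - 1), and the right side is at most z^2
    exp Z for either sign of z. *)
Lemma expR_le_quadratic (z Z : R) : z <= Z -> 0 <= Z ->
  expR z <= 1 + z + z ^+ 2 * expR Z.
Proof.
move=> zZ Z0.
have e0 := expR_gt0 z; have e1 := expR_ge1Dx z.
have eZ : expR z <= expR Z by rewrite ler_expR.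
have eZ1 : 1 <= expR Z by rewrite -expR0 ler_expR.
have h : expR z - 1 <= z * expR z.
  have := expR_ge1Dx (- z); rewrite expRN => h.
  have : expR z * (1 - z) <= 1.
    by rewrite -[leRHS](divff (lt0r_neq0 e0)) ler_pM2l.
  by nra.
have [z0|z0] := leP 0 z.
  have : z ^+ 2 * expR z <= z ^+ 2 * expR Z by rewrite ler_wpM2l // sqr_ge0.
  have : z * (expR z - 1) <= z * (z * expR z) by rewrite ler_wpM2l.
  by nra.
have : z ^+ 2 * 1 <= z ^+ 2 * expR Z by rewrite ler_wpM2l // sqr_ge0.
by nra.
Qed.

(** Bound exp(K (t - s)) quadratically and multiply by t = s + (t - s): the terms of order 0 and 1
    are exact, and only the coefficient of (t - s)^2 has to be estimated. *)
Lemma lyapunov_taylor K m s t : 0 <= K -> 0 <= s <= m -> 0 <= t <= m ->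
  t * expR (K * t) <= s * expR (K * s) + (1 + K * s) * expR (K * s) * (t - s)
    + expR (K * m) * (K + m * K ^+ 2 * expR (K * m)) * (t - s) ^+ 2.
Proof.
move=> K0 /andP[s0 sm] /andP[t0 tm].
have Es : expR (K * t) = expR (K * s) * expR (K * (t - s)).
  by rewrite -expRD -mulrDr addrC subrK.
have Em : expR (K * s) <= expR (K * m) by rewrite ler_expR ler_wpM2l.
have E0 := expR_gt0 (K * s); have Em0 := expR_gt0 (K * m).
have h : expR (K * (t - s)) <= 1 + K * (t - s) + (K * (t - s)) ^+ 2 * expR (K * m).
  apply: expR_le_quadratic; last by rewrite mulr_ge0 // (le_trans s0).
  by rewrite ler_wpM2l // lerBlDr (le_trans tm) // lerDl.
have h2 : t * expR (K * t) <=
    t * (expR (K * s) * (1 + K * (t - s) + (K * (t - s)) ^+ 2 * expR (K * m))).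
  by rewrite Es !ler_wpM2l // ltW.
apply: (le_trans h2).
set A := expR (K * s) in E0 Em *; set B := expR (K * m) in Em Em0 *.
have -> : t * (A * (1 + K * (t - s) + (K * (t - s)) ^+ 2 * B)) =
  s * A + (1 + K * s) * A * (t - s) + A * (K + t * K ^+ 2 * B) * (t - s) ^+ 2.
  by ring.
rewrite lerD2l ler_wpM2r ?sqr_ge0 //.
have K2 : 0 <= K ^+ 2 * B by rewrite mulr_ge0 ?sqr_ge0 // ltW.
apply: ler_pM; [exact: ltW| | exact: Em|].
  by rewrite addr_ge0 // -mulrA mulr_ge0.
by rewrite lerD2l -2!mulrA ler_wpM2r.
Qed.

(** A form of Chung's lemma, by induction on w n <= C / n. The induction step needs c <= C (q - 1),
    where q > 1 enters; it starts at [n0 >= q] so that 1 - q / (n + 1) is nonnegative. *)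
Lemma chung (w : nat -> R) q c : 1 < q -> 0 <= c -> (forall n, 0 <= w n) ->
  (forall n, w n.+1 <= (1 - q / n.+1%:R) * w n + c / n.+1%:R ^+ 2) ->
  exists C, \forall n \near \oo, w n <= C / n%:R.
Proof.
move=> q1 c0 w0 Hw.
pose n0 := (Num.truncn q).+1.
have n0q : q <= n0%:R by rewrite ltW // truncnS_gt.
pose C := Num.max (n0%:R * w n0) (c / (q - 1)).
have C0 : 0 <= C by rewrite le_max mulr_ge0.
have Cc : c <= C * (q - 1).
  by rewrite -ler_pdivrMr ?subr_gt0 // le_max lexx orbT.
exists C; suff H n : (n0 <= n)%N -> w n <= C / n%:R.
  by near=> n; apply: H; near: n; exact: nbhs_infty_ge.
elim: n => [//|n IH].
rewrite leq_eqVlt => /predU1P[<-|n0n].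
  by rewrite ler_pdivlMr ?ltr0n // mulrC le_max lexx.
have {}IH := IH n0n.
have np : 0 < n%:R :> R by rewrite ltr0n -ltnS (leq_trans _ n0n).
have n1p : 0 < n.+1%:R :> R by rewrite ltr0n.
have qn : q <= n.+1%:R by rewrite (le_trans n0q) // ler_nat ltnW // ltnS.
apply: (le_trans (Hw n)).
have h : (1 - q / n.+1%:R) * w n <= (1 - q / n.+1%:R) * (C / n%:R).
  by rewrite ler_wpM2l // subr_ge0 ler_pdivrMr // mul1r.
apply: (@le_trans _ _ ((1 - q / n.+1%:R) * (C / n%:R) + c / n.+1%:R ^+ 2)).
  by rewrite lerD2r.
rewrite -subr_ge0.
have -> : C / n.+1%:R - ((1 - q / n.+1%:R) * (C / n%:R) + c / n.+1%:R ^+ 2) =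
   (C * (q - 1) * n.+1%:R - c * n%:R) / (n%:R * n.+1%:R ^+ 2).
  rewrite -[n.+1]addn1 natrD; field.
  by rewrite -natr1 in n1p; rewrite (gt_eqF np) (gt_eqF n1p).
apply: divr_ge0; last by rewrite mulr_ge0 ?ltW // exprn_ge0 ?ltW.
rewrite subr_ge0; apply: (@le_trans _ _ (c * n.+1%:R)); last by rewrite ler_wpM2r // ltW.
by rewrite ler_wpM2l // ler_nat.
Unshelve. all: by end_near. Qed.

End Scalar.

(** * Moments of the vector field *)

Section Moments.
Context {R : realType} {r d : nat} {M : riemannian_manifold R r d}.
Context {dX : measure_display} {X : measurableType dX} (Q : probability X R).
Variables (p : M) (Y : X -> 'rV[R]_d) (m : 'rV[R]_d).
Hypothesis Ym : has_mean Q Y m.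

Lemma innerE_sum (w v : 'rV[R]_d) :
  inner p w v = \sum_j (w *m metric p (chart p p)) 0 j * v 0 j.
Proof. by rewrite /inner mxE; apply: eq_bigr => j _; rewrite [v^T _ _]mxE. Qed.

Lemma measurable_coordinate i : measurable_fun [set: X] (fun y => Y y 0 i).
Proof.
by have [/integrableP[/measurable_EFinP mY _] _] := Ym i.
Qed.

Lemma measurable_inner_mean (w : 'rV[R]_d) :
  measurable_fun [set: X] (fun y => inner p w (Y y)).
Proof.
under eq_fun do rewrite innerE_sum.
apply: measurable_sum => j; apply: measurable_funM => //.
exact: measurable_coordinate.
Qed.

Lemma measurable_tnorm_mean : measurable_fun [set: X] (fun y => tnorm p (Y y) ^+ 2).
Proof.
under eq_fun do rewrite tnorm_sqr innerE_sum.
apply: measurable_sum => j; apply: measurable_funM; last exact: measurable_coordinate.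
under eq_fun do rewrite mxE.
apply: measurable_sum => i; apply: measurable_funM => //; exact: measurable_coordinate.
Qed.

Lemma integrable_inner (w : 'rV[R]_d) :
  Q.-integrable setT (fun y => (inner p w (Y y))%:E).
Proof.
under eq_fun do rewrite innerE_sum -sumEFin.
apply: integrable_sum => // j _; under eq_fun do rewrite EFinM.
by apply: integrableZl => //; have [] := Ym j.
Qed.

Lemma integral_inner (w : 'rV[R]_d) :
  (\int[Q]_y (inner p w (Y y))%:E = (inner p w m)%:E)%E.
Proof.
under eq_integral do rewrite innerE_sum -sumEFin.
rewrite integral_sum //; last first.
  by move=> j; under eq_fun do rewrite EFinM; apply: integrableZl => //; have [] := Ym j.
rewrite innerE_sum -sumEFin; apply: eq_bigr => j _.
have [iY <-] := Ym j.
under eq_integral do rewrite EFinM.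
by rewrite integralZl // EFinM /Rintegral fineK // integrable_fin_num.
Qed.

Variable C : R.
Hypothesis YC : (\int[Q]_y (tnorm p (Y y) ^+ 2)%:E <= C%:E)%E.

Lemma integrable_tnorm : Q.-integrable setT (fun y => (tnorm p (Y y) ^+ 2)%:E).
Proof.
apply/integrableP; split; first exact/measurable_EFinP/measurable_tnorm_mean.
under eq_integral do rewrite gee0_abs ?lee_fin ?sqr_ge0 //.
by apply: (le_lt_trans YC); rewrite ltry.
Qed.

(** Integrate 2 <m, Y> - |m|^2 <= |Y|^2, which is |Y - m|^2 >= 0. *)
Lemma tnorm_mean_le : tnorm p m ^+ 2 <= C.
Proof.
have i1 := integrable_inner m.
have H : (\int[Q]_y ((2 * inner p m (Y y))%:E - (tnorm p m ^+ 2)%:E) <=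
          \int[Q]_y (tnorm p (Y y) ^+ 2)%:E)%E.
  apply: le_integral => //.
  - apply: integrableB => //; last exact: finite_measure_integrable_cst.
    by under eq_fun do rewrite EFinM; apply: integrableZl.
  - exact: integrable_tnorm.
  - move=> y _; rewrite -EFinB lee_fin !tnorm_sqr.
    have := qf_amgm m (Y y) (- 1) (metric_pd (dom_self p)).
    rewrite /qf -/(inner p m (Y y)) -/(inner p m m) -/(inner p (Y y) (Y y)); lra.
have := le_trans H YC; rewrite integralB //; last 2 first.
- by under eq_fun do rewrite EFinM; apply: integrableZl.
- exact: finite_measure_integrable_cst.
under eq_integral do rewrite EFinM.
have -> : (\int[Q]__ (tnorm p m ^+ 2)%:E = (tnorm p m ^+ 2)%:E)%E.
  by rewrite -[RHS]mule1 -(@probability_setT _ _ _ Q) -integral_cst.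
rewrite integralZl // integral_inner -EFinM -EFinB lee_fin -tnorm_sqr.
by lra.
Qed.

End Moments.

(** * The recursion for the mean Lyapunov function *)

Section MeanSquare.
Context {R : realType} {r d : nat} {M : riemannian_manifold R r d}.
Context {dX dO : measure_display} {X : measurableType dX}
  {Omega : measurableType dO}.
Variables (Q : probability X R) (Pr : probability Omega R).
Hypothesis r3 : (3 < r)%N.
Variables (D : M -> R) (S : set M) (u : M -> X -> 'rV[R]_d).
Hypothesis Dd : forall p, differentiable_at D p.
Hypothesis D_ge0 : forall p, 0 <= D p.
Hypothesis Sc : geodesically_convex S.
Hypothesis Scomp : compact S.
Hypothesis DL : lipschitz_field S (grad D).
Hypothesis uc : forall y, continuous_field (fun p => u p y).
Hypothesis um : forall p, has_mean Q (u p) (- grad D p).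
Variable CV : R.
Hypothesis uV : forall p, S p -> (\int[Q]_y (tnorm p (u p y) ^+ 2)%:E <= CV%:E)%E.
Variables (x : nat -> Omega -> X) (gamma : nat -> R) (th : nat -> Omega -> M).
Hypothesis xiid : iid Pr Q (fun n => x n.+1).
Hypothesis gamma0 : forall n, 0 < gamma n.+1.
Hypothesis thS : forall n, statistic x n (th n).
Hypothesis thE : forall n w,
  is_Exp (th n w) (gamma n.+1 *: u (th n w) (x n.+1 w)) (th n.+1 w).
Hypothesis stable : {ae Pr, forall w, forall n, S (th n w)}.
Variables (beta K : R).
Hypothesis beta0 : 0 < beta.
Hypothesis K0 : 0 < K.
Hypothesis HK : forall p, S p ->
  beta * D p <= (1 + K * D p) * tnorm p (grad D p) ^+ 2.

Let b := Num.sqrt CV.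

(** The mean of [u] is - grad D, so the bound on its second moment also bounds the gradient. *)
Lemma grad_bound p : S p -> tnorm p (grad D p) <= b.
Proof.
move=> Sp; have := tnorm_mean_le (um p) (uV Sp); rewrite tnormN => H.
rewrite -(ger0_norm (tnorm_ge0 p (grad D p))) -sqrtr_sqr ler_wsqrtr //.
Qed.

(* Near [ths] the drift of [D] itself is at rate [beta]; the exponential factor
   makes this rate uniform on [S], where [HK] is all that is available. *)
Definition lyapunov (p : M) : R := D p * expR (K * D p).
(** The derivative of s exp(K s) at s = D p. *)
Definition weight (p : M) : R := (1 + K * D p) * expR (K * D p).

Lemma lyapunov_ge0 p : 0 <= lyapunov p.
Proof. by rewrite mulr_ge0 // ltW // expR_gt0. Qed.

Lemma weight_ge0 p : 0 <= weight p.
Proof. by rewrite mulr_ge0 ?addr_ge0 ?mulr_ge0 ?(ltW K0) // ltW // expR_gt0. Qed.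

Lemma le_lyapunov p : D p <= lyapunov p.
Proof.
rewrite ler_peMr // -[leLHS]expR0 ler_expR mulr_ge0 // ltW //.
Qed.

Lemma lyapunov_drift p : S p ->
  beta * lyapunov p <= weight p * tnorm p (grad D p) ^+ 2.
Proof.
move=> Sp; rewrite /lyapunov /weight mulrA [leRHS]mulrAC ler_wpM2r ?HK //.
Qed.

Lemma lyapunov_continuous : continuous lyapunov.
Proof.
move=> p; apply: cvgM; first exact: D_continuous.
apply: (@continuous_comp _ _ _ (fun q => K * D q) expR); last exact: continuous_expR.
by apply: cvgM; [exact: cvg_cst|exact: D_continuous].
Qed.

Lemma weight_continuous : continuous weight.
Proof.
move=> p; have KD : K * D q @[q --> p] --> K * D p.
  by apply: cvgM; [exact: cvg_cst|exact: D_continuous].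
apply: cvgM; first by apply: cvgD; [exact: cvg_cst|].
by apply: (@continuous_comp _ _ _ (fun q => K * D q) expR); last exact: continuous_expR.
Qed.

Lemma stable_bounds : exists m : R, [/\ 0 <= m, forall p, S p -> D p <= m,
  forall p, S p -> lyapunov p <= m * expR (K * m) &
  forall p, S p -> weight p <= (1 + K * m) * expR (K * m)].
Proof.
have [m0 Hm] := D_bounded Dd Scomp.
pose m := Num.max m0 0; have mm p : S p -> D p <= m.
  by move=> Sp; rewrite le_max Hm.
have KDm p : S p -> K * D p <= K * m by move=> Sp; rewrite ler_wpM2l ?(ltW K0) ?mm.
exists m; split=> //; first by rewrite le_max lexx orbT.
  by move=> p Sp; apply: ler_pM; rewrite ?expR_ge0 ?ler_expR ?KDm ?mm.
move=> p Sp; apply: ler_pM; rewrite ?expR_ge0 ?ler_expR ?lerD2l ?KDm //.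
by rewrite addr_ge0 // mulr_ge0 // ltW.
Qed.

Lemma lyapunov_step : exists2 C : R, 0 < C & forall p q v, S p -> S q ->
  is_Exp p v q ->
  lyapunov q <= lyapunov p + weight p * inner p (grad D p) v + C * tnorm p v ^+ 2.
Proof.
have [C0 C00 HC0] := gradient_expansion_uniform r3 Dd D_ge0 Sc Scomp DL grad_bound.
have [m [m0 Dm _ Wm]] := stable_bounds.
set Pm := (1 + K * m) * _ in Wm.
pose L := expR (K * m) * (K + m * K ^+ 2 * expR (K * m)).
have L0 : 0 <= L.
  have e0 := expR_gt0 (K * m).
  by rewrite /L mulr_ge0 ?addr_ge0 ?mulr_ge0 ?exprn_ge0 ?(ltW K0) ?(ltW e0).
have Pm0 : 0 <= Pm.
  by rewrite mulr_ge0 ?addr_ge0 ?mulr_ge0 ?(ltW K0) // ltW // expR_gt0.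
have b0 : 0 <= b by exact: sqrtr_ge0.
(* The summands come from the expansion error of D, from the second-order term of [lyapunov_taylor],
   and from the need for a positive constant: it becomes a denominator when the square is
   completed. *)
exists (Pm * C0 + L * ((b + C0) ^+ 2 + m ^+ 2) + 1).
  have := mulr_ge0 Pm0 C00.
  by have := mulr_ge0 L0 (addr_ge0 (sqr_ge0 (b + C0)) (sqr_ge0 m)); lra.
move=> p q v Sp Sq Epq.
have Hpq := HC0 p q v Sp Sq Epq.
have T := @lyapunov_taylor R K m (D p) (D q) (ltW K0) _ _.
have {}T := T _ _; move: (T).
rewrite D_ge0 (Dm _ Sp) D_ge0 (Dm _ Sq) => /(_ isT isT) {}T.
rewrite -/(lyapunov q) -/(lyapunov p) -/(weight p) -/L in T.
have t0 := tnorm_ge0 p v; set t := tnorm p v in Hpq t0 *.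
have cs : `|inner p (grad D p) v| <= b * t.
  by apply: (le_trans (inner_cs _ _ _)); rewrite ler_wpM2r // grad_bound.
set I := inner p (grad D p) v in Hpq cs *.
set dl := D q - D p in Hpq T *.
(* For t <= 1 the expansion makes [dl] of order t; for larger t it suffices that [dl] is at most [m]
   in absolute value. *)
have dlb : dl ^+ 2 <= ((b + C0) ^+ 2 + m ^+ 2) * t ^+ 2.
  have [t1|t1] := leP t 1.
    have : `|dl| <= (b + C0) * t.
      have -> : dl = (dl - I) + I by rewrite subrK.
      apply: (le_trans (ler_normD _ _)).
      have : C0 * t ^+ 2 <= C0 * t by rewrite ler_wpM2l // expr2 ler_piMr.
      by lra.
    move=> h; rewrite -[dl ^+ 2]real_normK ?num_real //.
    apply: (@le_trans _ _ (((b + C0) * t) ^+ 2)).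
      by rewrite ler_pXn2r // nnegrE // mulr_ge0 ?addr_ge0.
    by rewrite exprMn mulrDl lerDl mulr_ge0 ?sqr_ge0.
  have : `|dl| <= m.
    have := Dm _ Sp; have := Dm _ Sq; have := D_ge0 p; have := D_ge0 q.
    by rewrite ler_norml /dl => *; apply/andP; split; lra.
  move=> h; rewrite -[dl ^+ 2]real_normK ?num_real //.
  apply: (@le_trans _ _ (m ^+ 2)); first by rewrite ler_pXn2r // nnegrE.
  have : m ^+ 2 * 1 <= m ^+ 2 * t ^+ 2.
    by rewrite ler_wpM2l ?sqr_ge0 // exprn_ege1 // ltW.
  have := mulr_ge0 (sqr_ge0 (b + C0)) (sqr_ge0 t).
  by lra.
have h1 : weight p * dl <= weight p * I + Pm * C0 * t ^+ 2.
  have : weight p * (dl - I) <= weight p * (C0 * t ^+ 2).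
    rewrite ler_wpM2l ?weight_ge0 //; exact: le_trans (ler_norm _) Hpq.
  have : weight p * (C0 * t ^+ 2) <= Pm * (C0 * t ^+ 2).
    by rewrite ler_wpM2r ?Wm // mulr_ge0 ?sqr_ge0.
  by lra.
have h2 : L * dl ^+ 2 <= L * (((b + C0) ^+ 2 + m ^+ 2) * t ^+ 2) by rewrite ler_wpM2l.
have := sqr_ge0 t.
by lra.
Qed.

Hypothesis CV0 : 0 <= CV.

Definition stability_event : set Omega := \bigcap_n (th n @^-1` S).

Let S_closed : closed S.
Proof. by apply: compact_closed => //; exact: man_hausdorff. Qed.

Lemma measurable_stable n : measurable (th n @^-1` S).
Proof. exact: (past_measurable xiid (past_stable (@thS n) S_closed)). Qed.

Lemma measurable_stability_event : measurable stability_event.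
Proof. by apply: bigcapT_measurable => n; exact: measurable_stable. Qed.

Lemma unstable_null : Pr (~` stability_event) = 0%E.
Proof.
apply/(negligibleP _ (measurableC measurable_stability_event)).
apply: negligibleS stable => w /= H Hw; apply: H => n _; exact: Hw.
Qed.

Lemma probability_stability_event : Pr stability_event = 1%E.
Proof.
rewrite -[stability_event]setCK probability_setC; last first.
  exact: measurableC measurable_stability_event.
by rewrite -[X in (1 - X)%E]/(Pr (~` stability_event)) unstable_null sube0.
Qed.

(** Independence needs an event of the past, namely that [th n] is in [S], while the step inequality
    needs [th n.+1] in [S] as well; up to a null set both reduce to one event for all [n]. *)
Lemma integral_stability_event n (f : Omega -> \bar R) :
  measurable_fun (th n @^-1` S) f -> (forall w, S (th n w) -> (0 <= f w)%E) ->
  (\int[Pr]_(w in th n @^-1` S) f w = \int[Pr]_(w in stability_event) f w)%E.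
Proof.
move=> mf f0.
rewrite (ge0_negligible_integral (measurableC measurable_stability_event)
  (measurable_stable n) mf f0 unstable_null).
congr (integral _ _ _); rewrite setDE setCK; apply/setIidr.
by move=> w; apply.
Qed.

Lemma stability_event_sub n : stability_event `<=` th n @^-1` S.
Proof. by move=> w; apply. Qed.

Lemma measurable_statistic n (f : M -> R) : continuous f ->
  measurable_fun (th n @^-1` S) (fun w => f (th n w)).
Proof.
move=> fc; have [U [Uo Ub]] := second_countable_base (@man_second_countable _ _ _ M).
apply: (measurable_step xiid (@thS n) S_closed Uo Ub (F := fun p _ => f p)) => //.
by move=> p y Sp; apply: cvg_within_filter; exact: fc.
Qed.

Definition mean_lyapunov n : R :=
  fine (\int[Pr]_(w in stability_event) (lyapunov (th n w))%:E).

Lemma integral_bounded_stable n (f : M -> R) (m : R) : continuous f ->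
  (forall p, S p -> `|f p| <= m) ->
  Pr.-integrable stability_event (fun w => (f (th n w))%:E).
Proof.
move=> fc fm; have mE := measurable_stability_event.
apply: (@le_integrable _ _ _ _ _ mE _ (cst m%:E)); last exact: finite_measure_integrable_cst.
  apply/measurable_EFinP.
  apply: (measurable_funS (measurable_stable n) (@stability_event_sub n)).
  exact: measurable_statistic.
move=> w Ew; rewrite /= lee_fin (le_trans (fm _ _)) ?ler_norm //.
exact: stability_event_sub.
Qed.

Lemma integrable_lyapunov n :
  Pr.-integrable stability_event (fun w => (lyapunov (th n w))%:E).
Proof.
have [m [m0 _ Lm _]] := stable_bounds.
apply: (integral_bounded_stable n (m := m * expR (K * m)) lyapunov_continuous) => p Sp.
by rewrite ger0_norm ?lyapunov_ge0 // Lm.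
Qed.

Lemma mean_lyapunovE n :
  (\int[Pr]_(w in stability_event) (lyapunov (th n w))%:E = (mean_lyapunov n)%:E)%E.
Proof.
rewrite fineK // integrable_fin_num //; first exact: measurable_stability_event.
exact: integrable_lyapunov.
Qed.

Lemma mean_lyapunov_ge0 n : 0 <= mean_lyapunov n.
Proof. by apply: fine_ge0; apply: integral_ge0 => w _; rewrite lee_fin lyapunov_ge0. Qed.

Lemma mean_lyapunov_affine n (s c : R) :
  (\int[Pr]_(w in stability_event) (c - s * lyapunov (th n w))%:E =
   (c - s * mean_lyapunov n)%:E)%E.
Proof.
have mE := measurable_stability_event.
under eq_integral do rewrite EFinB EFinM.
rewrite integralB //; last 2 first.
- exact: finite_measure_integrable_cst.
- by apply: integrableZl => //; exact: integrable_lyapunov.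
rewrite integralZl //; last exact: integrable_lyapunov.
have -> : (\int[Pr]_(w in stability_event) c%:E = c%:E)%E.
  by rewrite -[RHS]mule1 -probability_stability_event -integral_cst.
by rewrite mean_lyapunovE.
Qed.

Section Increment.
Variables (n : nat) (C m : R).
Let g := gamma n.+1.
Let B := m * b.
Let c := B ^+ 2 / (4 * (C * g)).
(* [c] completes the square, making [F] nonnegative: its expectation can then be
   bounded without knowing beforehand that [F] is integrable. *)
Let F p y := weight p * inner p (grad D p) (u p y)
  + C * g * tnorm p (u p y) ^+ 2 + c.
Hypothesis C0 : 0 < C.
Hypothesis wm : forall p, S p -> weight p <= m.

Lemma increment_ge0 p y : S p -> 0 <= F p y.
Proof.
move=> Sp; have e0 : 0 < C * g by rewrite mulr_gt0 // gamma0.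
have b0 : 0 <= b by exact: sqrtr_ge0.
set t := tnorm p (u p y); have t0 : 0 <= t by exact: tnorm_ge0.
have h : - (B * t) <= weight p * inner p (grad D p) (u p y).
  have h1 : `|weight p * inner p (grad D p) (u p y)| <= B * t.
    rewrite normrM ger0_norm ?weight_ge0 // /B -mulrA ler_pM ?weight_ge0 ?wm //.
    by apply: (le_trans (inner_cs _ _ _)); rewrite ler_wpM2r // grad_bound.
  by have := ler_norm (- (weight p * inner p (grad D p) (u p y))); rewrite normrN; lra.
rewrite /F -/t; apply: (@le_trans _ _ (- (B * t) + C * g * t ^+ 2 + c)); last first.
  by rewrite !lerD2r.
have -> : - (B * t) + C * g * t ^+ 2 + c = (2 * (C * g) * t - B) ^+ 2 / (4 * (C * g)).
  have gp : 0 < g by exact: gamma0.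
  by rewrite /c; field; rewrite (gt_eqF C0) (gt_eqF gp).
by rewrite divr_ge0 ?sqr_ge0 // mulr_ge0 // ltW.
Qed.

Lemma increment_measurable p : measurable_fun [set: X] (F p).
Proof.
apply: measurable_funD => //; apply: measurable_funD; apply: measurable_funM => //.
  exact: measurable_inner_mean (um p) _.
exact: measurable_tnorm_mean (um p).
Qed.

Lemma increment_continuous p y : S p -> F q y @[q --> within S (nbhs p)] --> F p y.
Proof.
move=> Sp.
have cu := field_components_cvg S (o := p) (@uc y).
have cg := grad_components_cvg r3 Sc DL grad_bound Sp.
apply: cvgD; last exact: cvg_cst.
apply: cvgD; apply: cvgM.
- by apply: cvg_within_filter; exact: weight_continuous.
- exact: inner_cvg.
- exact: cvg_cst.
- under eq_fun do rewrite tnorm_sqr.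
  by rewrite tnorm_sqr; exact: inner_cvg.
Qed.

(** The cross term averages to minus [weight p] times the squared gradient, which [lyapunov_drift]
    turns into - beta W. *)
Lemma increment_integral p : S p ->
  (\int[Q]_y (F p y)%:E <= (C * g * CV + c - beta * lyapunov p)%:E)%E.
Proof.
move=> Sp; have e0 : 0 < C * g by rewrite mulr_gt0 // gamma0.
have i1 := integrable_inner p (um p) (grad D p).
have i2 := integrable_tnorm (um p) (uV Sp).
have j1 : Q.-integrable setT (fun y => (weight p)%:E * (inner p (grad D p) (u p y))%:E)%E.
  exact: integrableZl.
have j2 : Q.-integrable setT (fun y => (C * g)%:E * (tnorm p (u p y) ^+ 2)%:E)%E.
  exact: integrableZl.
have FE y : (F p y)%:E = ((weight p)%:E * (inner p (grad D p) (u p y))%:E +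
    (C * g)%:E * (tnorm p (u p y) ^+ 2)%:E + c%:E)%E by [].
under eq_integral do rewrite FE.
rewrite integralD //; [|exact: integrableD|exact: finite_measure_integrable_cst].
rewrite integralD // !integralZl // (integral_inner p (um p)).
have -> : (\int[Q]__ c%:E = c%:E)%E.
  by rewrite -[RHS]mule1 -(@probability_setT _ _ _ Q) -integral_cst.
have h : ((C * g)%:E * \int[Q]_y (tnorm p (u p y) ^+ 2)%:E <= (C * g * CV)%:E)%E.
  by rewrite [(_ * CV)%:E]EFinM lee_pmul2l ?lte_fin ?fin_numE //; exact: uV.
apply: (@le_trans _ _ ((weight p)%:E * (inner p (grad D p) (- grad D p))%:E
   + (C * g * CV)%:E + c%:E)%E).
  by rewrite leeD2r // leeD2l.
rewrite -EFinM -!EFinD lee_fin.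
have -> : inner p (grad D p) (- grad D p) = - tnorm p (grad D p) ^+ 2.
  by rewrite tnorm_sqr /inner linearN /= mulmxN mxE.
by have := lyapunov_drift Sp; lra.
Qed.

Hypothesis step : forall p q v, S p -> S q -> is_Exp p v q ->
  lyapunov q <= lyapunov p + weight p * inner p (grad D p) v + C * tnorm p v ^+ 2.

Lemma mean_lyapunov_step :
  mean_lyapunov n.+1 <= (1 - beta * g) * mean_lyapunov n + C * CV * g ^+ 2.
Proof.
have g0 : 0 < g by exact: gamma0.
have c0 : 0 <= c by rewrite divr_ge0 ?sqr_ge0 // mulr_ge0 // mulr_ge0 // ltW.
have mE := measurable_stability_event.
have [U [Uo Ub]] := second_countable_base (@man_second_countable _ _ _ M).
have mF := measurable_step xiid (@thS n) S_closed Uo Ub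
  (fun p _ => increment_measurable p) increment_continuous.
have mFE : measurable_fun stability_event (fun w => F (th n w) (x n.+1 w)).
  exact: (measurable_funS (measurable_stable n) (@stability_event_sub n)).
have HF : (\int[Pr]_(w in stability_event) (F (th n w) (x n.+1 w))%:E <=
    (C * g * CV + c - beta * mean_lyapunov n)%:E)%E.
  rewrite -mean_lyapunov_affine -!(@integral_stability_event n).
  - apply: (step_integral_le xiid (@thS n) S_closed Uo Ub
      (F := F) (g := fun p => C * g * CV + c - beta * lyapunov p)
      (K := C * g * CV + c)) => //.
    + exact: increment_ge0.
    + by move=> p _; exact: increment_measurable.
    + exact: increment_continuous.
    + exact: increment_integral.
    + move=> p Sp; apply: cvg_within_filter.
      apply: cvgB; first exact: cvg_cst.
      by apply: cvgM; [exact: cvg_cst|exact: lyapunov_continuous].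
    + by move=> p Sp; rewrite gerBl mulr_ge0 ?lyapunov_ge0 // ltW.
  - apply/measurable_EFinP; apply: measurable_funB => //.
    by apply: measurable_funM => //; exact: measurable_statistic lyapunov_continuous.
  - move=> w Sw; apply: le_trans (increment_integral Sw).
    by apply: integral_ge0 => y _; rewrite lee_fin increment_ge0.
  - exact/measurable_EFinP.
  - by move=> w Sw; rewrite lee_fin increment_ge0.
(* The step inequality with [g * c] added on both sides: only nonnegative integrands occur, and the
   constant cancels at the end. *)
have HS : (\int[Pr]_(w in stability_event) (lyapunov (th n.+1 w) + g * c)%:E <=
  \int[Pr]_(w in stability_event)
     ((lyapunov (th n w))%:E + g%:E * (F (th n w) (x n.+1 w))%:E))%E.
  apply: ge0_le_integral_nomeas => w Ew.
    by rewrite lee_fin addr_ge0 ?lyapunov_ge0 // mulr_ge0 // ltW.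
  have := step (Ew n I) (Ew n.+1 I) (thE n w).
  rewrite -EFinM -EFinD lee_fin -/g /F !tnorm_sqr.
  have -> : inner (th n w) (grad D (th n w)) (g *: u (th n w) (x n.+1 w)) =
     g * inner (th n w) (grad D (th n w)) (u (th n w) (x n.+1 w)).
    by rewrite /inner linearZ /= -scalemxAr mxE.
  have -> : inner (th n w) (g *: u (th n w) (x n.+1 w)) (g *: u (th n w) (x n.+1 w)) =
     g ^+ 2 * inner (th n w) (u (th n w) (x n.+1 w)) (u (th n w) (x n.+1 w)).
    by rewrite /inner linearZ /= -scalemxAr -!scalemxAl scalerA -expr2 mxE.
  by nra.
have E1 : (\int[Pr]_(w in stability_event) (lyapunov (th n.+1 w) + g * c)%:E =
   (mean_lyapunov n.+1 + g * c)%:E)%E.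
  have := mean_lyapunov_affine n.+1 (- 1) (g * c).
  by rewrite mulN1r opprK [in RHS]addrC => <-; apply: eq_integral => w _;
     rewrite mulN1r opprK addrC.
rewrite E1 ge0_integralD // in HS; last 4 first.
- by move=> w _; rewrite lee_fin lyapunov_ge0.
- apply/measurable_EFinP.
  by have /integrableP[/measurable_EFinP] := integrable_lyapunov n.
- by move=> w Ew; rewrite -EFinM lee_fin mulr_ge0 ?(ltW g0) // increment_ge0 //; exact: Ew.
- by apply: emeasurable_funM => //; exact/measurable_EFinP.
rewrite ge0_integralZl // in HS; last 3 first.
- exact/measurable_EFinP.
- by move=> w Ew; rewrite lee_fin increment_ge0 //; exact: Ew.
- by rewrite lee_fin ltW.
have HS2 := le_trans HS (leeD2l _ (lee_wpmul2l _ HF)).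
have := HS2 _; rewrite lee_fin (ltW g0) => /(_ isT).
rewrite mean_lyapunovE -EFinM -EFinD lee_fin.
by nra.
Qed.

End Increment.

Lemma mean_lyapunov_rate (a : R) : 1 < beta * a ->
  (forall n, gamma n.+1 = a / n.+1%:R) ->
  exists C, \forall n \near \oo, mean_lyapunov n <= C / n%:R.
Proof.
move=> ba ga; have [C C0 HC] := lyapunov_step.
have [m [m0 _ _ wm]] := stable_bounds.
apply: (@chung R mean_lyapunov (beta * a) (C * CV * a ^+ 2)) => //.
- by rewrite mulr_ge0 ?sqr_ge0 // mulr_ge0 // ltW.
- exact: mean_lyapunov_ge0.
move=> n; have := mean_lyapunov_step n C0 wm HC; rewrite ga.
by rewrite mulrA expr_div_n mulrA.
Qed.

Lemma mean_square_dist n (o : M) (L : R) : 0 <= L ->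
  (forall p, S p -> (dist p o ^+ 2 <= (L * D p)%:E)%E) ->
  (\int[Pr]_w (dist (th n w) o ^+ 2) <= (L * mean_lyapunov n)%:E)%E.
Proof.
move=> L0 HL; have mE := measurable_stability_event.
have mN := measurableC mE.
(* Off the stability event the distance is bounded only by +oo; since that set is null, [f1 + f2] is
   a measurable majorant at every point and costs nothing there. *)
pose f1 := (fun w => (L * lyapunov (th n w))%:E) \_ stability_event.
pose f2 := (cst +oo%E : Omega -> \bar R) \_ (~` stability_event).
have f10 w : (0 <= f1 w)%E.
  by rewrite /f1 patchE; case: ifP => // _; rewrite lee_fin mulr_ge0 // lyapunov_ge0.
have f20 w : (0 <= f2 w)%E by rewrite /f2 patchE; case: ifP => // _; rewrite leey.
have mf1 : measurable_fun [set: Omega] f1.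
  apply/(measurable_restrictT _ mE).1/measurable_EFinP; apply: measurable_funM => //.
  by have /integrableP[/measurable_EFinP] := integrable_lyapunov n.
have mf2 : measurable_fun [set: Omega] f2.
  by apply/(measurable_restrictT _ mN).1; exact: measurable_cst.
apply: (@le_trans _ _ (\int[Pr]_w (f1 w + f2 w))%E).
  apply: ge0_le_integral_nomeas => w _; first by rewrite expe_ge0 ?dist_ge0.
  rewrite /f1 /f2 !patchE in_setC; case: (boolP (w \in _)) => /= [/set_mem Ew|_].
    rewrite adde0; apply: (le_trans (HL _ (Ew n I))).
    by rewrite lee_fin ler_wpM2l // le_lyapunov.
  by rewrite add0e leey.
rewrite ge0_integralD //.
have -> : (\int[Pr]_w f2 w = 0)%E.
  by rewrite -integral_mkcond integral_cst // [X in (_ * X)%E]unstable_null mule0.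
rewrite adde0 -integral_mkcond.
under eq_integral do rewrite EFinM.
by rewrite integralZl //; [rewrite mean_lyapunovE|exact: integrable_lyapunov].
Qed.

End MeanSquare.

Theorem proposition3p2
  (R : realType) (r d : nat) (Theta : riemannian_manifold R r d)
  (dX dO : measure_display)
  (X : measurableType dX) (Omega : measurableType dO)
  (Pth : Theta -> probability X R) (Pr : probability Omega R)
  (ths : Theta) (Div : probability X R -> probability X R -> R)
  (u : Theta -> X -> 'rV[R]_d)
  (x : nat -> Omega -> X) (gamma : nat -> R)
  (th0 : Theta) (th : nat -> Omega -> Theta)
  (Ths : set Theta)
  (e : 'M[R]_d) (kappa : Theta -> 'rV[R]_d) (nu : 'rV[R]_d -> Theta)
  (lam a : R) :
  let D := fun th : Theta => Div (Pth ths) (Pth th) in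
  let H := hessian (D \o nu) 0 in
  (3 < r)%N ->
  (* the observations *)
  measure_is_complete Pr ->
  iid Pr (Pth ths) (fun n => x n.+1) ->
  (* the divergence function *)
  (forall th, 0 <= D th) ->
  (forall th, D th = 0 <->
     forall B : set X, measurable B -> Pth th B = Pth ths B) ->
  (forall th, differentiable_at D th) ->
  (* the vector field u *)
  (forall y, continuous_field (fun th => u th y)) ->
  (forall th, has_mean (Pth ths) (u th) (- grad D th)) ->
  (* the algorithm *)
  step_sizes gamma ->
  (forall n, statistic x n (th n)) ->
  (forall w, th 0%N w = th0) ->
  (forall n w, is_Exp (th n w) (gamma n.+1 *: u (th n w) (x n.+1 w))
                 (th n.+1 w)) ->
  (* the neighbourhood Theta^* and its normal coordinates *)
  nbhs ths Ths -> compact Ths -> geodesically_convex Ths ->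
  normal_coordinates Ths ths e kappa nu ->
  (* isolated stationary point, Lipschitz gradient *)
  (forall th, Ths th -> (grad D th = 0 <-> th = ths)) ->
  lipschitz_field Ths (grad D) ->
  (* Hessian *)
  twice_differentiable (D \o nu) 0 -> positive_definite H ->
  (* bound on V *)
  (exists C : R, forall th, Ths th ->
     (\int[Pth ths]_y (tnorm th (u th y) ^+ 2)%:E <= C%:E)%E) ->
  (* stability *)
  {ae Pr, forall w, forall n, Ths (th n w)} ->
  (* step sizes a/n *)
  0 < lam -> smallest_eigenvalue H lam -> 1 < 2 * lam * a ->
  (forall n, (0 < n)%N -> gamma n = a / n%:R) ->
  exists C : R, \forall n \near \oo,
    (\int[Pr]_w (dist (th n w) ths ^+ 2) <= (C / n%:R)%:E)%E.
Proof.
move=> D H r3 _ xiid D_ge0 DP Dd uc um [gamma_gt0 _ _ _] thS _ thE Sths Scomp Sc Hn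
  stat DL f2 Hpd [C0 uC] stable lam0 Hlam la ga.
have D0 : D ths = 0 by apply/DP.
have Tths : Ths ths by exact: nbhs_singleton.
have uV p : Ths p -> (\int[Pth ths]_y (tnorm p (u p y) ^+ 2)%:E <= `|C0|%:E)%E.
  by move=> Sp; apply: (le_trans (uC p Sp)); rewrite lee_fin ler_norm.
have a0 : 0 < a by have := gamma_gt0 1%N isT; rewrite ga // divr1.
(* The midpoint of 1 / a and 2 lambda: below 2 lambda for the drift, above 1 / a for the
   recursion. *)
pose beta := (a^-1 + 2 * lam) / 2.
have ia : a^-1 < 2 * lam by rewrite -(ltr_pM2r a0) mulVf ?gt_eqF.
have beta0 : 0 < beta by rewrite divr_gt0 // addr_gt0 ?invr_gt0 // mulr_gt0.
have beta_lam : beta < 2 * lam by rewrite /beta; lra.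
have beta_a : 1 < beta * a.
  rewrite -[X in X < _](@mulVf _ a) ?gt_eqF // ltr_pM2r //.
  by rewrite /beta; lra.
have Db := grad_bound um uV.
have [K K0 HK] := drift r3 Dd D_ge0 Sc Scomp DL Db Hn Tths D0 stat f2 Hpd lam0 Hlam
  beta0 beta_lam.
have [L L0 HL] := dist_sqr_le r3 Dd D_ge0 Scomp Hn Tths D0 stat f2 Hpd lam0 Hlam.
have g0 n : 0 < gamma n.+1 by exact: gamma_gt0.
have gE n : gamma n.+1 = a / n.+1%:R by exact: ga.
have [C HC] := mean_lyapunov_rate r3 Dd D_ge0 Sc Scomp DL uc um uV xiid g0 thS thE
  stable beta0 K0 HK (normr_ge0 C0) beta_a gE.
exists (L * C); near=> n.
apply: (le_trans (mean_square_dist Dd D_ge0 Scomp xiid thS stable K0 n (ltW L0) HL)).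
rewrite lee_fin -mulrA ler_wpM2l //; first exact: ltW.
by near: n; exact: HC.
Unshelve. all: by end_near. Qed.
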